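(* Let $\zeta_n=e^{2\pi i/n}$, $\underline{\mathcal O}_n={\mathbf Z}[\zeta_n+\zeta_n^{-1}]$ and $\underline{R}_n=\underline{\mathcal O}_n[1/2]$, with $n\ge 8$. (a) If $n=2^s$, then every totally positive unit of $\underline{\mathcal O}_n$ is a square in $\underline{\mathcal O}_n^\times$, the narrow class number $\tilde h(\underline{\mathcal O}_n)$ and the class number $h(\underline{\mathcal O}_n)$ are odd, and $\underline{R}_{n+}^\times/(\underline{R}_n^\times)^2\cong{\mathbf Z}/2{\mathbf Z}$. (b) If $n=3\cdot 2^s$, then $h(\underline{\mathcal O}_n)=\tilde h(\underline{R}_n)$ is odd, $\tilde h(\underline{\mathcal O}_n)=2h(\underline{\mathcal O}_n)$ (so $\tilde h(\underline{\mathcal O}_n)\equiv 2\pmod 4$), and $\underline{R}_{n+}^\times/(\underline{R}_n^\times)^2\cong{\mathbf Z}/2{\mathbf Z}$.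
   Context: $\underline{R}_{n+}^\times$ denotes the group of totally positive units of $\underline{R}_n$; $\tilde h$ denotes the narrow class number. *)

(* Defs.v *)
From HB Require Import structures.
From mathcomp Require Import all_boot all_order all_algebra all_field.
Set Implicit Arguments. Unset Strict Implicit. Unset Printing Implicit Defensive.
Import Order.TTheory GRing.Theory Num.Theory.
Local Open Scope ring_scope.

(* zeta_n = e^{2 pi i / n}: n.-root (-1) is the n-th root of -1 with minimal
   nonnegative argument, i.e. e^{i pi / n}; its square is e^{2 pi i / n}. *)
Definition zeta (n : nat) : algC := (n.-root (-1)) ^+ 2.

Definition eta (n : nat) : algC := zeta n + (zeta n)^-1.

Definition Oring (n : nat) (x : algC) : Prop :=
  exists p : {poly int}, x = (map_poly (fun z : int => z%:~R) p).[eta n].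

Definition Rring (n : nat) (x : algC) : Prop :=
  exists k : nat, Oring n (2 ^+ k * x).

Definition is_unit_in (S : algC -> Prop) (x : algC) : Prop :=
  S x /\ exists y, S y /\ x * y = 1.

(* totally positive: every embedding (= restriction of an automorphism of the
   algebraic closure algC) sends x to a positive real number *)
Definition totpos (x : algC) : Prop :=
  forall nu : {rmorphism algC -> algC}, 0 < nu x.

Definition nz_ideal (S : algC -> Prop) (I : algC -> Prop) : Prop :=
  (forall x, I x -> S x) /\ I 0 /\
  (forall x y, I x -> I y -> I (x + y)) /\
  (forall r x, S r -> I x -> I (r * x)) /\
  (exists x, I x /\ x != 0).

Definition scale_set (a : algC) (I : algC -> Prop) : algC -> Prop :=
  fun x => exists y, I y /\ x = a * y.

Definition same_set (A B : algC -> Prop) : Prop := forall x, A x <-> B x.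

Definition ideal_equiv (S : algC -> Prop) (I J : algC -> Prop) : Prop :=
  exists a b, S a /\ S b /\ a != 0 /\ b != 0 /\
    same_set (scale_set a I) (scale_set b J).

(* narrow equivalence: J = c I with c = b/a totally positive
   (equivalently a*b totally positive) *)
Definition narrow_equiv (S : algC -> Prop) (I J : algC -> Prop) : Prop :=
  exists a b, S a /\ S b /\ a != 0 /\ b != 0 /\ totpos (a * b) /\
    same_set (scale_set a I) (scale_set b J).

Definition num_classes (S : algC -> Prop)
    (eqv : (algC -> Prop) -> (algC -> Prop) -> Prop) (h : nat) : Prop :=
  exists reps : 'I_h -> (algC -> Prop),
    (forall i, nz_ideal S (reps i)) /\
    (forall i j, eqv (reps i) (reps j) -> i = j) /\
    (forall I, nz_ideal S I -> exists i, eqv I (reps i)).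

Definition class_number (S : algC -> Prop) (h : nat) : Prop :=
  num_classes S (ideal_equiv S) h.

Definition narrow_class_number (S : algC -> Prop) (h : nat) : Prop :=
  num_classes S (narrow_equiv S) h.

Definition tp_unit (S : algC -> Prop) (u : algC) : Prop :=
  is_unit_in S u /\ totpos u.

Definition tp_units_mod_squares_card (S : algC -> Prop) (k : nat) : Prop :=
  exists reps : 'I_k -> algC,
    (forall i, tp_unit S (reps i)) /\
    (forall i j v, is_unit_in S v -> reps i = reps j * v ^+ 2 -> i = j) /\
    (forall u, tp_unit S u -> exists i v, is_unit_in S v /\ u = reps i * v ^+ 2).

(* Main.v *)
From Stdlib Require Import Classical.
Require Import Defs.
From mathcomp Require Import all_boot all_order all_algebra all_field.
From mathcomp Require Import ring zify.
Set Implicit Arguments. Unset Strict Implicit. Unset Printing Implicit Defensive.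
Import Order.TTheory GRing.Theory Num.Theory.
Local Open Scope ring_scope.

(** Write [z] for a primitive root of order [n], [e = z + 1/z] and
    [f = z^2 + 1/z^2], so that [e^2 = 2 + f]; let [R] and [T] be the rings
    [Z[1/2, f]] and [Z[1/2, e]].  Then [T = R + R e] with [2] and [e^2] units of
    [R], so [T] is etale over [R] and conjugation-stable [T]-modules descend to
    [R].  Everything is proved by climbing this tower of quadratic extensions,
    from [n = 4] (the rationals) or [n = 12] ([Q(sqrt 3)], which is Euclidean).

    The induction carries two facts: a fractional ideal with principal square is
    principal, and every totally positive unit is a square up to the factor
    [2 + f].  If [b] is totally positive with [N b] a square, Hilbert 90 writes
    [b = w x^2] with [w] in the base field; this turns a totally positive unit,
    or a generator of [M^2], into data over [R], where descent applies.  All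
    signatures are realised by products of conjugates of [-(1 + e)], because
    the norm of [-(1 + e)] is [-(1 + f)].

    The class number is finite by Dirichlet approximation, and odd because
    inversion of classes is an involution whose only fixed point is the trivial
    class.  The only prime above [2] is generated by [p = 2 + e] when [n = 2^s]
    and by [p = 1 + e] when [n = 3 * 2^s], so inverting [2] does not change the
    class number.  When [n = 3 * 2^s] the element [2 + e] is a unit, no unit
    times [p] is totally positive, and the narrow classes are those of [J] and
    [p J] for [J] running over the classes. *)

(** * Modules over subrings *)

(** Why [2 + f] is the right exceptional class: it is totally positive and equals [e^2], so the
    defect at one level becomes a square at the next, where [2 + e] takes its place. The induction
    closes because the norm of [2 + e] is [2 - f], which is [2 + f] times the square of a unit.
    Descent needs both [2] and [e^2] to be invertible. The first is never a unit of the ring of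
    integers, nor is the second when n is a power of two; hence the detour through [Z[1/2, e]], with
    orders at the prime above 2 to come back. From order 6 to order 12 one has [e^2 = 3], which
    stays a non-unit after inverting 2. That step is ramified at 3, so the second family cannot
    start from the rationals and its bottom ring is treated by hand, with Pell equations. The two
    families part at the signatures: at the bottom, [-(1 + e)] is -1 for order 4 but -2 for order 6,
    a unit only once 2 is inverted. Hence the factor 2 in the narrow class number of the second
    family. *)

Notation pset := (algC -> Prop).

Definition is_subring (S : pset) : Prop :=
  [/\ S 1, (forall x y, S x -> S y -> S (x - y))
     & (forall x y, S x -> S y -> S (x * y))].

Definition fracset (S : pset) : pset :=
  fun x => exists a b, [/\ S a, S b, b != 0 & x = a / b].

Definition submodule (S M : pset) : Prop :=
  [/\ M 0, (forall x y, M x -> M y -> M (x + y))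
     & (forall r x, S r -> M x -> M (r * x))].

Inductive module_prod (M N : pset) : pset :=
| module_prodM x y : M x -> N y -> module_prod M N (x * y)
| module_prodD x y : module_prod M N x -> module_prod M N y ->
                     module_prod M N (x + y).

Section Subring.
Variable S : pset.
Hypothesis Sring : is_subring S.

Lemma subring1 : S 1. Proof. by case: Sring. Qed.
Lemma subringB x y : S x -> S y -> S (x - y). Proof. by case: Sring => _ + _; apply. Qed.
Lemma subringM x y : S x -> S y -> S (x * y). Proof. by case: Sring => _ _; apply. Qed.
Lemma subring0 : S 0. Proof. by rewrite -(subrr 1); apply: subringB; apply: subring1. Qed.
Lemma subringN x : S x -> S (- x).
Proof. by move=> Sx; rewrite -sub0r; apply: subringB => //; apply: subring0. Qed.
Lemma subringD x y : S x -> S y -> S (x + y).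
Proof. by move=> Sx Sy; rewrite -(opprK y); apply: subringB => //; apply: subringN. Qed.
Lemma subring_nat n : S n%:R.
Proof.
elim: n => [|n IH]; first exact: subring0.
by rewrite -natr1; apply: subringD => //; apply: subring1.
Qed.
Lemma subring_int (z : int) : S z%:~R.
Proof. by case: z => n; [|rewrite NegzE mulrNz; apply: subringN]; apply: subring_nat. Qed.
Lemma subringX x n : S x -> S (x ^+ n).
Proof.
move=> Sx; elim: n => [|n IH]; first exact: subring1.
by rewrite exprS; apply: subringM.
Qed.

Lemma submodule_self : submodule S S.
Proof. by split; [apply: subring0 | apply: subringD | apply: subringM]. Qed.

Lemma unit_in1 : is_unit_in S 1.
Proof. by split; [apply: subring1 | exists 1; rewrite mulr1; split=> //; apply: subring1]. Qed.
Lemma unit_inM x y : is_unit_in S x -> is_unit_in S y -> is_unit_in S (x * y).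
Proof.
move=> [Sx [x' [Sx' xx]]] [Sy [y' [Sy' yy]]]; split; first exact: subringM.
by exists (x' * y'); split; [apply: subringM | rewrite mulrACA xx yy mulr1].
Qed.
Lemma unit_inX x n : is_unit_in S x -> is_unit_in S (x ^+ n).
Proof.
move=> Ux; elim: n => [|n IH]; first exact: unit_in1.
by rewrite exprS; apply: unit_inM.
Qed.
Lemma unit_in_neq0 x : is_unit_in S x -> x != 0.
Proof.
by move=> [_ [y [_ xy]]]; apply/eqP=> x0; move/eqP: xy; rewrite x0 mul0r eq_sym oner_eq0.
Qed.
Lemma unit_in_invr x : is_unit_in S x -> S x^-1.
Proof.
move=> Ux; have x0 := unit_in_neq0 Ux; case: Ux => Sx [y [Sy xy]].
by rewrite -[x^-1]mulr1 -xy mulKf.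
Qed.
Lemma unit_inP x : S x -> S x^-1 -> x != 0 -> is_unit_in S x.
Proof. by move=> Sx Sx' x0; split=> //; exists x^-1; rewrite mulfV. Qed.
Lemma unit_inV x : is_unit_in S x -> is_unit_in S x^-1.
Proof.
move=> Ux; apply: unit_inP; [exact: unit_in_invr| | by rewrite invr_eq0 unit_in_neq0].
by rewrite invrK; case: Ux.
Qed.
Lemma unit_inN x : is_unit_in S x -> is_unit_in S (- x).
Proof.
move=> [Sx [y [Sy xy]]]; split; first exact: subringN.
by exists (- y); split; [apply: subringN | rewrite mulrNN].
Qed.
Lemma unit_in_div x y z : S x -> S y -> x * y = z -> is_unit_in S z -> is_unit_in S x.
Proof.
move=> Sx Sy xyz Uz; have z0 := unit_in_neq0 Uz; split=> //.
exists (y * z^-1); split; first by apply: subringM => //; apply: unit_in_invr.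
by rewrite mulrA xyz mulfV.
Qed.

Lemma frac_sub x : S x -> fracset S x.
Proof.
by move=> Sx; exists x, 1; split=> //; [apply: subring1|apply: oner_neq0|rewrite divr1].
Qed.
Lemma frac_is_subring : is_subring (fracset S).
Proof.
split; first by apply: frac_sub; apply: subring1.
  move=> _ _ [a [b [Sa Sb b0 ->]]] [c [d [Sc Sd d0 ->]]].
  exists (a * d - c * b), (b * d); split; last by field; rewrite b0 d0.
  - by apply: subringB; apply: subringM.
  - exact: subringM.
  - by rewrite mulf_neq0.
move=> _ _ [a [b [Sa Sb b0 ->]]] [c [d [Sc Sd d0 ->]]].
exists (a * c), (b * d); split; last by field; rewrite b0 d0.
- exact: subringM.
- exact: subringM.
- by rewrite mulf_neq0.
Qed.
Lemma fracV x : fracset S x -> fracset S x^-1.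
Proof.
move=> [a [b [Sa Sb b0 ->]]]; have [->|a0] := eqVneq a 0.
  by rewrite mul0r invr0; apply: frac_sub; apply: subring0.
by exists b, a; split=> //; rewrite invf_div.
Qed.
End Subring.

Lemma fracM S x y : is_subring S -> fracset S x -> fracset S y -> fracset S (x * y).
Proof. by move=> /frac_is_subring H; apply: subringM. Qed.
Lemma fracD S x y : is_subring S -> fracset S x -> fracset S y -> fracset S (x + y).
Proof. by move=> /frac_is_subring H; apply: subringD. Qed.
Lemma fracB S x y : is_subring S -> fracset S x -> fracset S y -> fracset S (x - y).
Proof. by move=> /frac_is_subring H; apply: subringB. Qed.

Lemma same_setP (A B : pset) :
  (forall x, A x -> B x) -> (forall x, B x -> A x) -> same_set A B.
Proof. by move=> AB BA x; split; [apply: AB | apply: BA]. Qed.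

Section ModuleProd.
Variable S : pset.
Hypothesis Sring : is_subring S.
Implicit Types M N P : pset.

Lemma module_prod_ind_sub M N (P : pset) :
    (forall x y, P x -> P y -> P (x + y)) ->
    (forall x y, M x -> N y -> P (x * y)) ->
  forall x, module_prod M N x -> P x.
Proof. by move=> PD PM x; elim=> // {}x y _ Px _ Py; apply: PD. Qed.

Lemma submodule_prod M N : submodule S M -> submodule S N -> submodule S (module_prod M N).
Proof.
move=> [M0 MD MZ] [N0 ND NZ]; split.
- by rewrite -(mul0r 0); apply: module_prodM.
- exact: module_prodD.
- move=> r x Sr; elim=> [{}x y Mx Ny|{}x y _ IHx _ IHy].
    by rewrite mulrA; apply: module_prodM => //; apply: MZ.
  by rewrite mulrDr; apply: module_prodD.
Qed.

Lemma module_prodC M N x : module_prod M N x -> module_prod N M x.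
Proof.
elim=> [{}x y Mx Ny|{}x y _ IHx _ IHy]; first by rewrite mulrC; apply: module_prodM.
exact: module_prodD.
Qed.

Lemma module_prod_mono M N M' N' : (forall x, M x -> M' x) -> (forall x, N x -> N' x) ->
  forall x, module_prod M N x -> module_prod M' N' x.
Proof.
move=> MM NN x; elim=> [{}x y Mx Ny|{}x y _ IHx _ IHy].
  by apply: module_prodM; auto.
exact: module_prodD.
Qed.

Lemma module_prodA M N P x :
  module_prod (module_prod M N) P x -> module_prod M (module_prod N P) x.
Proof.
elim=> [{}x y + Py|{}x y _ IHx _ IHy]; last exact: module_prodD.
elim=> [a b Ma Nb|a b _ IHa _ IHb]; last by rewrite mulrDl; apply: module_prodD.
by rewrite -mulrA; apply: module_prodM => //; apply: module_prodM.
Qed.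

Lemma module_prodAr M N P x :
  module_prod M (module_prod N P) x -> module_prod (module_prod M N) P x.
Proof.
elim=> [y {}x My|{}x y _ IHx _ IHy]; last exact: module_prodD.
elim=> [a b Na Pb|a b _ IHa _ IHb]; last by rewrite mulrDr; apply: module_prodD.
by rewrite mulrA; apply: module_prodM => //; apply: module_prodM.
Qed.

Lemma submodule_scale a M : submodule S M -> submodule S (scale_set a M).
Proof.
move=> [M0 MD MZ]; split.
- by exists 0; rewrite mulr0.
- by move=> _ _ [x [Mx ->]] [y [My ->]]; exists (x + y); rewrite mulrDr; auto.
- by move=> r _ Sr [x [Mx ->]]; exists (r * x); rewrite mulrCA; auto.
Qed.

Lemma scale_module_prod a b M N x :
  module_prod (scale_set a M) (scale_set b N) x <-> scale_set (a * b) (module_prod M N) x.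
Proof.
split.
  elim=> [_ _ [y [My ->]] [z [Nz ->]]|{}x y _ [x' [Mx ->]] _ [y' [My ->]]].
    by exists (y * z); rewrite mulrACA; split=> //; apply: module_prodM.
  by exists (x' + y'); rewrite mulrDr; split=> //; apply: module_prodD.
case=> y [+ ->]; elim=> [{}x z Mx Nz|{}x z _ IHx _ IHz].
  by rewrite mulrACA; apply: module_prodM; [exists x | exists z].
by rewrite mulrDr; apply: module_prodD.
Qed.

Lemma scale_set_unit u M : submodule S M -> is_unit_in S u -> same_set (scale_set u M) M.
Proof.
move=> [M0 MD MZ] Uu; apply: same_setP => x; first by case=> y [My ->]; apply: MZ => //; case: Uu.
move=> Mx; exists (u^-1 * x); rewrite mulVKf ?(unit_in_neq0 Uu) //; split=> //.
by apply: MZ => //; apply: unit_in_invr.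
Qed.

Lemma scale_self_unit a b : a != 0 -> b != 0 ->
  same_set (scale_set a S) (scale_set b S) -> exists2 u, is_unit_in S u & a = b * u.
Proof.
move=> a0 b0 E.
have [u [Su]]: scale_set b S a by apply/E; exists 1; rewrite mulr1; split=> //; apply: subring1.
have [v [Sv]]: scale_set a S b by apply/E; exists 1; rewrite mulr1; split=> //; apply: subring1.
move=> bE aE; exists u => //; split=> //; exists v; split=> //.
by apply: (mulfI a0); rewrite mulr1 (mulrC u) mulrA -bE -aE.
Qed.

Lemma nz_ideal_submodule I : nz_ideal S I -> submodule S I.
Proof. by move=> [_ [I0 [ID [IZ _]]]]. Qed.

Lemma nz_idealP I x : submodule S I -> (forall y, I y -> S y) -> I x -> x != 0 -> nz_ideal S I.
Proof. by move=> [I0 ID IZ] IS Ix x0; do 4?[split=> //]; exists x. Qed.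

Lemma nz_ideal_self : nz_ideal S S.
Proof.
by apply: (@nz_idealP _ 1) (submodule_self Sring) _ (subring1 Sring) (oner_neq0 _).
Qed.

Lemma nz_ideal_scale a I : nz_ideal S I -> S a -> a != 0 -> nz_ideal S (scale_set a I).
Proof.
move=> nI Sa a0; have [IS [_ [_ [_ [x [Ix x0]]]]]] := nI.
apply: (@nz_idealP _ (a * x)); last by rewrite mulf_neq0.
- exact/submodule_scale/nz_ideal_submodule.
- by move=> _ [y [Iy ->]]; apply: subringM => //; apply: IS.
- by exists x.
Qed.

Lemma nz_ideal_prod I J : nz_ideal S I -> nz_ideal S J -> nz_ideal S (module_prod I J).
Proof.
move=> nI nJ; have [IS [_ [_ [_ [x [Ix x0]]]]]] := nI.
have [JS [_ [_ [_ [y [Jy y0]]]]]] := nJ.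
apply: (@nz_idealP _ (x * y)); last by rewrite mulf_neq0.
- by apply: submodule_prod; apply: nz_ideal_submodule.
- apply: module_prod_ind_sub => [u v|u v Iu Jv]; first exact: subringD.
  by apply: subringM; auto.
- exact: module_prodM.
Qed.
End ModuleProd.

(** * Equivalence of ideals *)

Lemma ideal_equiv_refl S I : is_subring S -> ideal_equiv S I I.
Proof.
by move=> Sr; exists 1, 1; do 4?[split; first by [apply: subring1|apply: oner_neq0]].
Qed.
Lemma ideal_equiv_sym S I J : ideal_equiv S I J -> ideal_equiv S J I.
Proof.
by move=> [a [b [Sa [Sb [a0 [b0 E]]]]]]; exists b, a; do 4?[split=> //]; move=> x; split=> /E.
Qed.
Lemma scale_setA a b M : same_set (scale_set a (scale_set b M)) (scale_set (a * b) M).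
Proof.
apply: same_setP => x; first by case=> _ [[y [My ->]] ->]; exists y; rewrite mulrA.
by case=> y [My ->]; exists (b * y); rewrite mulrA; split=> //; exists y.
Qed.
Lemma scale_set_same a M N : same_set M N -> same_set (scale_set a M) (scale_set a N).
Proof. by move=> E x; split=> -[y [/E My ->]]; exists y. Qed.
Lemma same_set_sym M N : same_set M N -> same_set N M.
Proof. by move=> E x; split=> /E. Qed.
Lemma same_set_trans M N P : same_set M N -> same_set N P -> same_set M P.
Proof. by move=> E F x; split; [move=> /E /F | move=> /F /E]. Qed.
Lemma scale_setC a b M : same_set (scale_set a (scale_set b M)) (scale_set b (scale_set a M)).
Proof.
by move=> x; split=> /scale_setA; rewrite mulrC => /scale_setA.
Qed.
Lemma scale_set_inj a M N : a != 0 -> same_set (scale_set a M) (scale_set a N) -> same_set M N.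
Proof.
move=> a0 E x; split=> Mx.
  by have [|y [Ny /(mulfI a0) ->]] := (E (a * x)).1 _; first by exists x.
by have [|y [Ny /(mulfI a0) ->]] := (E (a * x)).2 _; first by exists x.
Qed.
Lemma ideal_equiv_trans S I J K : is_subring S ->
  ideal_equiv S I J -> ideal_equiv S J K -> ideal_equiv S I K.
Proof.
move=> Sr [a [b [Sa [Sb [a0 [b0 E]]]]]] [c [d [Sc [Sd [c0 [d0 F]]]]]].
exists (c * a), (b * d).
do 2![split; first by apply: subringM]; do 2![split; first by rewrite mulf_neq0].
apply: same_set_trans (same_set_sym (@scale_setA c a I)) _.
apply: same_set_trans (scale_set_same c E) _.
apply: same_set_trans (@scale_setC c b J) _.
apply: same_set_trans (scale_set_same b F) _.
exact: scale_setA.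
Qed.

(** * Quadratic towers *)

Definition totreal (x : algC) : Prop :=
  forall nu : {rmorphism algC -> algC}, nu x \is Num.real.

Lemma totpos_neq0 x : totpos x -> x != 0.
Proof. by move=> /(_ idfun) /=; apply: lt0r_neq0. Qed.
Lemma totposM x y : totpos x -> totpos y -> totpos (x * y).
Proof. by move=> px py nu; rewrite rmorphM mulr_gt0. Qed.
Lemma totposD x y : totpos x -> totpos y -> totpos (x + y).
Proof. by move=> px py nu; rewrite rmorphD addr_gt0. Qed.
Lemma totposV x : totpos x -> totpos x^-1.
Proof. by move=> px nu; rewrite fmorphV invr_gt0. Qed.
Lemma totpos_sqr x : totreal x -> x != 0 -> totpos (x ^+ 2).
Proof. by move=> rx x0 nu; rewrite rmorphXn real_exprn_even_gt0 //= fmorph_eq0. Qed.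
Lemma totpos_morph (s : {rmorphism algC -> algC}) x : totpos x -> totpos (s x).
Proof. by move=> px nu; apply: (px (nu \o s)). Qed.
Lemma totposMr x y : totpos y -> totpos (x * y) -> totpos x.
Proof. by move=> py pxy; rewrite -(mulfK (totpos_neq0 py) x); apply/totposM/totposV. Qed.

(** The class group has no element of order two. Fractional submodules are allowed so that [M] may
    be rescaled by any field element during the descent; [M M = b S] makes [M] invertible by
    itself. *)
Definition no_two_torsion (S : pset) : Prop :=
  forall M b, submodule S M -> (forall x, M x -> fracset S x) -> b != 0 ->
    same_set (module_prod M M) (scale_set b S) ->
  exists g, g != 0 /\ same_set M (scale_set g S).

(** The Dedekind property, with inverses taken up to principal factors. *)
Definition invertible_ideals (S : pset) : Prop :=
  forall I, nz_ideal S I -> exists J g,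
    [/\ nz_ideal S J, g != 0 & same_set (module_prod I J) (scale_set g S)].

Definition tp_units_gen (S : pset) (d : algC) : Prop :=
  forall u, tp_unit S u ->
    exists v, is_unit_in S v /\ (u = v ^+ 2 \/ u = d * v ^+ 2).

Definition unit_signs (S : pset) : Prop :=
  forall x, fracset S x -> x != 0 -> exists eps, is_unit_in S eps /\ totpos (x * eps).

(** With [I J = g S], the element [x g] lies in [(x I) J], hence in [g S]. Invertibility takes the
    place of the determinant argument for integral elements. *)
Lemma mul_stable_ideal S I x : is_subring S -> invertible_ideals S -> nz_ideal S I ->
  (forall y, I y -> I (x * y)) -> S x.
Proof.
move=> Sr inv nI st; have [J [g [nJ g0 E]]] := inv _ nI.
have: module_prod I J (x * g).
  have: module_prod I J g by apply/E; exists 1; rewrite mulr1; split=> //; apply: subring1.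
  elim=> [u v Iu Jv|u v _ IHu _ IHv]; last by rewrite mulrDr; apply: module_prodD.
  by rewrite mulrA; apply: module_prodM => //; apply: st.
by case/E=> r [Sr' /eqP]; rewrite mulrC => /eqP /(mulfI g0) ->.
Qed.

(** Integral closedness for square roots: the [y] in [S] with [x y] in [S] form a nonzero ideal,
    stable under [x] because [x^2] is in [S]. *)
Lemma subring_sqrt S x : is_subring S -> invertible_ideals S -> fracset S x ->
  S (x ^+ 2) -> S x.
Proof.
move=> Sr inv [a [b [Sa Sb b0 xE]]] Sx2.
apply: (@mul_stable_ideal S (fun y => S y /\ S (x * y))) => //.
  apply: (@nz_idealP _ _ b) => //; last 1 first.
  - by split=> //; rewrite xE divfK.
  - split.
    + by rewrite mulr0; split; apply: subring0.
    + by move=> y z [Sy Sxy] [Sz Sxz]; rewrite mulrDr; split; apply: subringD.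
    + by move=> r y Sr' [Sy Sxy]; rewrite mulrCA; split; apply: subringM.
  - by move=> y [].
by move=> y [Sy Sxy]; split=> //; rewrite mulrA -expr2; apply: subringM.
Qed.

(** Conjugation is an automorphism of all of [algC]. As it fixes [R] and negates [e], the components
    of [a + b e] are unique; this is how the degree two enters. *)
Record tower (R T : pset) (s : {rmorphism algC -> algC}) (e : algC) : Prop := Tower {
  tower_base : is_subring R;
  tower_top : is_subring T;
  tower_topE : forall x, T x <-> exists a b, [/\ R a, R b & x = a + b * e];
  tower_fix : forall x, R x -> s x = x;
  tower_gen : s e = - e;
  tower_gen0 : e != 0;
  tower_sqr : R (e ^+ 2) }.

Section Tower.
Variables (R T : pset) (s : {rmorphism algC -> algC}) (e : algC).
Hypothesis tw : tower R T s e.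

Let Rr : is_subring R. Proof. by case: tw. Qed.
Let Tr : is_subring T. Proof. by case: tw. Qed.
Let e0 : e != 0. Proof. by case: tw. Qed.
Let two0 : (2 : algC) != 0. Proof. by rewrite pnatr_eq0. Qed.
Hint Resolve Rr Tr e0 two0 : core.

Lemma tower_sub x : R x -> T x.
Proof.
move=> Rx; apply/(tower_topE tw); exists x, 0; split=> //; first exact: subring0.
by rewrite mul0r addr0.
Qed.
Lemma tower_sub_frac x : fracset R x -> fracset T x.
Proof. by move=> [a [b [Ra Rb b0 ->]]]; exists a, b; split=> //; apply: tower_sub. Qed.
Lemma tower_mem_gen : T e.
Proof.
apply/(tower_topE tw); exists 0, 1; rewrite mul1r add0r.
by split=> //; [apply: subring0 | apply: subring1].
Qed.
Lemma tower_fix_frac x : fracset R x -> s x = x.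
Proof. by move=> [a [b [Ra Rb b0 ->]]]; rewrite fmorph_div /= !(tower_fix tw). Qed.
Lemma tower_morph x : T x -> T (s x).
Proof.
move=> /(tower_topE tw)[a [b [Ra Rb ->]]]; apply/(tower_topE tw).
exists a, (- b); split=> //; first exact: subringN.
by rewrite rmorphD rmorphM /= (tower_gen tw) (tower_fix tw Ra) (tower_fix tw Rb) mulrN mulNr.
Qed.
Lemma tower_morphK x : T x -> s (s x) = x.
Proof.
move=> /(tower_topE tw)[a [b [Ra Rb ->]]].
rewrite rmorphD rmorphM /= (tower_gen tw) (tower_fix tw Ra) (tower_fix tw Rb) mulrN.
by rewrite rmorphB rmorphM /= (tower_gen tw) (tower_fix tw Ra) (tower_fix tw Rb) mulrN opprK.
Qed.
Lemma tower_morph_frac x : fracset T x -> fracset T (s x).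
Proof.
move=> [a [b [Ta Tb b0 ->]]]; rewrite fmorph_div /=; exists (s a), (s b).
by split=> //; [apply: tower_morph | apply: tower_morph | rewrite fmorph_eq0].
Qed.
Lemma tower_morphK_frac x : fracset T x -> s (s x) = x.
Proof. by move=> [a [b [Ta Tb b0 ->]]]; rewrite !fmorph_div /= !tower_morphK. Qed.

Lemma tower_fixed_split a b : s a = a -> s b = b -> s (a + b * e) = a + b * e -> b = 0.
Proof.
move=> sa sb; rewrite rmorphD rmorphM /= sa sb (tower_gen tw) mulrN => /addrI /eqP.
rewrite eq_sym -subr_eq0 opprK -mulr2n -mulr_natl !mulf_eq0 (negPf two0) (negPf e0) orbF /=.
by move/eqP.
Qed.

Lemma tower_fixed x : T x -> s x = x -> R x.
Proof.
move=> /(tower_topE tw)[a [b [Ra Rb ->]]] sx.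
by rewrite (tower_fixed_split (tower_fix tw Ra) (tower_fix tw Rb) sx) mul0r addr0.
Qed.
Lemma tower_norm x : T x -> R (x * s x).
Proof.
move=> Tx; apply: tower_fixed; first by apply: subringM => //; apply: tower_morph.
by rewrite rmorphM /= tower_morphK // mulrC.
Qed.
(** Denominators are rationalised: [u / v = u s(v) / N(v)], and [N(v) = v s(v)] lies in [R]. *)
Lemma tower_split_frac x : fracset T x -> exists a b, [/\ fracset R a, fracset R b & x = a + b * e].
Proof.
move=> [u [v [Tu Tv v0 ->]]].
have sv0 : s v != 0 by rewrite fmorph_eq0.
have /(tower_topE tw)[a [b [Ra Rb uv]]]: T (u * s v) by apply: subringM => //; apply: tower_morph.
have RN := tower_norm Tv; have N0 : v * s v != 0 by rewrite mulf_neq0.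
exists (a / (v * s v)), (b / (v * s v)); split.
- by exists a, (v * s v).
- by exists b, (v * s v).
by rewrite mulrAC -mulrDl -uv; field; rewrite v0 sv0.
Qed.
Lemma tower_fixed_frac x : fracset T x -> s x = x -> fracset R x.
Proof.
move=> /tower_split_frac[a [b [Ra Rb ->]]] sx.
by rewrite (tower_fixed_split (tower_fix_frac Ra) (tower_fix_frac Rb) sx) mul0r addr0.
Qed.
Lemma tower_norm_frac x : fracset T x -> fracset R (x * s x).
Proof.
move=> Tx; apply: tower_fixed_frac; first by apply: fracM => //; apply: tower_morph_frac.
by rewrite rmorphM /= tower_morphK_frac // mulrC.
Qed.
Lemma tower_norm_unit x : is_unit_in T x -> is_unit_in R (x * s x).
Proof.
move=> [Tx [y [Ty xy]]]; split; first exact: tower_norm.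
exists (y * s y); split; first exact: tower_norm.
by rewrite mulrACA -rmorphM xy rmorph1 mulr1.
Qed.
Lemma tower_unit x : is_unit_in R x -> is_unit_in T x.
Proof.
by move=> [Rx [y [Ry xy]]]; split; [|exists y; split=> //]; apply: tower_sub.
Qed.

(* Hilbert 90 for [b / g], with [g + b] as the explicit solution. *)
Lemma square_of_square_norm b g : fracset T b -> b != 0 -> fracset R g -> g != 0 ->
    b * s b = g ^+ 2 ->
  exists w x, [/\ fracset R w, fracset T x, w != 0, x != 0 & b = w * x ^+ 2].
Proof.
move=> Tb b0 Rg g0 Nb; have [/eqP|] := eqVneq (g + b) 0.
  rewrite addrC addr_eq0 => /eqP ->; exists (- g), 1; split=> //.
  - by rewrite -sub0r; apply: fracB => //; apply/frac_sub => //; apply: subring0.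
  - by apply: frac_sub => //; apply: subring1.
  - by rewrite oppr_eq0.
  - by rewrite oner_eq0.
  - by rewrite expr1n mulr1.
(* Here [s(c) b = g b + g^2 = g c], so [b = g c / s(c) = (g / N(c)) c^2]. *)
set c := g + b => c0.
have Tc : fracset T c by apply: fracD => //; apply: tower_sub_frac.
have sc0 : s c != 0 by rewrite fmorph_eq0.
have scE : s c * b = c * g by rewrite rmorphD /= tower_fix_frac // mulrDl [s b * b]mulrC Nb /c; ring.
exists (g / (c * s c)), c; split=> //.
- by apply: fracM => //; apply: fracV => //; apply: tower_norm_frac.
- by rewrite mulf_neq0 // invr_eq0 mulf_neq0.
apply: (mulfI sc0); rewrite scE.
by field; rewrite c0 sc0.
Qed.

Definition module_conj (M : pset) : pset := fun x => exists2 y, M y & x = s y.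
Definition module_ext (J : pset) : pset :=
  fun x => exists a b, [/\ J a, J b & x = a + b * e].
Definition module_fixed (P : pset) : pset := fun x => P x /\ s x = x.

Lemma submodule_conj M : submodule T M -> submodule T (module_conj M).
Proof.
move=> [M0 MD MZ]; split.
- by exists 0; rewrite ?rmorph0.
- by move=> _ _ [x Mx ->] [y My ->]; exists (x + y); rewrite ?rmorphD //; apply: (MD).
- move=> r _ Tr' [x Mx ->]; exists (s r * x); last by rewrite rmorphM /= tower_morphK.
  by apply: (MZ) => //; apply: tower_morph.
Qed.

Lemma submodule_ext J : submodule R J -> submodule T (module_ext J).
Proof.
move=> [J0 JD JZ]; split.
- by exists 0, 0; rewrite mul0r addr0.
- move=> _ _ [a [b [Ja Jb ->]]] [c [d [Jc Jd ->]]]; exists (a + c), (b + d).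
  by split; [apply: (JD) | apply: (JD) | ring].
- move=> r _ /(tower_topE tw)[p [q [Rp Rq ->]]] [a [b [Ja Jb ->]]].
  exists (p * a + (q * e ^+ 2) * b), (p * b + q * a); split; last by ring.
    by apply: (JD); apply: (JZ) => //; apply: subringM => //; apply: (tower_sqr tw).
  by apply: (JD); apply: (JZ).
Qed.

Section Etale.
Hypothesis half : R 2^-1.
Hypothesis inv_sqr : R (e ^+ 2)^-1.

Let Ve : T e^-1.
Proof.
have -> : e^-1 = (e ^+ 2)^-1 * e by field.
by apply: subringM => //; [apply: tower_sub | apply: tower_mem_gen].
Qed.

Section Stable.
Variable P : pset.
Hypothesis Pm : submodule T P.
Hypothesis PF : forall x, P x -> fracset T x.
Hypothesis Ps : forall x, P x -> P (s x).

Lemma submodule_fixed : submodule R (module_fixed P).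
Proof.
case: Pm => P0 PD PZ; split.
- by split=> //; rewrite rmorph0.
- by move=> x y [Px sx] [Py sy]; split; [apply: (PD) | rewrite rmorphD /= sx sy].
- move=> r x Rr' [Px sx]; split; first by apply: (PZ) => //; apply: tower_sub.
  by rewrite rmorphM /= sx (tower_fix tw).
Qed.

(** Galois descent: [(x + s x) / 2] and [(x - s x) / (2 e)] are fixed by [s], and they stay in [P]
    because [1/2] and [1/e] lie in [T]. *)
Lemma stable_split x : P x ->
  exists a b, [/\ module_fixed P a, module_fixed P b & x = a + b * e].
Proof.
case: Pm => P0 PD PZ Px; have ssx := tower_morphK_frac (PF Px).
have PN y : P y -> P (- y).
  by move=> Py; rewrite -mulN1r; apply: (PZ) => //; apply: (subringN Tr (subring1 Tr)).
exists (2^-1 * (x + s x)), (e^-1 * (2^-1 * (x - s x))).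
split; last by field.
  split; first by apply: (PZ); [apply: tower_sub | apply: (PD) => //; apply: Ps].
  by rewrite rmorphM /= fmorphV rmorph_nat rmorphD /= ssx addrC.
split.
  apply: (PZ) => //; apply: (PZ); first exact: tower_sub.
  by apply: (PD) => //; apply/PN/Ps.
rewrite !rmorphM /= !fmorphV rmorph_nat rmorphB /= ssx (tower_gen tw).
by field.
Qed.

Lemma stable_ext : same_set P (module_ext (module_fixed P)).
Proof.
case: Pm => P0 PD PZ; apply: same_setP => x; first exact: stable_split.
case=> a [b [[Pa _] [Pb _] ->]]; apply: (PD) => //.
by rewrite mulrC; apply: (PZ) => //; apply: tower_mem_gen.
Qed.

(** For the inclusion of [w R], the element [w] of [P P] is expanded as [u + v e] with [u], [v] in
    the square of the fixed part; [w] being fixed, [v = 0]. *)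
Lemma fixed_prod w : s w = w -> w != 0 ->
  same_set (module_prod P P) (scale_set w T) ->
  same_set (module_prod (module_fixed P) (module_fixed P)) (scale_set w R).
Proof.
move=> sw w0 E; set J := module_fixed P.
have Jm : submodule R J := submodule_fixed.
have [JJ0 JJD JJZ] := submodule_prod Jm Jm.
have JJs x : module_prod J J x -> s x = x.
  elim=> [u v [_ su] [_ sv]|u v _ su _ sv]; first by rewrite rmorphM /= su sv.
  by rewrite rmorphD /= su sv.
apply: same_setP => x.
  move=> JJx; have sx := JJs x JJx.
  have /E[r [Tr' xE]]: module_prod P P x.
    by apply: module_prod_mono JJx => y [].
  exists r; split=> //; apply: tower_fixed => //; apply: (mulfI w0).
  by rewrite -{1}sw -rmorphM -xE sx.
case=> r [Rr' ->]; rewrite mulrC; apply: (JJZ) => //.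
have: module_prod P P w by apply/E; exists 1; rewrite mulr1; split=> //; apply: subring1.
have H y : module_prod P P y -> exists u v, [/\ module_prod J J u, module_prod J J v & y = u + v * e].
  elim=> [u v|u v _ [a [b [Ja Jb ->]]] _ [a' [b' [Ja' Jb' ->]]]]; last first.
    by exists (a + a'), (b + b'); split; [apply: (JJD) | apply: (JJD) | ring].
  move=> /stable_split[a [b [Ja Jb ->]]] /stable_split[a' [b' [Ja' Jb' ->]]].
  exists (a * a' + e ^+ 2 * (b * b')), (a * b' + b * a'); split; last by ring.
    apply: (JJD); first exact: module_prodM.
    by apply: (JJZ); [apply: (tower_sqr tw) | apply: module_prodM].
  by apply: (JJD); apply: module_prodM.
case/H=> u [v [Ju Jv wE]]; have: v = 0.
  by apply: (tower_fixed_split (JJs _ Ju) (JJs _ Jv)); rewrite -wE.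
by move=> v0; rewrite wE v0 mul0r addr0.
Qed.

Lemma stable_principal w : no_two_torsion R -> s w = w -> w != 0 ->
    same_set (module_prod P P) (scale_set w T) ->
  exists g, [/\ g != 0, fracset R g & same_set P (scale_set g T)].
Proof.
move=> N2 sw w0 E.
have [x Jx|g [g0 Eg]] := N2 _ _ submodule_fixed _ w0 (fixed_prod sw w0 E).
  by case: Jx => Px sx; apply: tower_fixed_frac => //; apply: PF.
exists g; split=> //.
  have [Pg sg]: module_fixed P g.
    by apply/Eg; exists 1; rewrite mulr1; split=> //; apply: subring1.
  by apply: tower_fixed_frac => //; apply: PF.
apply: same_set_trans stable_ext _; apply: same_setP => x.
  case=> a [b [/Eg[r [Rr' ->]] /Eg[r' [Rr'' ->]] ->]].
  exists (r + r' * e); split; last by ring.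
  by apply/(tower_topE tw); exists r, r'.
case=> _ [/(tower_topE tw)[r [r' [Rr1 Rr2 ->]]] ->].
by exists (g * r), (g * r'); split; [apply/Eg; exists r | apply/Eg; exists r' | ring].
Qed.
End Stable.

(** [I s(I)] is stable under conjugation, hence extended from an ideal of [R]. If [J'] inverts that
    ideal, [s(I) J' T] inverts [I]. *)
Lemma invertible_ideals_step : invertible_ideals R -> invertible_ideals T.
Proof.
move=> inv I nI; have Im := nz_ideal_submodule nI; have sIm := submodule_conj Im.
have [IT [_ [_ [_ [x [Ix x0]]]]]] := nI.
pose P := module_prod I (module_conj I).
have nsI : nz_ideal T (module_conj I).
  apply: (@nz_idealP _ _ (s x)) => //; last by rewrite fmorph_eq0.
    by move=> _ [y Iy ->]; apply/tower_morph/IT.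
  by exists x.
have nP : nz_ideal T P by apply: nz_ideal_prod.
have [PT _] := nP; have Pm := nz_ideal_submodule nP.
have Ps y : P y -> P (s y).
  elim=> [u _ Iu [v Iv ->]|u v _ Pu _ Pv]; last by rewrite rmorphD; apply: module_prodD.
  rewrite rmorphM /= tower_morphK; last exact: IT.
  rewrite mulrC.
  by apply: module_prodM => //; exists u.
have PF y : P y -> fracset T y by move=> /PT; apply: frac_sub.
have nJ : nz_ideal R (module_fixed P).
  apply: (@nz_idealP _ _ (x * s x)).
  - exact: submodule_fixed.
  - by move=> y [/PT Ty sy]; apply: tower_fixed.
  - split; first by apply: module_prodM => //; exists x.
    by rewrite rmorphM /= tower_morphK 1?mulrC //; apply: IT.
  - by rewrite mulf_neq0 ?fmorph_eq0.
have [J' [g [nJ' g0 E]]] := inv _ nJ.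
have [J'R [_ [_ [_ [y [Jy y0]]]]]] := nJ'.
have J'm := nz_ideal_submodule nJ'.
have nK : nz_ideal T (module_ext J').
  apply: (@nz_idealP _ _ y) => //; first exact: submodule_ext.
    by move=> _ [a [b [/J'R Ra /J'R Rb ->]]]; apply/(tower_topE tw); exists a, b.
  by case: J'm => J0 _ _; exists y, 0; rewrite mul0r addr0.
exists (module_prod (module_conj I) (module_ext J')), g; split=> //.
  exact: nz_ideal_prod.
have [gT0 gTD gTZ] := submodule_scale g (submodule_self Tr).
have gR u : module_prod (module_fixed P) J' u -> scale_set g T u.
  by case/E=> r [Rr' ->]; exists r; split=> //; apply: tower_sub.
apply: same_setP => u.
  move=> /module_prodAr; elim=> {u} [u v|u v _ Hu _ Hv]; last exact: gTD.
  move=> /(stable_split Pm PF Ps)[a [b [Ja Jb ->]]] [a' [b' [Ja' Jb' ->]]].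
  have -> : (a + b * e) * (a' + b' * e) =
    (a * a' + e ^+ 2 * (b * b')) + e * (a * b' + b * a') by ring.
  have Te2 := tower_sub (tower_sqr tw); have Te := tower_mem_gen.
  apply: (gTD).
    by apply: (gTD); [|apply: (gTZ) => //]; apply: (gR); apply: module_prodM.
  by apply: (gTZ) => //; apply: (gTD); apply: (gR); apply: module_prodM.
case=> r [Tr' ->]; rewrite mulrC; have [_ _ +] := submodule_prod Im (submodule_prod sIm (submodule_ext J'm)).
apply=> //; apply: module_prodA.
have: module_prod (module_fixed P) J' g by apply/E; exists 1; rewrite mulr1; split=> //; apply: subring1.
apply: module_prod_mono => v; first by case.
by case: J'm => J0 _ _ Jv; exists v, 0; rewrite mul0r addr0.
Qed.
End Etale.
End Tower.

(** * Descent of totally positive units and of two-torsion *)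

(** The correcting elements range over an explicit set [W], so that one induction over the rings
    with 2 inverted also yields units of the rings of integers whenever the elements of [W] happen
    to be such. *)
Definition signs_in (S W : pset) : Prop :=
  forall x, fracset S x -> x != 0 -> exists eps, W eps /\ totpos (x * eps).

Section Step.
Variables (R T : pset) (s : {rmorphism algC -> algC}) (e : algC).
Hypothesis tw : tower R T s e.
Hypothesis real : forall x, fracset T x -> totreal x.

Let Rr : is_subring R. Proof. by case: tw. Qed.
Let Tr : is_subring T. Proof. by case: tw. Qed.
Let e0 : e != 0. Proof. by case: tw. Qed.
Hint Resolve Rr Tr e0 : core.

(* After correcting the signs of the norm, x and its conjugate have the same
   signs, hence so does the trace of x, which lives in the base. *)
Lemma signs_step (WR WT : pset) :
    (forall x, WT x -> T x) ->
    (forall x y, WT x -> WT y -> WT (x * y)) -> (forall x, WT x -> WT (s x)) ->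
    (forall x, WR x -> exists2 y, WT y & x = y * s y) ->
  signs_in R WR -> signs_in T WT.
Proof.
move=> WT_T WM Ws WN sR x Tx x0; have sx0 : s x != 0 by rewrite fmorph_eq0.
have N0 : x * s x != 0 by rewrite mulf_neq0.
have [_ [/WN[eps Weps ->] pN]] := sR _ (tower_norm_frac tw Tx) N0.
pose x1 := x * eps.
have pN1 : totpos (x1 * s x1) by rewrite rmorphM /= mulrACA.
have x10 : x1 != 0 by apply: contraNneq (totpos_neq0 pN1) => ->; rewrite mul0r.
have Tx1 : fracset T x1 by apply: fracM => //; apply/frac_sub/WT_T.
have Tsx1 := tower_morph_frac tw Tx1.
have pT : totpos (x1 * (x1 + s x1)).
  by rewrite mulrDr -expr2; apply: totposD => //; apply: totpos_sqr => //; apply: real.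
have t0 : x1 + s x1 != 0 by apply: contraNneq (totpos_neq0 pT) => ->; rewrite mulr0.
have Rt : fracset R (x1 + s x1).
  apply: (tower_fixed_frac tw); first exact: fracD.
  by rewrite rmorphD /= (tower_morphK_frac tw Tx1) addrC.
have [_ [/WN[d Wd ->] pd]] := sR _ Rt t0.
exists (eps * (d * s d)); split; first by apply: (WM) => //; apply: (WM) => //; apply: Ws.
apply: (@totposMr _ ((x1 + s x1) ^+ 2)).
  by apply: totpos_sqr => //; apply/real/fracD.
have -> : x * (eps * (d * s d)) * (x1 + s x1) ^+ 2 =
  (x1 * (x1 + s x1)) * ((x1 + s x1) * (d * s d)) by rewrite /x1; ring.
exact: totposM.
Qed.

Hypothesis half : R 2^-1.
Hypothesis inv_sqr : R (e ^+ 2)^-1.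
Hypothesis N2 : no_two_torsion R.
Hypothesis H2 : tp_units_gen R (e ^+ 2).
Hypothesis invT : invertible_ideals T.

(** For [M = R a + R b] the hypotheses put [w M M] inside [R], and the assumed unit is a combination
    of [w a^2] and [w b^2], so [w M M = R]. Thus [M] has principal square, and a generator [g] of
    [M] makes [w g^2] a unit. *)
Lemma two_generated_square_principal w a b :
    fracset R w -> fracset R a -> fracset R b -> w != 0 ->
    R (w * a ^+ 2) -> R (w * b ^+ 2) -> R (w * (a * b)) ->
    is_unit_in R (w * (a ^+ 2 - e ^+ 2 * b ^+ 2)) ->
  exists g eps, [/\ fracset R g, g != 0, is_unit_in R eps & w * g ^+ 2 = eps].
Proof.
move=> Fw Fa Fb w0 Ra Rb Rab U.
pose M : pset := fun x => exists r r', [/\ R r, R r' & x = r * a + r' * b].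
have Mm : submodule R M.
  split.
  - by exists 0, 0; rewrite !mul0r addr0; split=> //; apply: subring0.
  - move=> _ _ [r [r' [Rr1 Rr2 ->]]] [q [q' [Rq1 Rq2 ->]]].
    by exists (r + q), (r' + q'); split; [apply: subringD|apply: subringD|ring].
  - move=> t _ Rt [r [r' [Rr1 Rr2 ->]]].
    by exists (t * r), (t * r'); split; [apply: subringM|apply: subringM|ring].
have Ma : M a by exists 1, 0; rewrite mul1r mul0r addr0; split=> //; [apply: subring1|apply: subring0].
have Mb : M b by exists 0, 1; rewrite mul1r mul0r add0r; split=> //; [apply: subring0|apply: subring1].
have MF x : M x -> fracset R x.
  by move=> [r [r' [Rr1 Rr2 ->]]]; apply: fracD => //; apply: fracM => //; apply: frac_sub.
have MM : same_set (module_prod M M) (scale_set w^-1 R).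
  apply: same_setP => x.
    move=> Mx; exists (w * x); rewrite mulKf //; split=> //.
    elim: Mx => {x} [x y [r [r' [Rr1 Rr2 ->]]] [q [q' [Rq1 Rq2 ->]]]|x y _ Rx _ Ry].
      have -> : w * ((r * a + r' * b) * (q * a + q' * b)) =
        r * q * (w * a ^+ 2) + (r * q' + r' * q) * (w * (a * b)) + r' * q' * (w * b ^+ 2) by ring.
      by do ![apply: subringD => //|apply: subringM => //].
    by rewrite mulrDr; apply: subringD.
  case=> r [Rr' ->]; have [_ MMD MMZ] := submodule_prod Mm Mm.
  have U0 := unit_in_neq0 U.
  have -> : w^-1 * r = (w * (a ^+ 2 - e ^+ 2 * b ^+ 2))^-1 * r *
      (a * a + - (e ^+ 2) * (b * b)).
    have -> : a * a + - e ^+ 2 * (b * b) = a ^+ 2 - e ^+ 2 * b ^+ 2 by ring.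
    by move: U0; rewrite mulf_eq0 negb_or w0 /=; move: (_ - _) => N N0; field; rewrite N0 w0.
  apply: (MMZ); first by apply: subringM => //; apply: unit_in_invr.
  apply: MMD; first exact: module_prodM.
  by apply: (MMZ); [apply: (subringN Rr (tower_sqr tw)) | apply: module_prodM].
have w'0 : w^-1 != 0 by rewrite invr_eq0.
have [g [g0 Mg]] := N2 Mm MF w'0 MM.
have gg0 : g ^+ 2 != 0 by rewrite expf_neq0.
have [k Uk kE] : exists2 k, is_unit_in R k & g ^+ 2 = w^-1 * k.
  apply: scale_self_unit => //; apply: same_set_trans MM.
  apply: same_setP => x.
    case=> r [Rr' ->]; rewrite expr2 -mulrA; apply: module_prodM; apply/Mg.
      by exists 1; rewrite mulr1; split=> //; apply: subring1.
    by exists r.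
  elim=> {x} [_ _ /Mg[r [Rr1 ->]] /Mg[r' [Rr2 ->]]|_ _ _ [r [Rr1 ->]] _ [r' [Rr2 ->]]].
    by exists (r * r'); split; [apply: subringM | ring].
  by exists (r + r'); split; [apply: subringD | ring].
exists g, k; split=> //; last by rewrite kE mulVKf.
by apply: MF; apply/Mg; exists 1; rewrite mulr1; split=> //; apply: subring1.
Qed.

Lemma tower_split_uniq a b a' b' : fracset R a -> fracset R b -> fracset R a' -> fracset R b' ->
  a + b * e = a' + b' * e -> a = a' /\ b = b'.
Proof.
move=> Fa Fb Fa' Fb' E.
have b0 : b - b' = 0.
  apply: (tower_fixed_split tw (a := a - a')); try by apply/(tower_fix_frac tw)/fracB.
  have -> : a - a' + (b - b') * e = 0; last exact: rmorph0.
  by rewrite mulrBl addrACA -opprD E subrr.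
have bb : b = b' by apply/eqP; rewrite -subr_eq0 b0.
by split=> //; move: E; rewrite bb => /addIr.
Qed.

(** Hilbert 90 gives [u = w x^2] with [w] in the base field and [w N(x)] equal to [v] or [-v].
    Replacing [x] by [x / g], for [g] a generator of the module spanned by the components of [x],
    turns [w] into a totally positive unit of [R]. *)
Lemma square_unit u v : tp_unit T u -> is_unit_in R v -> u * s u = v ^+ 2 ->
  exists y, is_unit_in T y /\ u = y ^+ 2.
Proof.
move=> [Uu pu] Uv Nu; have Tu : T u by case: Uu.
have Rv : R v by case: Uv.
have [|||||w [x [Fw Fx w0 x0 uE]]] := @square_of_square_norm _ _ _ _ tw u v.
- exact: frac_sub.
- exact: unit_in_neq0 Uu.
- exact: frac_sub.
- exact: unit_in_neq0 Uv.
- by [].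
have [a [b [Fa Fb xE]]] := tower_split_frac tw Fx.
have Fe2 : fracset R (e ^+ 2) by apply: (frac_sub Rr (tower_sqr tw)).
have FR2 : fracset R 2 by apply: frac_sub => //; apply: subring_nat.
have sx : s x = a - b * e.
  by rewrite xE rmorphD rmorphM /= (tower_gen tw) !(tower_fix_frac tw) // mulrN.
have Nx : x * s x = a ^+ 2 - e ^+ 2 * b ^+ 2 by rewrite sx xE; ring.
have UN : is_unit_in R (w * (a ^+ 2 - e ^+ 2 * b ^+ 2)).
  have /eqP: (w * (x * s x)) ^+ 2 = v ^+ 2.
    rewrite -Nu uE rmorphM rmorphXn /= (tower_fix_frac tw Fw); ring.
  by rewrite -Nx eqf_sqr => /orP[]/eqP-> //; apply: unit_inN.
have RC : R (w * (a ^+ 2 - e ^+ 2 * b ^+ 2)) by case: UN.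
have /(tower_topE tw)[p [q [Rp Rq uE2]]] := Tu.
have [|||||pE qE] := @tower_split_uniq p q (w * (a ^+ 2 + e ^+ 2 * b ^+ 2)) (2 * (w * (a * b))).
- exact: frac_sub.
- exact: frac_sub.
- by rewrite !expr2; do ![apply: fracM => //|apply: fracD => //]; rewrite -expr2.
- by do ![apply: fracM => //|apply: fracD => //].
- by rewrite -uE2 uE xE; ring.
(* Both [p = w (a^2 + e^2 b^2)] and the unit [w (a^2 - e^2 b^2)] lie in [R]; separating the summands
   uses [1/2] and [1/e^2]. *)
have Ra : R (w * a ^+ 2).
  have -> : w * a ^+ 2 = 2^-1 * (p + w * (a ^+ 2 - e ^+ 2 * b ^+ 2)) by rewrite pE; field.
  by apply: subringM => //; apply: subringD.
have Rb : R (w * b ^+ 2).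
  have -> : w * b ^+ 2 = 2^-1 * ((e ^+ 2)^-1 * (p - w * (a ^+ 2 - e ^+ 2 * b ^+ 2))) by rewrite pE; field.
  by do 2!apply: subringM => //; apply: subringB.
have Rab : R (w * (a * b)).
  have -> : w * (a * b) = 2^-1 * q by rewrite qE; field.
  exact: subringM.
have [g [eps [Fg g0 Ueps wE]]] := two_generated_square_principal Fw Fa Fb w0 Ra Rb Rab UN.
pose y := x / g.
have Fy : fracset T y by apply: fracM => //; apply: fracV => //; apply: tower_sub_frac tw _ Fg.
have y0 : y != 0 by rewrite mulf_neq0 // invr_eq0.
have uE3 : u = eps * y ^+ 2 by rewrite uE -wE /y; field.
have tpe : tp_unit R eps.
  split=> //; apply: (@totposMr _ (y ^+ 2)); last by rewrite -uE3.
  by apply: totpos_sqr => //; apply: real.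
(* In either case [eps] is a square in [T], the exceptional class being that of [e^2]. *)
have [t [Ut tE]] := H2 tpe.
have [y' Fy' uE4] : exists2 y', fracset T y' & u = y' ^+ 2.
  have Ft : fracset T t by apply: frac_sub => //; apply: (tower_sub tw); case: Ut.
  case: tE => tE.
    by exists (t * y); [apply: fracM | rewrite uE3 tE; ring].
  exists (e * t * y); last by rewrite uE3 tE; ring.
  by do ![apply: fracM => //]; apply: frac_sub => //; apply: tower_mem_gen tw.
have Ty' : T y' by apply: subring_sqrt => //; rewrite -uE4.
by exists y'; split=> //; apply: (unit_in_div Tr Ty' Ty') Uu; rewrite -expr2 -uE4.
Qed.

Variables (dT eps : algC).
Hypothesis tpd : tp_unit T dT.
Hypothesis Ueps : is_unit_in R eps.
Hypothesis Nd : dT * s dT = e ^+ 2 * eps ^+ 2.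

Lemma tower_tp_unit_norm u : tp_unit T u -> tp_unit R (u * s u).
Proof.
move=> [Uu pu]; split; first exact: tower_norm_unit tw _ Uu.
by apply: totposM => //; apply: totpos_morph.
Qed.

(** The norm of [u] is [v^2] or [e^2 v^2]. In the second case the norm of [u dT] is a square, since
    that of [dT] is [e^2 eps^2]. *)
Lemma tp_units_gen_step : tp_units_gen T dT.
Proof.
move=> u tpu; have [v [Uv [vE|vE]]] := H2 (tower_tp_unit_norm tpu).
  by have [y [Uy ->]] := square_unit tpu Uv vE; exists y; split=> //; left.
have Ue : is_unit_in R (e ^+ 2) by apply: unit_inP => //; [apply: (tower_sqr tw)|rewrite expf_neq0].
have [[Uu pu] [Ud pd]] := (tpu, tpd).
have [|||y [Uy yE]] := @square_unit (u * dT) (e ^+ 2 * eps * v).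
- by split; [apply: unit_inM | apply: totposM].
- by do 2!apply: unit_inM => //.
- by rewrite rmorphM /= mulrACA vE Nd; ring.
have d0 := unit_in_neq0 Ud.
exists (y / dT); split; first by apply: unit_inM => //; apply: unit_inV.
by right; rewrite expr_div_n -yE; field.
Qed.

Hypothesis sgT : unit_signs T.

(** The product [M s(M)] is conjugation-stable and its square is generated by the norm of [b], which
    is fixed, so [stable_principal] applies. Comparing [g^2] with that norm yields the unit [k]. *)
Lemma conj_prod_principal M b : submodule T M -> (forall x, M x -> fracset T x) ->
    fracset T b -> b != 0 -> same_set (module_prod M M) (scale_set b T) ->
  exists g k, [/\ fracset R g, g != 0,
    same_set (module_prod M (module_conj s M)) (scale_set g T),
    is_unit_in R k & g ^+ 2 = b * s b * k].
Proof.
move=> Mm MF Fb b0 MM; set P := module_prod M _.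
have sMm := submodule_conj tw Mm; have [_ PD PZ] := submodule_prod Mm sMm.
have sb0 : s b != 0 by rewrite fmorph_eq0.
have N0 : b * s b != 0 by rewrite mulf_neq0.
have FN : fracset R (b * s b) := tower_norm_frac tw Fb.
have Ps x : P x -> P (s x).
  elim=> [u _ Iu [v Iv ->]|u v _ Pu _ Pv]; last by rewrite rmorphD; apply: module_prodD.
  rewrite rmorphM /= (tower_morphK_frac tw); last exact: MF.
  by rewrite mulrC; apply: module_prodM => //; exists u.
have PF x : P x -> fracset T x.
  elim=> [u _ Iu [v Iv ->]|u v _ Pu _ Pv]; last exact: fracD.
  by apply: fracM => //; [apply: MF | apply/(tower_morph_frac tw)/MF].
have PP : same_set (module_prod P P) (scale_set (b * s b) T).
  have [_ bD bZ] := submodule_scale (b * s b) (submodule_self Tr).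
  apply: same_setP => x.
    elim=> {x} [x y|x y _ Hx _ Hy]; last exact: bD.
    elim=> {x} [m1 _ M1 [m2 M2 ->]|x1 x2 _ IH1 _ IH2] Py; last first.
      by rewrite mulrDl; apply: bD; auto.
    elim: Py => {y} [m3 _ M3 [m4 M4 ->]|x1 x2 _ IH1 _ IH2]; last first.
      by rewrite mulrDr; apply: bD.
    have /MM[r [Tr1 E1]] : module_prod M M (m1 * m3) by apply: module_prodM.
    have /MM[r' [Tr2 E2]] : module_prod M M (m2 * m4) by apply: module_prodM.
    exists (r * s r'); split; first by apply: subringM => //; apply: tower_morph tw _ Tr2.
    by rewrite mulrACA E1 -rmorphM E2 rmorphM /=; ring.
  case=> r [Tr1 ->] {x}; rewrite mulrC.
  have [_ _ +] := submodule_prod (submodule_prod Mm sMm) (submodule_prod Mm sMm); apply=> //.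
  have bM : module_prod M M b by apply/MM; exists 1; rewrite mulr1; split=> //; apply: subring1.
  have H x y : module_prod M M x -> module_prod M M y -> module_prod P P (x * s y).
    elim=> {x} [m1 m3 M1 M3|x1 x2 _ IH1 _ IH2] My; last first.
      by rewrite mulrDl; apply: module_prodD; auto.
    elim: My => {y} [m2 m4 M2 M4|x1 x2 _ IH1 _ IH2]; last first.
      by rewrite rmorphD mulrDr; apply: module_prodD.
    by rewrite rmorphM /= mulrACA; apply: module_prodM; apply: module_prodM => //;
      [exists m2 | exists m4].
  exact: H.
have [g [g0 Fg Pg]] := stable_principal tw half inv_sqr (submodule_prod Mm sMm) PF Ps N2
  (tower_fix_frac tw FN) N0 PP.
have gg0 : g ^+ 2 != 0 by rewrite expf_neq0.
have [k Uk kE] : exists2 k, is_unit_in T k & g ^+ 2 = b * s b * k.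
  apply: scale_self_unit => //; apply: same_set_trans PP.
  apply: same_setP => x.
    case=> r [Rr' ->]; rewrite expr2 -mulrA; apply: module_prodM; apply/Pg.
      by exists 1; rewrite mulr1; split=> //; apply: subring1.
    by exists r.
  elim=> {x} [_ _ /Pg[r [Rr1 ->]] /Pg[r' [Rr2 ->]]|_ _ _ [r [Rr1 ->]] _ [r' [Rr2 ->]]].
    by exists (r * r'); split; [apply: subringM | ring].
  by exists (r + r'); split; [apply: subringD | ring].
exists g, k; split=> //.
have sk : s k = k.
  have -> : k = g ^+ 2 / (b * s b) by rewrite kE mulrAC mulfV ?mul1r.
  by apply: (tower_fix_frac tw); apply: fracM => //; [rewrite expr2; apply: fracM|apply: fracV].
have k0 := unit_in_neq0 Uk.
apply: unit_inP => //; apply: (tower_fixed tw) => //; first by case: Uk.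
  exact: unit_in_invr.
by rewrite fmorphV /= sk.
Qed.

Lemma scale_same_unit M a b u : a != 0 -> is_unit_in T u ->
  same_set M (scale_set a T) -> b = a * u -> same_set M (scale_set b T).
Proof.
move=> a0 Uu E ->; apply: same_set_trans E _.
apply: same_set_trans (scale_setA a u T).
exact/scale_set_same/same_set_sym/(scale_set_unit (submodule_self Tr)).
Qed.

(** The generator of [M M] is adjusted by units until its norm is a square. It is then [w x^2] with
    [w] in the base field; [M / x] is stable under conjugation and descends to [R]. *)
Lemma no_two_torsion_step : no_two_torsion T.
Proof.
move=> M b0 Mm MF b00 MM0.
have FMM x : module_prod M M x -> fracset T x.
  by elim=> [u v /MF Fu /MF Fv|u v _ Fu _ Fv]; [apply: fracM|apply: fracD].
have Fb0 : fracset T b0.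
  by apply/FMM/MM0; exists 1; rewrite mulr1; split=> //; apply: subring1.
have [eta [Ueta pb1]] := sgT Fb0 b00.
set b1 := b0 * eta in pb1.
have MM1 : same_set (module_prod M M) (scale_set b1 T) by apply: scale_same_unit Ueta MM0 _.
have Fb1 : fracset T b1 by apply: fracM => //; apply: frac_sub => //; case: Ueta.
have b10 := totpos_neq0 pb1.
have [g [k [Fg g0 Pg Uk gE]]] := conj_prod_principal Mm MF Fb1 b10 MM1.
have Fk : fracset R k by apply: frac_sub => //; case: Uk.
have N10 : b1 * s b1 != 0 by rewrite mulf_neq0 ?fmorph_eq0.
have pk : totpos k.
  apply: (@totposMr _ (b1 * s b1)); first by apply: totposM => //; apply: totpos_morph.
  rewrite mulrC -gE; apply: totpos_sqr => //; apply: real; exact: tower_sub_frac tw _ Fg.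
have [Ud pd] := tpd; have d0 := unit_in_neq0 Ud.
have eps0 := unit_in_neq0 Ueps.
have [v [Uv vE]] := H2 (conj Uk pk).
have [b [v' [MM Fb nb0 Uv' gE']]] : exists b v', [/\ same_set (module_prod M M) (scale_set b T),
    fracset T b, b != 0, is_unit_in R v' & g ^+ 2 = b * s b * v' ^+ 2].
  case: vE => vE; first by exists b1, v; rewrite -vE.
  (* The factor [e^2] of [k] is absorbed by [dT], whose norm is [e^2 eps^2]. *)
  exists (b1 * dT), (v / eps); split.
  - exact: (scale_same_unit b10 Ud MM1 erefl).
  - by apply: fracM => //; apply: frac_sub => //; case: Ud.
  - by rewrite mulf_neq0.
  - by apply: unit_inM => //; apply: unit_inV.
  - rewrite gE vE (rmorphM s b1 dT).
    have -> : b1 * dT * (s b1 * s dT) = b1 * s b1 * (dT * s dT) by ring.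
    by rewrite Nd; field.
have v0 := unit_in_neq0 Uv'.
have Rv' : R v' by case: Uv'.
have Fg' : fracset R (g / v') by apply: fracM => //; apply: (fracV Rr (frac_sub Rr Rv')).
have [||w [x [Fw Fx w0 x0 bE]]] := square_of_square_norm tw Fb nb0 Fg'.
- by rewrite mulf_neq0 // invr_eq0.
- by rewrite expr_div_n gE' mulfK // expf_neq0.
have x'0 : x^-1 != 0 by rewrite invr_eq0.
have sx0 : s x != 0 by rewrite fmorph_eq0.
(* As [b = w x^2], the square of [M0] is generated by the conjugation-invariant [w]. *)
pose M0 := scale_set x^-1 M.
have M0m : submodule T M0 by apply: submodule_scale.
have M0F y : M0 y -> fracset T y.
  by move=> [m [/MF Fm ->]]; apply: fracM => //; apply: fracV.
have MM' : same_set (module_prod M0 M0) (scale_set w T).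
  move=> y; split.
    move=> /scale_module_prod[m [/MM[r [Tr1 ->]] ->]]; exists r; split=> //.
    by rewrite bE; field.
  move=> [r [Tr1 ->]]; apply/scale_module_prod; exists (b * r).
  by split; [apply/MM; exists r | rewrite bE; field].
have [kk [Ukk kkE]] : exists kk, is_unit_in R kk /\ g / (x * s x) = w * kk.
  have /eqP: (w * (x * s x)) ^+ 2 = (g / v') ^+ 2.
    rewrite expr_div_n gE' mulfK ?expf_neq0 // bE rmorphM rmorphXn /=.
    by rewrite (tower_fix_frac tw Fw); ring.
  rewrite eqf_sqr => /orP[]/eqP E.
    exists v'; split=> //; have -> : g = w * (x * s x) * v' by rewrite E divfK.
    by field; rewrite sx0 x0.
  exists (- v'); split; first exact: unit_inN.
  have -> : g = - (w * (x * s x)) * v' by rewrite E opprK divfK.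
  by field; rewrite sx0 x0.
have conjM : same_set (module_prod M0 (module_conj s M0)) (scale_set w T).
  apply: (@scale_same_unit _ (g / (x * s x)) _ kk^-1).
  - by rewrite mulf_neq0 // invr_eq0 mulf_neq0.
  - by apply: (tower_unit tw); apply: unit_inV.
  - apply: (@same_set_trans _ (module_prod (scale_set x^-1 M) (scale_set (s x)^-1 (module_conj s M)))).
      have E : same_set (module_conj s M0) (scale_set (s x)^-1 (module_conj s M)).
        move=> y; split.
          by case=> _ [m [Mm' ->]] ->; exists (s m); rewrite rmorphM /= fmorphV; split=> //; exists m.
        by case=> _ [[m Mm' ->] ->]; exists (x^-1 * m); rewrite ?rmorphM /= ?fmorphV //; exists m.
      by move=> y; split; apply: module_prod_mono => // z /E.
    move=> y; split.
      move=> /scale_module_prod[m [/Pg[r [Tr1 ->]] ->]]; exists r; split=> //.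
      by field; rewrite x0 sx0.
    move=> [r [Tr1 ->]]; apply/scale_module_prod; exists (g * r).
    by split; [apply/Pg; exists r | field; rewrite x0 sx0].
  - by rewrite kkE mulfK // (unit_in_neq0 Ukk).
have [_ cD cZ] := submodule_conj tw M0m.
(* [M0 M0] and [M0 s(M0)] are both [w T]. Hence [w y] lies in [M0 s(M0) y], inside [w s(M0)], and
   [y] lies in [s(M0)]. *)
have M0s y : M0 y -> M0 (s y).
  move=> M0y; have: scale_set w (module_conj s M0) (w * y).
    have: module_prod M0 (module_conj s M0) w.
      by apply/conjM; exists 1; rewrite mulr1; split=> //; apply: subring1.
    have H z : module_prod M0 (module_conj s M0) z -> scale_set w (module_conj s M0) (z * y).
      elim=> {z} [m n Mm' cn|z1 z2 _ [m1 [c1 E1]] _ [m2 [c2 E2]]].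
        have /MM'[r [Tr1 E]] : module_prod M0 M0 (m * y) by apply: module_prodM.
        by exists (r * n); split; [apply: cZ | rewrite mulrAC E; ring].
      by exists (m1 + m2); split; [apply: cD | rewrite mulrDl E1 E2 mulrDr].
    exact: H.
  case=> z [[m Mm' ->] /(mulfI w0) yE].
  by rewrite yE (tower_morphK_frac tw) //; apply: M0F.
have [g1 [g10 _ E]] := stable_principal tw half inv_sqr M0m M0F M0s N2 (tower_fix_frac tw Fw) w0 MM'.
exists (x * g1); split; first by rewrite mulf_neq0.
move=> y; split.
  move=> My; have /E[r [Tr1 E1]] : M0 (x^-1 * y) by exists y.
  by exists r; split=> //; rewrite -mulrA -E1 mulVKf.
case=> r [Tr1 ->]; have [m [Mm' E1]] : M0 (g1 * r) by apply/E; exists r.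
by rewrite -mulrA E1 mulVKf.
Qed.
End Step.

(** * Monogenic rings and inversion of two *)

(** [Oring n] is convertible with [Zadj (eta n)], and [Rring n] with its image under [Zhalf]. A free
    generator lets the induction run over arbitrary primitive roots. *)
Definition Zadj (e : algC) : pset :=
  fun x => exists p : {poly int}, x = (map_poly (fun z : int => z%:~R) p).[e].

Definition Zhalf (S : pset) : pset := fun x => exists k : nat, S (2 ^+ k * x).

Lemma Zadj_subring e : is_subring (Zadj e).
Proof.
split.
- by exists 1; rewrite rmorph1 hornerC.
- by move=> _ _ [p ->] [q ->]; exists (p - q); rewrite rmorphB hornerD hornerN.
- by move=> _ _ [p ->] [q ->]; exists (p * q); rewrite rmorphM hornerM.
Qed.
Lemma Zadj_gen e : Zadj e e.
Proof. by exists 'X; rewrite map_polyX hornerX. Qed.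
Lemma Zadj_min S e x : is_subring S -> S e -> Zadj e x -> S x.
Proof.
move=> Sr Se [p ->]; elim/poly_ind: p => [|p c IH].
  by rewrite rmorph0 horner0; apply: subring0.
rewrite rmorphD rmorphM /= map_polyX map_polyC /= hornerMXaddC.
by apply: subringD => //; [apply: subringM | apply: subring_int].
Qed.

Section Zhalf.
Variable S : pset.
Hypothesis Sr : is_subring S.
Let two0 k : (2 ^+ k : algC) != 0. Proof. by rewrite expf_neq0 // pnatr_eq0. Qed.
Hint Resolve two0 : core.
Lemma Zhalf_sub x : S x -> Zhalf S x.
Proof. by exists 0%N; rewrite expr0 mul1r. Qed.
Lemma Zhalf_half : Zhalf S 2^-1.
Proof. by exists 1%N; rewrite expr1 mulfV ?pnatr_eq0 //; apply: subring1. Qed.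
Lemma Zhalf_subring : is_subring (Zhalf S).
Proof.
have S2 n : S (2 ^+ n) by apply: subringX => //; apply: subring_nat.
split; first by apply: Zhalf_sub; apply: subring1.
  move=> x y [k Sx] [l Sy]; exists (k + l)%N.
  have -> : 2 ^+ (k + l) * (x - y) = 2 ^+ l * (2 ^+ k * x) - 2 ^+ k * (2 ^+ l * y).
    by rewrite exprD; ring.
  by apply: subringB => //; apply: subringM.
move=> x y [k Sx] [l Sy]; exists (k + l)%N.
by rewrite exprD mulrACA; apply: subringM.
Qed.
Lemma Zhalf_frac x : fracset (Zhalf S) x <-> fracset S x.
Proof.
split=> [[a [b [[k Sa] [l Sb] b0 ->]]]|[a [b [Sa Sb b0 ->]]]]; last first.
  by exists a, b; split=> //; apply: Zhalf_sub.
exists (2 ^+ l * (2 ^+ k * a)), (2 ^+ k * (2 ^+ l * b)); split.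
- by apply: subringM => //; apply: subringX => //; apply: subring_nat.
- by apply: subringM => //; apply: subringX => //; apply: subring_nat.
- by rewrite !mulf_neq0.
- by field; rewrite ?b0 !two0.
Qed.
Lemma Zhalf_unit x : is_unit_in S x -> is_unit_in (Zhalf S) x.
Proof. by move=> [Sx [y [Sy xy]]]; split; [|exists y; split=> //]; apply: Zhalf_sub. Qed.
End Zhalf.

Lemma tower_Zhalf R T s e : tower R T s e -> tower (Zhalf R) (Zhalf T) s e.
Proof.
case=> Rr Tr TE fixR se e0 e2; split=> //; try exact: Zhalf_subring.
- move=> x; split.
    case=> k /TE[a [b [Ra Rb E]]]; have k0 : (2 ^+ k : algC) != 0 by rewrite expf_neq0 // pnatr_eq0.
    exists (a / 2 ^+ k), (b / 2 ^+ k); split.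
    - by exists k; rewrite mulrC divfK.
    - by exists k; rewrite mulrC divfK.
    - by apply: (mulfI k0); rewrite E; field.
  case=> a [b [[k Ra] [l Rb] ->]]; exists (k + l)%N; apply/TE.
  exists (2 ^+ l * (2 ^+ k * a)), (2 ^+ k * (2 ^+ l * b)); split; last by rewrite exprD; ring.
    by apply: subringM => //; apply: subringX => //; apply: subring_nat.
  by apply: subringM => //; apply: subringX => //; apply: subring_nat.
- move=> x [k /fixR]; rewrite rmorphM rmorphXn /= rmorph_nat => /mulfI; apply.
  by rewrite expf_neq0 // pnatr_eq0.
- exact: Zhalf_sub.
Qed.

Lemma tower_Zadj (s : {rmorphism algC -> algC}) e f :
  e ^+ 2 = 2 + f -> e != 0 -> s e = - e -> tower (Zadj f) (Zadj e) s e.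
Proof.
move=> eE e0 se; have Rr := Zadj_subring f; have Tr := Zadj_subring e.
have fE : f = e ^+ 2 - 2 by rewrite eE; ring.
have Te := Zadj_gen e.
have fT x : Zadj f x -> Zadj e x.
  apply: Zadj_min => //; rewrite fE; apply: subringB => //; last exact: subring_nat.
  exact: subringX.
have Re2 : Zadj f (e ^+ 2).
  by rewrite eE; apply: subringD => //; [apply: subring_nat | apply: Zadj_gen].
split=> //.
- move=> x; split; last first.
    by case=> a [b [/fT Ra /fT Rb ->]]; apply: subringD => //; apply: subringM.
  apply: (@Zadj_min (fun x => exists a b, [/\ Zadj f a, Zadj f b & x = a + b * e])).
    split.
    - by exists 1, 0; rewrite mul0r addr0; split=> //; [apply: subring1|apply: subring0].
    - move=> _ _ [a [b [Ra Rb ->]]] [c [d [Rc Rd ->]]]; exists (a - c), (b - d).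
      by split; [apply: subringB | apply: subringB | ring].
    - move=> _ _ [a [b [Ra Rb ->]]] [c [d [Rc Rd ->]]].
      exists (a * c + e ^+ 2 * (b * d)), (a * d + b * c); split; last by ring.
        by do ![apply: subringD => //|apply: subringM => //].
      by do ![apply: subringD => //|apply: subringM => //].
  by exists 0, 1; rewrite mul1r add0r; split=> //; [apply: subring0|apply: subring1].
- have sf : s f = f by rewrite {1}fE rmorphB rmorphXn /= se sqrrN rmorph_nat fE.
  move=> x; apply: (@Zadj_min (fun x => s x = x)) => //; split.
  - exact: rmorph1.
  - by move=> x' y hx hy; rewrite rmorphB /= hx hy.
  - by move=> x' y hx hy; rewrite rmorphM /= hx hy.
Qed.

(** * Principal ideal rings, integral norms and Euclidean division *)

Definition principal_ideals (S : pset) : Prop :=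
  forall I, nz_ideal S I -> exists g, g != 0 /\ same_set I (scale_set g S).

Section Principal.
Variable S : pset.
Hypothesis Sr : is_subring S.
Hypothesis PI : principal_ideals S.

Lemma principal_invertible : invertible_ideals S.
Proof.
move=> I nI; have [g [g0 E]] := PI nI; exists S, g; split=> //.
  exact: nz_ideal_self.
apply: same_setP => x.
  elim=> {x} [x y /E[r [Sr1 ->]] Sy|x y _ [a [Sa ->]] _ [b [Sb ->]]].
    by exists (r * y); rewrite mulrA; split=> //; apply: subringM.
  by exists (a + b); rewrite mulrDr; split=> //; apply: subringD.
by case=> r [Sr1 ->]; rewrite -[r]mul1r mulrA; apply: module_prodM => //; apply/E; exists 1;
  split=> //; apply: subring1.
Qed.

(** For a nonzero [m] in [M], the product [m M] lies in [M M = b S], so [(m / b) M] is an honest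
    ideal of [S]. *)
Lemma principal_no_two_torsion : no_two_torsion S.
Proof.
move=> M b Mm MF b0 MM.
have [m Mm' m0] : exists2 m, M m & m != 0.
  apply: NNPP => nM; have M0 m : M m -> m = 0.
    by move=> Mm'; apply/eqP; apply: contra_notT nM => m0; exists m.
  have: module_prod M M b by apply/MM; exists 1; rewrite mulr1; split=> //; apply: subring1.
  have H x : module_prod M M x -> x = 0.
    by elim=> [u v /M0-> _|u v _ -> _ ->]; rewrite ?mul0r ?addr0.
  by move/H/eqP; apply/negP.
have mb0 : m / b != 0 by rewrite mulf_neq0 // invr_eq0.
have nI : nz_ideal S (scale_set (m / b) M).
  apply: (@nz_idealP _ _ (m / b * m)).
  - exact: submodule_scale.
  - move=> _ [y [My ->]]; have /MM[r [Sr1 E]] : module_prod M M (m * y) by apply: module_prodM.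
    by rewrite mulrAC E mulrAC mulfV // mul1r.
  - by exists m.
  - by rewrite mulf_neq0.
have [g [g0 E]] := PI nI; exists (g / (m / b)); split; first by rewrite mulf_neq0 // invr_eq0.
apply: same_setP => x.
  move=> Mx; have /E[r [Sr1 xE]] : scale_set (m / b) M (m / b * x) by exists x.
  by exists r; split=> //; rewrite mulrAC -xE mulrAC mulfV // mul1r.
case=> r [Sr1 ->]; have /E[y [My xE]] : scale_set g S (g * r) by exists r.
by rewrite mulrAC xE mulrAC mulfV // mul1r.
Qed.

Lemma principal_Zhalf : principal_ideals (Zhalf S).
Proof.
move=> I nI; have [IS [I0 [ID [IZ [x [Ix x0]]]]]] := nI.
have Hr := Zhalf_subring Sr.
have two k : Zhalf S (2 ^+ k) by apply: subringX => //; apply: subring_nat.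
have nJ : nz_ideal S (fun y => S y /\ I y).
  have [k Sx] := IS _ Ix.
  apply: (@nz_idealP _ _ (2 ^+ k * x)) => //.
  - split; first by split=> //; apply: subring0.
      by move=> y z [Sy Iy] [Sz Iz]; split; [apply: subringD | apply: ID].
    by move=> r y Sr1 [Sy Iy]; split; [apply: subringM | apply: IZ => //; apply: Zhalf_sub].
  - by move=> y [].
  - by split=> //; apply: IZ.
  - by rewrite mulf_neq0 // expf_neq0 // pnatr_eq0.
have [g [g0 E]] := PI nJ; exists g; split=> //; apply: same_setP => y.
  move=> Iy; have [k Sy] := IS _ Iy.
  have /E[r [Sr1 yE]] : S (2 ^+ k * y) /\ I (2 ^+ k * y) by split=> //; apply: IZ.
  have k0 : (2 ^+ k : algC) != 0 by rewrite expf_neq0 // pnatr_eq0.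
  exists (r / 2 ^+ k); split; first by exists k; rewrite mulrC divfK.
  by apply: (mulfI k0); rewrite yE; field.
case=> r [Sr1 ->]; rewrite mulrC; apply: IZ => //.
by have [] : S g /\ I g by apply/E; exists 1; rewrite mulr1; split=> //; apply: subring1.
Qed.
End Principal.

(** An abstract norm to the rationals. The field [int_norm_lt1] stands for the formula of the norm
    as a product of conjugates. *)
Record int_norm (S : pset) (N : algC -> algC) : Prop := IntNorm {
  int_normM : forall x y, N (x * y) = N x * N y;
  int_norm_int : forall x, S x -> N x \is a Num.int;
  int_norm_neq0 : forall x, x != 0 -> N x != 0;
  int_norm_lt1 : forall x, (forall nu : {rmorphism algC -> algC}, `|nu x| < 1) -> `|N x| < 1 }.

Lemma int_norm_tower R T s e N : tower R T s e ->
  int_norm R N -> int_norm T (fun x => N (x * s x)).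
Proof.
move=> tw [NM Nint N0 N1]; split.
- by move=> x y /=; rewrite rmorphM /= mulrACA !NM.
- by move=> x Tx; apply/Nint/(tower_norm tw).
- by move=> x x0; apply: N0; rewrite mulf_neq0 // fmorph_eq0.
- move=> x h; apply: N1 => nu; rewrite rmorphM normrM.
  by apply: mulr_ilt1 => //; apply: (h (nu \o s)).
Qed.

(** Take [b] of least norm in [I]. If [t a / b] is within norm 1 of [w], then [t a - w b] is in [I]
    with norm below that of [b], hence zero; and every [t <= M] divides [M!]. The case [M = 1] is
    Euclidean division. *)
Lemma ideal_near_principal S N M : is_subring S -> int_norm S N ->
    (forall x, fracset S x -> exists t w, [/\ (0 < t <= M)%N, S w & `|N (t%:R * x - w)| < 1]) ->
  forall I, nz_ideal S I -> exists b, [/\ I b, b != 0 &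
    forall a, I a -> exists r, S r /\ (M`!)%:R * a = b * r].
Proof.
move=> Sr [NM Nint N0 N1] app I nI; have [IS [I0 [ID [IZ [x [Ix x0]]]]]] := nI.
have [b [Ib b0 bmin]] : exists b, [/\ I b, b != 0 &
    forall c, I c -> c != 0 -> ~ (`|N c| < `|N b|)].
  have [n] : exists n : nat, `|N x| < n%:R.
    have /natrP[n ->] : `|N x| \is a Num.nat by apply: natr_norm_int; apply/Nint/IS.
    by exists n.+1; rewrite ltr_nat.
  elim: n => [|n IH] in x Ix x0 *; first by rewrite normr_lt0.
  have /natrP[k kE] : `|N x| \is a Num.nat by apply: natr_norm_int; apply/Nint/IS.
  rewrite kE ltr_nat ltnS => le_kn.
  case: (classic (exists c, [/\ I c, c != 0 & `|N c| < `|N x|])) => [[c [Ic c0 lt]]|nx].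
    apply: (IH c) => //; apply: lt_le_trans lt _; by rewrite kE ler_nat.
  by exists x; split=> // c Ic c0 lt; apply: nx; exists c.
exists b; split=> // a Ia.
have [|t [w [/andP[t0 tM] Sw lt]]] := app (a / b).
  by exists a, b; split=> //; apply: IS.
have Ic : I (t%:R * a - w * b).
  have -> : t%:R * a - w * b = t%:R * a + (- w) * b by ring.
  by apply: ID; apply: IZ => //; [apply: subring_nat | apply: subringN].
have tE : t%:R * a = w * b.
  apply/eqP; rewrite -subr_eq0; apply/negP => /negP c0; apply: (bmin _ Ic c0).
  have -> : t%:R * a - w * b = b * (t%:R * (a / b) - w) by field.
  by rewrite NM normrM -[ltRHS]mulr1 ltr_pM2l // normr_gt0 N0.
have /dvdnP[q ->] : (t %| M`!)%N by rewrite dvdn_fact // t0.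
exists (q%:R * w); split; first by apply: subringM => //; apply: subring_nat.
by rewrite natrM -mulrA tE; ring.
Qed.

Lemma euclidean_principal S N : is_subring S -> int_norm S N ->
    (forall x, fracset S x -> exists w, S w /\ `|N (x - w)| < 1) ->
  principal_ideals S.
Proof.
move=> Sr nN app I nI.
have [|b [Ib b0 bE]] := @ideal_near_principal S N 1 Sr nN _ I nI.
  by move=> x /app[w [Sw lt]]; exists 1%N, w; split=> //; rewrite mul1r.
exists b; split=> //; apply: same_setP => x; first by move=> /bE; rewrite mul1r.
by case=> r [Sr1 ->]; rewrite mulrC; case: (nz_ideal_submodule nI) => _ _; apply.
Qed.

(** * Counting ideal classes *)

Lemma num_classes_of_cover S (eqv : pset -> pset -> Prop) k (reps : 'I_k -> pset) :
    (forall I J K, eqv I J -> eqv J K -> eqv I K) ->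
    (forall i, nz_ideal S (reps i)) ->
    (forall I, nz_ideal S I -> exists i, eqv I (reps i)) ->
  exists h, num_classes S eqv h.
Proof.
move=> tr; elim: k reps => [|k IH] reps nr cov.
  by exists 0%N, reps; split=> //; split=> // -[].
case: (classic (exists i j, eqv (reps i) (reps j) /\ i <> j)) => [[i [j [ij nij]]]|H].
  apply: (IH (fun l => reps (lift i l))) => // I /cov[i' Ii'].
  have [E|ne] := eqVneq i' i; last by have [l El|] := unliftP i i'; [exists l; rewrite -El|move/eqP: ne].
  have [l El|E'] := unliftP i j; last by case: nij.
  by exists l; rewrite -El; apply: tr ij; rewrite -E.
exists k.+1, reps; split=> //; split=> // i j ij.
by apply: NNPP => nij; apply: H; exists i, j.
Qed.

Lemma num_classes_of_coloring S (eqv : pset -> pset -> Prop) (F : finType)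
    (col : pset -> F -> Prop) :
    is_subring S ->
    (forall I J K, eqv I J -> eqv J K -> eqv I K) ->
    (forall I, nz_ideal S I -> exists c, col I c) ->
    (forall I J c, nz_ideal S I -> nz_ideal S J -> col I c -> col J c -> eqv I J) ->
  exists h, num_classes S eqv h.
Proof.
move=> Sr tr colE colI.
have rep (c : F) : exists I, nz_ideal S I /\ ((exists2 J, nz_ideal S J & col J c) -> col I c).
  case: (classic (exists2 J, nz_ideal S J & col J c)) => [[J nJ cJ]|H]; first by exists J.
  (* A colour carried by no ideal gets the default representative [S]. *)
  by exists S; split=> //; apply: nz_ideal_self.
have [r rP] := fin_all_exists rep.
apply: (@num_classes_of_cover _ _ #|F| (fun i => r (enum_val i))) => //.
  by move=> i; case: (rP (enum_val i)).
move=> I nI; have [c cI] := colE I nI; exists (enum_rank c); rewrite enum_rankK.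
have [nr cr] := rP c; apply: (colI _ _ c) => //.
by apply: cr; exists I.
Qed.

(** Simultaneous Dirichlet approximation at all archimedean places, with a bound [M] uniform in the
    points. A whole family is approximated because each quadratic step doubles the number of
    coordinates. *)
Definition approximable (S : pset) : Prop :=
  forall (I : finType) (k : nat), (0 < k)%N -> exists M, forall x : I -> algC,
    (forall i, fracset S (x i)) ->
    exists t (w : I -> algC), (0 < t <= M)%N /\ forall i, S (w i) /\
      forall nu : {rmorphism algC -> algC}, `|nu (t%:R * x i - w i)| < k%:R^-1.

Definition finite_residues (S : pset) : Prop :=
  forall m : nat, (0 < m)%N -> exists l : seq algC, forall x, S x ->
    exists y q, [/\ y \in l, S q & x = y + m%:R * q].

Lemma approximable_tower R T s e : tower R T s e ->
    (forall nu : {rmorphism algC -> algC}, `|nu e| <= 2) ->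
  approximable R -> approximable T.
Proof.
move=> tw be app I k k0; have Rr := tower_base tw; have Tr := tower_top tw.
(* As the conjugates of [e] have modulus at most 2, the error is below [1/(3k) + 2/(3k)]. *)
have [|M HM] := app (I + I)%type (3 * k)%N; first by rewrite muln_gt0.
exists M => x Fx.
have [a Ha] := fin_all_exists (fun i => tower_split_frac tw (Fx i)).
have [b ab] := fin_all_exists Ha.
have [[i|i]|t [w [tM wP]]] := HM (fun i => match i with inl i => a i | inr i => b i end).
- by case: (ab i).
- by case: (ab i).
exists t, (fun i => w (inl i) + w (inr i) * e); split=> // i.
have [[Sa na] [Sb nb]] := (wP (inl i), wP (inr i)); split.
  by apply/(tower_topE tw); exists (w (inl i)), (w (inr i)).
move=> nu; have [_ _ ->] := ab i.
have -> : t%:R * (a i + b i * e) - (w (inl i) + w (inr i) * e) =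
  (t%:R * a i - w (inl i)) + (t%:R * b i - w (inr i)) * e by ring.
rewrite rmorphD (rmorphM nu _ e); apply: le_lt_trans (ler_normD _ _) _.
rewrite normrM.
have -> : k%:R^-1 = (3 * k)%:R^-1 + (3 * k)%:R^-1 * 2 :> algC.
  by rewrite natrM; field; rewrite pnatr_eq0 -lt0n.
apply: ltr_leD; first exact: na.
by apply: ler_pM => //; apply/ltW/nb.
Qed.

Lemma finite_residues_tower R T s e : tower R T s e -> finite_residues R -> finite_residues T.
Proof.
move=> tw fR m m0; have [l lP] := fR m m0.
exists [seq a + b * e | a <- l, b <- l] => x /(tower_topE tw)[a [b [/lP[a' [qa [la Ra ->]]] /lP[b' [qb [lb Rb ->]]] ->]]].
exists (a' + b' * e), (qa + qb * e); split; last by ring.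
  by apply/allpairsP; exists (a', b').
by apply/(tower_topE tw); exists qa, qb.
Qed.

(** With [m = M!] and a suitable [b] in [I], the ideal [(m / b) I] lies between [m S] and [S]. It is
    a union of residue classes modulo [m], and the colour records which ones; ideals of equal colour
    become equal after this scaling. *)
Lemma class_number_exists S N : is_subring S -> int_norm S N -> approximable S ->
  finite_residues S -> exists h, class_number S h.
Proof.
move=> Sr nN app res; have [M HM] := app unit 1%N isT.
have near := @ideal_near_principal S N M Sr nN _.
have {near} near I : nz_ideal S I -> exists b, [/\ I b, b != 0 &
    forall a, I a -> exists r, S r /\ (M`!)%:R * a = b * r].
  apply: near => x Fx; have [t [w [tM wP]]] := HM (fun _ => x) (fun _ => Fx).
  have [Sw lt] := wP tt; exists t, (w tt); split=> //.
  by apply: (int_norm_lt1 nN) => nu; have := lt nu; rewrite invr1.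
have [l lP] := res M`! (fact_gt0 M).
set m := (M`!)%:R in near lP.
have m0 : m != 0 :> algC by rewrite pnatr_eq0 -lt0n fact_gt0.
have Sm : S m by apply: subring_nat.
pose col (I : pset) (c : {ffun 'I_(size l) -> bool}) :=
  exists b, [/\ S b, b != 0, I b,
    forall a, I a -> exists r, S r /\ m * a = b * r &
    forall i : 'I_(size l), c i <-> exists a, I a /\ m * a = b * l`_i].
apply: (@num_classes_of_coloring _ _ {ffun 'I_(size l) -> bool} col) => //.
- by move=> I J K; apply: ideal_equiv_trans.
- move=> I nI; have [b [Ib b0 bE]] := near I nI; have [IS _] := nI.
  have D (i : 'I_(size l)) : exists c : bool, c <-> exists a, I a /\ m * a = b * l`_i.
    case: (classic (exists a, I a /\ m * a = b * l`_i)) => H; first by exists true.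
    by exists false.
  have [c cP] := fin_all_exists D.
  exists [ffun i => c i], b; split=> //; first exact: IS.
  by move=> i; rewrite ffunE.
move=> I J c nI nJ [b [Sb b0 Ib bE cb]] [b' [Sb' b'0 Jb' b'E cb']].
have H I' b1 b2 J' : nz_ideal S I' -> nz_ideal S J' -> S b1 -> b1 != 0 -> S b2 -> b2 != 0 ->
  I' b1 -> J' b2 ->
  (forall a, I' a -> exists r, S r /\ m * a = b1 * r) ->
  (forall i : 'I_(size l), c i <-> exists a, I' a /\ m * a = b1 * l`_i) ->
  (forall i : 'I_(size l), c i <-> exists a, J' a /\ m * a = b2 * l`_i) ->
  forall x, scale_set (b2 * m) I' x -> scale_set (b1 * m) J' x.
  move=> nI' nJ' Sb1 b10 Sb2 b20 Ib1 Jb2 E1 c1 c2 x [a [Ia ->]].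
  have [r [Sr1 rE]] := E1 a Ia; have [y [q [ly Sq yE]]] := lP r Sr1.
  have [I0 ID IZ] := nz_ideal_submodule nI'; have [J0 JD JZ] := nz_ideal_submodule nJ'.
  have lty : (index y l < size l)%N by rewrite index_mem.
  have /c2[a' [Ja' a'E]] : c (Ordinal lty).
    apply/c1; exists (a + (- q) * b1); split.
      by apply: ID => //; apply: IZ => //; apply: subringN.
    by rewrite /= nth_index // mulrDr rE yE; ring.
  rewrite /= nth_index // in a'E.
  exists (a' + q * b2); split; first by apply: JD => //; apply: JZ.
  have -> : b2 * m * a = b2 * (m * a) by ring.
  have -> : b1 * m * (a' + q * b2) = b1 * (m * a') + b1 * m * (q * b2) by ring.
  by rewrite rE a'E yE; ring.
exists (b' * m), (b * m); do 2![split; first by apply: subringM].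
do 2![split; first by rewrite mulf_neq0].
by move=> x; split; [apply: (H I b b' J) | apply: (H J b' b I)].
Qed.

Lemma involution_odd n (f : 'I_n -> 'I_n) (i0 : 'I_n) : involutive f ->
  (forall i, (f i == i) = (i == i0)) -> odd n.
Proof.
move=> fK fix0; rewrite -(card_ord n) -cardsT.
pose A := [set i : 'I_n | (i < f i)%N].
have -> : [set: 'I_n] = i0 |: (A :|: f @: A).
  apply/setP=> i; rewrite !inE; apply/esym; rewrite -fix0.
  have [//|ne] := eqVneq (f i) i; case: (ltngtP i (f i)) => //= h.
    apply/imsetP; exists (f i); last by rewrite fK.
    by rewrite inE fK.
  by case/eqP: ne; apply: val_inj.
rewrite cardsU1 cardsU card_imset; last exact: can_inj fK.
have -> : A :&: f @: A = set0.
  apply/setP=> i; rewrite !inE; apply/andP=> -[lt /imsetP[j]].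
  by rewrite inE => ltj E; move: lt; rewrite E fK ltnNge ltnW.
rewrite cards0 subn0 !inE ltn_neqAle.
have /eqP E : f i0 == i0 by rewrite fix0.
rewrite E eqxx /= (_ : (i0 \in _) = false) /=; first by rewrite addnn odd_double.
apply/imsetP=> -[j]; rewrite inE => ltj E'; have : f i0 = j by rewrite E' fK.
by rewrite E => jE; move: ltj; rewrite -jE E ltnn.
Qed.

Lemma ideal_equiv_prod S I I' J J' : is_subring S -> ideal_equiv S I I' -> ideal_equiv S J J' ->
  ideal_equiv S (module_prod I J) (module_prod I' J').
Proof.
move=> Sr [a [b [Sa [Sb [a0 [b0 E]]]]]] [c [d [Sc [Sd [c0 [d0 F]]]]]].
exists (a * c), (b * d); do 2![split; first by apply: subringM].
do 2![split; first by rewrite mulf_neq0].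
move=> x; split=> /scale_module_prod H; apply/scale_module_prod; move: H;
  by apply: module_prod_mono => y; [move/E | move/F].
Qed.

Lemma ideal_equiv_same S I J : is_subring S -> same_set I J -> ideal_equiv S I J.
Proof.
move=> Sr E; have := ideal_equiv_refl I Sr => -[a [b [Sa [Sb [a0 [b0 F]]]]]].
exists a, b; do 4?split=> //; exact: same_set_trans F (scale_set_same b E).
Qed.

Section OddClassNumber.
Variable S : pset.
Hypothesis Sr : is_subring S.
Local Notation "I ~~ J" := (ideal_equiv S I J) (at level 70).
Local Notation "I ** J" := (module_prod I J) (at level 40).

Lemma principal_equiv I g : nz_ideal S I -> g != 0 -> same_set I (scale_set g S) -> I ~~ S.
Proof.
move=> nI g0 E; have [IS _] := nI.
have Sg : S g by apply/IS/E; exists 1; rewrite mulr1; split=> //; apply: subring1.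
exists 1, g; split; first exact: subring1.
do 3![split; first by rewrite ?oner_neq0].
by apply: same_set_trans E; apply: (scale_set_unit (nz_ideal_submodule nI)); apply: unit_in1.
Qed.

Lemma module_prod1 I : nz_ideal S I -> S ** I ~~ I.
Proof.
move=> nI; apply: ideal_equiv_same => //; have [I0 ID IZ] := nz_ideal_submodule nI.
apply: same_setP => x; last by move=> Ix; rewrite -[x]mul1r; apply: module_prodM => //; apply: subring1.
by elim=> [u v Su Iv|u v _ Iu _ Iv]; [apply: IZ|apply: ID].
Qed.

Lemma inverse_class_uniq I J K : nz_ideal S J -> nz_ideal S K ->
  I ** J ~~ S -> I ** K ~~ S -> J ~~ K.
Proof.
move=> nJ nK IJ IK; have refl M := ideal_equiv_refl M Sr.
have tr := fun M N P => @ideal_equiv_trans S M N P Sr.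
apply: (tr _ (S ** J)); first exact/ideal_equiv_sym/module_prod1.
apply: (tr _ ((I ** K) ** J)); first exact/ideal_equiv_prod/refl/ideal_equiv_sym.
apply: (tr _ ((I ** J) ** K)).
  apply: ideal_equiv_same => //; apply: same_setP => x /module_prodA H; apply: module_prodAr;
    by apply: module_prod_mono H => // y; apply: module_prodC.
apply: (tr _ (S ** K)); last exact: module_prod1.
by apply: ideal_equiv_prod.
Qed.

Lemma odd_class_number h : invertible_ideals S -> no_two_torsion S -> class_number S h -> odd h.
Proof.
move=> inv N2 [reps [nr [inj cov]]].
have refl M := ideal_equiv_refl M Sr.
have tr := fun M N P => @ideal_equiv_trans S M N P Sr.
have inve i : exists j, reps i ** reps j ~~ S.
  have [J [g [nJ g0 E]]] := inv _ (nr i); have [j Jj] := cov J nJ; exists j.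
  apply: (tr _ (reps i ** J)); first by apply: ideal_equiv_prod => //; apply: ideal_equiv_sym.
  by apply: principal_equiv g0 E; apply: nz_ideal_prod.
have [f fP] := fin_all_exists inve.
have C I J : I ** J ~~ J ** I.
  by apply: ideal_equiv_same => //; apply: same_setP => x; apply: module_prodC.
have [i0 Si0] := cov S (nz_ideal_self Sr).
apply: (@involution_odd _ f i0).
  move=> i; apply: inj; apply: (@inverse_class_uniq (reps (f i))) => //.
  exact: tr (C _ _) (fP i).
move=> i; apply/eqP/eqP => [fi|->].
  have := fP i; rewrite fi => -[a [b [Sa [Sb [a0 [b0 E]]]]]].
  have ba0 : b / a != 0 by rewrite mulf_neq0 // invr_eq0.
  have E' : same_set (reps i ** reps i) (scale_set (b / a) S).
    apply: (scale_set_inj a0); apply: same_set_trans E _.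
    apply: same_set_sym; apply: same_set_trans (scale_setA _ _ _) _.
    by rewrite mulrC divfK.
  have [IS _] := nr i.
  have [|g [g0 Eg]] := N2 _ _ (nz_ideal_submodule (nr i)) _ ba0 E'.
    by move=> x /IS; apply: frac_sub.
  exact/inj/(tr _ S _ _ Si0)/(principal_equiv (nr i) g0 Eg).
apply: inj; apply: (@inverse_class_uniq (reps i0)) => //.
apply: (tr _ (S ** S)); first by apply: ideal_equiv_prod => //; apply: ideal_equiv_sym.
exact/module_prod1/nz_ideal_self.
Qed.
End OddClassNumber.

(** * The prime above two *)

Lemma Zhalf_scale a I : same_set (Zhalf (scale_set a I)) (scale_set a (Zhalf I)).
Proof.
have two0 k : (2 ^+ k : algC) != 0 by rewrite expf_neq0 // pnatr_eq0.
apply: same_setP => x.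
  case=> k [y [Iy E]]; exists (y / 2 ^+ k); split.
    by exists k; rewrite mulrC divfK.
  by apply: (mulfI (two0 k)); rewrite E; field.
by case=> y [[k Iy] ->]; exists k, (2 ^+ k * y); rewrite mulrCA.
Qed.

Lemma Zhalf_same I J : same_set I J -> same_set (Zhalf I) (Zhalf J).
Proof. by move=> E x; split=> -[k /E Ix]; exists k. Qed.

Section Uniformizer.
Variables (S : pset) (N : algC -> algC) (p eps : algC) (e : nat).
Hypothesis Sr : is_subring S.
Hypothesis nN : int_norm S N.
Hypothesis Sp : S p.
Hypothesis Ueps : is_unit_in S eps.
Hypothesis two_p : 2 = p ^+ e.+1 * eps.
Hypothesis res_p : forall x, S x -> exists y, S y /\ (x = p * y \/ x = 1 + p * y).

Let R := Zhalf S.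
Let Rr : is_subring R. Proof. exact: Zhalf_subring. Qed.
Let two0 : (2 : algC) != 0. Proof. by rewrite pnatr_eq0. Qed.
Let p0 : p != 0.
Proof. by apply: contraNneq two0 => pE; rewrite two_p pE expr0n mul0r. Qed.
Let pk0 k : p ^+ k != 0. Proof. by rewrite expf_neq0. Qed.
Let eps0 : eps != 0 := unit_in_neq0 Ueps.
Hint Resolve Sr Rr two0 p0 pk0 eps0 Sp : core.
Let SX k x : S x -> S (x ^+ k). Proof. exact: subringX. Qed.
Let Seps : S eps. Proof. by case: Ueps. Qed.
Let S1 : S 1. Proof. exact: subring1. Qed.
Hint Resolve SX Seps S1 : core.

Definition dvd_unif x := exists z, S z /\ x = p * z.

Lemma int_norm1 : N 1 = 1.
Proof.
have N0 : N 1 != 0 by apply: (int_norm_neq0 nN); rewrite oner_neq0.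
by apply: (mulfI N0); rewrite -(int_normM nN) !mulr1.
Qed.

Lemma int_norm_unit x : is_unit_in S x -> `|N x| = 1.
Proof.
move=> [Sx [y [Sy xy]]].
have /natrP[a aE] := natr_norm_int (int_norm_int nN Sx).
have /natrP[b bE] := natr_norm_int (int_norm_int nN Sy).
have : `|N x| * `|N y| = 1 by rewrite -normrM -(int_normM nN) xy int_norm1 normr1.
rewrite aE bE -natrM => /eqP; rewrite -[1]/(1%:R) eqr_nat muln_eq1 => /andP[/eqP-> _].
by [].
Qed.

(** If the norm of [p] had modulus 1, so would that of 2; but all conjugates of [1/2] are small, so
    its norm is below 1. *)
Lemma int_norm_unif_gt1 : 1 < `|N p|.
Proof.
have /natrP[a aE] := natr_norm_int (int_norm_int nN Sp).
have NX k : N (p ^+ k) = N p ^+ k.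
  by elim: k => [|k IH]; rewrite ?int_norm1 // !exprS (int_normM nN) IH.
have lt : `|N 2^-1| < 1.
  apply: (int_norm_lt1 nN) => nu; rewrite fmorphV rmorph_nat normfV normr_nat.
  by rewrite invf_lt1 ?ltr1n // ltr0n.
have E : `|N 2| * `|N 2^-1| = 1 by rewrite -normrM -(int_normM nN) mulfV // int_norm1 normr1.
have N2 : `|N 2| = a%:R ^+ e.+1.
  by rewrite two_p (int_normM nN) NX normrM normrX (int_norm_unit Ueps) mulr1 aE.
rewrite aE ltr1n ltnNge; apply/negP; rewrite leq_eqVlt ltnS leqn0 => /orP[]/eqP a1.
  by move: E lt; rewrite N2 a1 expr1n mul1r => ->; rewrite ltxx.
by move/eqP: E; rewrite N2 a1 expr0n mul0r eq_sym oner_eq0.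
Qed.

Lemma unif_not_unit : ~ S p^-1.
Proof.
move=> Sp'; have := int_norm_unif_gt1; rewrite int_norm_unit ?ltxx //.
exact: unit_inP.
Qed.

(** Each division by [p] strictly lowers the integer [|N x|], so the division stops. *)
Lemma unif_order x : S x -> x != 0 -> exists k y, [/\ S y, ~ dvd_unif y & x = p ^+ k * y].
Proof.
move=> Sx x0; have [n] : exists n : nat, `|N x| < n%:R.
  have /natrP[n ->] := natr_norm_int (int_norm_int nN Sx).
  by exists n.+1; rewrite ltr_nat.
elim: n => [|n IH] in x Sx x0 *; first by rewrite normr_lt0.
have /natrP[m mE] := natr_norm_int (int_norm_int nN Sx).
rewrite mE ltr_nat ltnS => le_mn.
case: (classic (dvd_unif x)) => [[z [Sz xE]]|nd]; last by exists 0%N, x; rewrite expr0 mul1r.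
have z0 : z != 0 by apply: contraNneq x0 => z0; rewrite xE z0 mulr0.
have [|k [y [Sy nd yE]]] := IH z Sz z0.
  apply: lt_le_trans (_ : m%:R <= _); last by rewrite ler_nat.
  rewrite -mE xE (int_normM nN) normrM -[ltLHS]mul1r ltr_pM2r ?int_norm_unif_gt1 //.
  by rewrite normr_gt0 (int_norm_neq0 nN).
by exists k.+1, y; split=> //; rewrite xE yE exprS mulrA.
Qed.

Lemma not_dvd_unifP x : S x -> ~ dvd_unif x -> exists y, S y /\ x = 1 + p * y.
Proof.
by move=> Sx nd; have [y [Sy [xE|xE]]] := res_p Sx; [case: nd; exists y | exists y].
Qed.

Lemma not_dvd_unif1 x : S x -> ~ dvd_unif (1 + p * x).
Proof.
move=> Sx [z [Sz E]]; apply: unif_not_unit.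
have -> : p^-1 = z - x; last exact: subringB.
by apply: (mulfI p0); rewrite mulfV // mulrBr -E addrK.
Qed.

(** [p] is prime with residue field of two elements: what is not divisible by [p] is congruent to
    1. *)
Lemma not_dvd_unifM x y : S x -> S y -> ~ dvd_unif x -> ~ dvd_unif y -> ~ dvd_unif (x * y).
Proof.
move=> Sx Sy /(not_dvd_unifP Sx)[a [Sa ->]] /(not_dvd_unifP Sy)[b [Sb ->]].
have -> : (1 + p * a) * (1 + p * b) = 1 + p * (a + b + p * (a * b)) by ring.
by apply: not_dvd_unif1; do ![apply: subringD => //|apply: subringM => //].
Qed.

Lemma not_dvd_unif_unit x : is_unit_in S x -> ~ dvd_unif x.
Proof.
move=> [Sx [y [Sy xy]]] [z [Sz E]]; apply: unif_not_unit.
have -> : p^-1 = z * y; last exact: subringM.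
by apply: (mulfI p0); rewrite mulfV // mulrA -E.
Qed.

Lemma unif_pow_inj a b x y : S x -> S y -> ~ dvd_unif x -> ~ dvd_unif y ->
  p ^+ a * x = p ^+ b * y -> a = b /\ x = y.
Proof.
move=> Sx Sy nx ny E.
suff H c d u v : S v -> ~ dvd_unif u -> (c < d)%N -> p ^+ c * u = p ^+ d * v -> False.
  have ab : a = b by case: (ltngtP a b) => // lt; [case: (H _ _ _ _ Sy nx lt E)|case: (H _ _ _ _ Sx ny lt (esym E))].
  by split=> //; move: E; rewrite ab => /mulfI; apply.
move=> Sv nu lt Ecd; apply: nu; exists (p ^+ (d - c.+1) * v); split; first by apply: subringM => //; apply: SX.
by apply: (mulfI (pk0 c)); rewrite Ecd -[in LHS](subnKC lt) exprD exprSr -!mulrA.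
Qed.

Lemma unif_unit_half : is_unit_in R p.
Proof.
apply: unit_inP => //; first exact: Zhalf_sub.
exists 1%N; rewrite expr1 two_p exprSr; have -> : p ^+ e * p * eps * p^-1 = p ^+ e * eps by field.
by apply: subringM => //; apply: SX.
Qed.

(** Clear denominators of [u] and of its inverse and compare orders at [p] in the product, a power
    of 2: the parts prime to [p] multiply to a unit of [S]. Two natural exponents encode one
    integral power of [p]. *)
Lemma unit_half_split u : is_unit_in R u ->
  exists k l w, is_unit_in S w /\ u * p ^+ l = p ^+ k * w.
Proof.
move=> Uu; have u0 := unit_in_neq0 Uu; case: Uu => [[a Su] [u' [[b Su'] uu]]].
have u'0 : u' != 0 by apply/eqP=> u'0; move/eqP: uu; rewrite u'0 mulr0 eq_sym oner_eq0.
have tk0 k : (2 ^+ k : algC) != 0 by rewrite expf_neq0.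
have [|k [x [Sx nx xE]]] := unif_order Su; first by rewrite mulf_neq0.
have [|l [y [Sy ny yE]]] := unif_order Su'; first by rewrite mulf_neq0.
have [|||_ E] := @unif_pow_inj (e.+1 * (a + b)) (k + l) (eps ^+ (a + b)) (x * y)
   (SX _ Seps) (subringM Sr Sx Sy).
- by apply: not_dvd_unif_unit; apply: unit_inX.
- exact: not_dvd_unifM.
- by rewrite exprM -exprMn -two_p !exprD mulrACA -xE -yE mulrACA uu mulr1.
have Ux : is_unit_in S x by apply: (unit_in_div Sr Sx Sy (esym E)); apply: unit_inX.
exists k, (e.+1 * a)%N, (x * (eps ^+ a)^-1); split.
  by apply: unit_inM => //; apply: unit_inV => //; apply: unit_inX.
have ea0 : eps ^+ a != 0 by rewrite expf_neq0.
apply: (mulIf ea0); rewrite -mulrA exprM -exprMn -two_p mulrC xE.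
by field.
Qed.

(** The order at [p] of a square is even. *)
Lemma odd_unif_not_square w v : is_unit_in S w -> is_unit_in R v -> p * w <> v ^+ 2.
Proof.
move=> Uw Uv E; have [k [l [w' [Uw' vE]]]] := unit_half_split Uv.
have [|||||] := @unif_pow_inj (l.*2.+1) k.*2 w (w' ^+ 2).
- by case: Uw.
- by apply: SX; case: Uw'.
- exact: not_dvd_unif_unit.
- by apply: not_dvd_unif_unit; apply: unit_inX.
- rewrite exprS -!muln2 !exprM mulrAC E -exprMn vE; ring.
by move=> /(congr1 odd); rewrite /= !odd_double.
Qed.

(** Prime to [p]: such an ideal is recovered from its extension to [S[1/2]] by intersecting with
    [S]. *)
Definition saturated (I : pset) : Prop := forall x, S x -> I (p * x) -> I x.

Lemma saturatedX I k x : saturated I -> S x -> I (p ^+ k * x) -> I x.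
Proof.
move=> sI Sx; elim: k => [|k IH]; first by rewrite mul1r.
rewrite exprS -mulrA => Ix; apply/IH/(sI _ _ Ix).
by apply: subringM => //; apply: SX.
Qed.

Lemma Zhalf_saturated I x : nz_ideal S I -> saturated I -> S x -> Zhalf I x -> I x.
Proof.
move=> nI sI Sx [k]; rewrite two_p exprMn -exprM => Ix.
apply: (saturatedX sI Sx (k := e.+1 * k)).
have ek0 : eps ^+ k != 0 by rewrite expf_neq0.
have -> : p ^+ (e.+1 * k) * x = (eps ^+ k)^-1 * (p ^+ (e.+1 * k) * eps ^+ k * x) by field.
have [_ _ IZ] := nz_ideal_submodule nI.
by apply: IZ => //; apply: unit_in_invr => //; apply: unit_inX.
Qed.

(** Let [k] be the least order at [p] of an element of [I]; dividing by [p^k] leaves an ideal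
    containing some [x1 = 1 + p z]. It is saturated, since [u = x1 u - z (p u)]. *)
Lemma saturate I : nz_ideal S I -> exists k J,
  [/\ nz_ideal S J, saturated J & same_set I (scale_set (p ^+ k) J)].
Proof.
move=> nI; have [IS [I0 [ID [IZ [x [Ix x0]]]]]] := nI.
have [k [x1 [y [Iy Sx1 nx1 yE ymin]]]] : exists k x1 y, [/\ I y, S x1, ~ dvd_unif x1, y = p ^+ k * x1 &
    forall l z z1, I z -> S z1 -> ~ dvd_unif z1 -> z = p ^+ l * z1 -> (k <= l)%N].
  have [k [x1 [Sx1 nx1 xE]]] := unif_order (IS _ Ix) x0.
  elim/ltn_ind: k => k IH in x x1 Ix x0 Sx1 nx1 xE *.
  case: (classic (exists l z z1, [/\ I z, S z1, ~ dvd_unif z1, z = p ^+ l * z1 & (l < k)%N])).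
    move=> [l [z [z1 [Iz Sz1 nz1 zE lt]]]]; apply: (IH l lt z z1) => //.
    rewrite zE mulf_neq0 //; apply/eqP=> z10; apply: nz1; exists 0.
    by rewrite z10 mulr0; split=> //; apply: subring0.
  move=> H; exists k, x1, x; split=> // l z z1 Iz Sz1 nz1 zE.
  by rewrite leqNgt; apply/negP=> lt; apply: H; exists l, z, z1.
pose J := fun z => S z /\ I (p ^+ k * z).
have Jx1 : J x1 by split=> //; rewrite -yE.
exists k, J; split.
- apply: (@nz_idealP _ _ x1) => //.
  + split; first by rewrite /J mulr0; split=> //; apply: subring0.
      by move=> u v [Su Iu] [Sv Iv]; split; [apply: subringD | rewrite mulrDr; apply: ID].
    by move=> r u Sr1 [Su Iu]; split; [apply: subringM | rewrite mulrCA; apply: IZ].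
  + by move=> u [].
  + by apply/eqP=> x10; apply: nx1; exists 0; rewrite x10 mulr0; split=> //; apply: subring0.
- move=> u Su [_ Iu]; split=> //; have [z [Sz zE]] := not_dvd_unifP Sx1 nx1.
  have -> : p ^+ k * u = u * (p ^+ k * x1) + (- z) * (p ^+ k * (p * u)) by rewrite zE; ring.
  by apply: ID; apply: IZ => //; [case: Jx1 | apply: subringN].
- apply: same_setP => z; last by case=> u [[Su Iu] ->].
  move=> Iz; have [->|z0] := eqVneq z 0.
    by exists 0; rewrite mulr0; split=> //; split; rewrite ?mulr0 //; apply: subring0.
  have [l [z1 [Sz1 nz1 zE]]] := unif_order (IS _ Iz) z0.
  have le := ymin _ _ _ Iz Sz1 nz1 zE.
  have E : p ^+ k * (p ^+ (l - k) * z1) = z by rewrite mulrA -exprD subnKC.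
  exists (p ^+ (l - k) * z1); split=> //; split; last by rewrite E.
  by apply: subringM => //; apply: SX.
Qed.

Lemma Zhalf_ideal I : nz_ideal S I -> nz_ideal R (Zhalf I).
Proof.
move=> nI; have [IS [I0 [ID [IZ [x [Ix x0]]]]]] := nI.
have t k : S (2 ^+ k) by apply: SX; apply: subring_nat.
apply: (@nz_idealP _ _ x) => //.
- split; first by exists 0%N; rewrite mulr0.
    move=> u v [k Iu] [l Iv]; exists (k + l)%N.
    have -> : 2 ^+ (k + l) * (u + v) = 2 ^+ l * (2 ^+ k * u) + 2 ^+ k * (2 ^+ l * v).
      by rewrite exprD; ring.
    by apply: ID; apply: IZ.
  by move=> r u [k Sr1] [l Iu]; exists (k + l)%N; rewrite exprD mulrACA; apply: IZ.
- by move=> u [k /IS]; exists k.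
- by exists 0%N; rewrite mul1r.
Qed.

Lemma restrict_ideal J : nz_ideal R J -> nz_ideal S (fun x => S x /\ J x).
Proof.
move=> nJ; have [JR [J0 [JD [JZ [x [Jx x0]]]]]] := nJ.
have [k Sx] := JR _ Jx.
apply: (@nz_idealP _ _ (2 ^+ k * x)) => //.
- split; first by split=> //; apply: subring0.
    by move=> y z [Sy Jy] [Sz Jz]; split; [apply: subringD | apply: JD].
  by move=> r y Sr1 [Sy Jy]; split; [apply: subringM | apply: JZ => //; apply: Zhalf_sub].
- by move=> y [].
- by split=> //; apply: JZ => //; apply: Zhalf_sub; apply: SX; apply: subring_nat.
- by rewrite mulf_neq0 // expf_neq0.
Qed.

Lemma Zhalf_restrict J : nz_ideal R J -> same_set (Zhalf (fun x => S x /\ J x)) J.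
Proof.
move=> nJ; have [JR [J0 [JD [JZ _]]]] := nJ; apply: same_setP => x.
  case=> k [Sx Jx]; have k0 : (2 ^+ k : algC) != 0 by rewrite expf_neq0.
  have -> : x = (2^-1) ^+ k * (2 ^+ k * x) by rewrite exprVn mulKf.
  by apply: JZ => //; apply: subringX => //; apply: Zhalf_half.
move=> Jx; have [k Sx] := JR _ Jx; exists k; split=> //.
by apply: JZ => //; apply: Zhalf_sub; apply: SX; apply: subring_nat.
Qed.

Lemma ideal_equiv_half I J : ideal_equiv S I J -> ideal_equiv R (Zhalf I) (Zhalf J).
Proof.
move=> [a [b [Sa [Sb [a0 [b0 E]]]]]]; exists a, b; do 2![split; first exact: Zhalf_sub].
do 2!split=> //; apply: same_set_trans (same_set_sym (Zhalf_scale a I)) _.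
exact: same_set_trans (Zhalf_same E) (Zhalf_scale b J).
Qed.

Lemma unif_clear a : R a -> a != 0 -> exists b u,
  [/\ S b, ~ dvd_unif b, b != 0, is_unit_in R u & a = u * b].
Proof.
move=> [k Sa] a0; have tk0 : (2 ^+ k : algC) != 0 by rewrite expf_neq0.
have [|l [b [Sb nb E]]] := unif_order Sa; first by rewrite mulf_neq0.
have b0 : b != 0.
  by apply/eqP=> b0; apply: nb; exists 0; rewrite b0 mulr0; split=> //; apply: subring0.
exists b, (p ^+ l / 2 ^+ k); split=> //.
  apply: unit_inM => //; first by apply: unit_inX => //; apply: unif_unit_half.
  rewrite -exprVn; apply: unit_inX => //; apply: unit_inP => //; first exact: Zhalf_half.
    by rewrite invrK; apply: Zhalf_sub; apply: subring_nat.
  by rewrite invr_eq0.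
by apply: (mulfI tk0); rewrite E; field.
Qed.

Lemma saturated_scale a I : S a -> ~ dvd_unif a -> nz_ideal S I -> saturated I ->
  saturated (scale_set a I).
Proof.
move=> Sa na nI sI x Sx [y [Iy E]]; have [IS _] := nI.
case: (classic (dvd_unif y)) => [[z [Sz yE]]|ny].
  exists z; split; first by apply: sI => //; rewrite -yE.
  by apply: (mulfI p0); rewrite E yE; ring.
by case: (not_dvd_unifM Sa (IS _ Iy) na ny); exists x.
Qed.

(** Both ideals may be taken saturated, and the multipliers, up to units of [S[1/2]], in [S] and not
    divisible by [p]. Both scaled ideals are then saturated, and the equality over [S[1/2]]
    restricts to [S]. *)
Lemma ideal_equiv_half_inv I J : nz_ideal S I -> nz_ideal S J ->
  ideal_equiv R (Zhalf I) (Zhalf J) -> ideal_equiv S I J.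
Proof.
move=> nI nJ eq; have tr := fun M N P => @ideal_equiv_trans S M N P Sr.
have [k [I1 [nI1 sI1 IE]]] := saturate nI; have [l [J1 [nJ1 sJ1 JE]]] := saturate nJ.
have II1 : ideal_equiv S I I1.
  exists 1, (p ^+ k); do 4![split; first by rewrite ?oner_neq0 //; apply: SX].
  apply: same_set_trans IE; exact: scale_set_unit (nz_ideal_submodule nI) (unit_in1 Sr).
have JJ1 : ideal_equiv S J J1.
  exists 1, (p ^+ l); do 4![split; first by rewrite ?oner_neq0 //; apply: SX].
  apply: same_set_trans JE; exact: scale_set_unit (nz_ideal_submodule nJ) (unit_in1 Sr).
apply: (tr _ I1 _ II1); apply: (tr _ J1); last exact: ideal_equiv_sym.
have : ideal_equiv R (Zhalf I1) (Zhalf J1).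
  have trR := fun M N P => @ideal_equiv_trans R M N P Rr.
  apply: (trR _ (Zhalf I)); first exact/ideal_equiv_half/ideal_equiv_sym.
  by apply: (trR _ (Zhalf J)) => //; apply: ideal_equiv_half.
move=> [a [b [Ra [Rb [a0 [b0 E]]]]]].
have [a' [u [Sa' na' a'0 Uu aE]]] := unif_clear Ra a0.
have [b' [v [Sb' nb' b'0 Uv bE]]] := unif_clear Rb b0.
have E' : same_set (scale_set a' (Zhalf I1)) (scale_set b' (Zhalf J1)).
  have mI := nz_ideal_submodule (Zhalf_ideal nI1); have mJ := nz_ideal_submodule (Zhalf_ideal nJ1).
  have EI : same_set (scale_set a (Zhalf I1)) (scale_set a' (Zhalf I1)).
    rewrite aE; apply: same_set_trans (same_set_sym (scale_setA _ _ _)) _.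
    by apply: scale_set_unit Uu; apply: submodule_scale.
  have EJ : same_set (scale_set b (Zhalf J1)) (scale_set b' (Zhalf J1)).
    rewrite bE; apply: same_set_trans (same_set_sym (scale_setA _ _ _)) _.
    by apply: scale_set_unit Uv; apply: submodule_scale.
  apply: same_set_trans (same_set_sym EI) _; exact: same_set_trans E EJ.
exists a', b'; do 4!split=> //.
have H c M d M' : S c -> ~ dvd_unif c -> c != 0 -> S d -> ~ dvd_unif d -> d != 0 ->
    nz_ideal S M -> nz_ideal S M' -> saturated M' ->
    same_set (scale_set c (Zhalf M)) (scale_set d (Zhalf M')) ->
  forall x, scale_set c M x -> scale_set d M' x.
  move=> Sc nc c0 Sd nd d0 nM nM' sM' EE x [y [My ->]]; have [MS _] := nM.
  apply: Zhalf_saturated; first exact: nz_ideal_scale.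
  - exact: saturated_scale.
  - by apply: subringM => //; apply: MS.
  - by apply/Zhalf_scale/EE; exists y; split=> //; exists 0%N; rewrite mul1r.
by move=> x; split; apply: H => //; apply: same_set_sym.
Qed.

Lemma class_number_half h : class_number S h -> class_number R h.
Proof.
move=> [reps [nr [inj cov]]]; exists (fun i => Zhalf (reps i)); split; last split.
- by move=> i; apply: Zhalf_ideal.
- by move=> i j /ideal_equiv_half_inv H; apply: inj; apply: H.
move=> J nJ; have [i Ji] := cov _ (restrict_ideal nJ); exists i.
apply: (@ideal_equiv_trans R _ (Zhalf (fun x => S x /\ J x))) => //.
  by apply: ideal_equiv_same => //; apply/same_set_sym/Zhalf_restrict.
exact: ideal_equiv_half.
Qed.
End Uniformizer.

(** * The integers *)

Definition is_ints (S : pset) : Prop := forall x, S x <-> x \is a Num.int.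

Section Integers.
Variable S : pset.
Hypothesis SZ : is_ints S.

Lemma ints_subring : is_subring S.
Proof.
split; first by apply/SZ; apply: rpred1.
  by move=> x y /SZ hx /SZ hy; apply/SZ; rewrite rpredB.
by move=> x y /SZ hx /SZ hy; apply/SZ; rewrite rpredM.
Qed.
Hint Resolve ints_subring : core.

Lemma ints_frac_fix (nu : {rmorphism algC -> algC}) x : fracset S x -> nu x = x.
Proof.
by move=> [a [b [/SZ/intrP[m ->] /SZ/intrP[n ->] _ ->]]]; rewrite fmorph_div !rmorph_int.
Qed.
Lemma ints_frac_real x : fracset S x -> x \is Num.real.
Proof.
by move=> [a [b [/SZ/intrP[m ->] /SZ/intrP[n ->] _ ->]]]; rewrite rpred_div ?realz.
Qed.
Lemma ints_norm : int_norm S id.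
Proof. by split=> // [x /SZ|x h] //; apply: (h idfun). Qed.

Lemma ints_floor x : fracset S x -> exists w : int, 0 <= x - w%:~R < 1.
Proof.
move=> /ints_frac_real/real_floor_itv/andP[h1 h2]; exists (Num.floor x).
by rewrite subr_ge0 h1 ltrBlDl; rewrite intrD in h2.
Qed.

Lemma ints_principal : principal_ideals S.
Proof.
apply: (euclidean_principal ints_subring ints_norm) => x Fx.
have [w /andP[h1 h2]] := ints_floor Fx; exists w%:~R.
by split; [apply/SZ; apply: intr_int | rewrite ger0_norm].
Qed.

Lemma ints_finite_residues : finite_residues S.
Proof.
move=> m m0; exists [seq i%:R | i <- iota 0 m] => x /SZ/intrP[z ->].
have m0' : m%:Z != 0 by case: m m0.
exists ((z %% m)%Z)%:~R, ((z %/ m)%Z)%:~R; split.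
- have : (0 <= (z %% m)%Z) && ((z %% m)%Z < m%:Z) by rewrite modz_ge0 // ltz_pmod.
  case: ((z %% m)%Z) => // r /andP[_ lt]; apply/mapP; exists r => //.
  by rewrite mem_iota add0n.
- by apply/SZ; apply: intr_int.
- by rewrite {1}(divz_eq z m) addrC rmorphD rmorphM /= mulrC.
Qed.

(** Pigeonhole: [t] takes [k ^ #|I| + 1] values, 0 included, while the first base-[k] digits of the
    fractional parts of the [t x_i] form only [k ^ #|I|] patterns. Two colliding multiples are
    subtracted. *)
Lemma ints_approximable : approximable S.
Proof.
move=> I k k0; exists (k ^ #|I|)%N => x Fx.
have Fxt (t : nat) i : fracset S (t%:R * x i).
  by apply: fracM => //; apply: frac_sub => //; apply: subring_nat.
case: k k0 => // k _; set K := k.+1%:R : algC.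
have K0 : 0 < K by rewrite ltr0n.
have digits t i : exists c : 'I_k.+1, exists w : int,
    0 <= K * (t%:R * x i - w%:~R) - c%:R < 1.
  have [w /andP[w0 w1]] := ints_floor (Fxt t i).
  have Fy : fracset S (K * (t%:R * x i - w%:~R)).
    apply: fracM => //; first by apply: frac_sub => //; apply: subring_nat.
    by apply: fracB => //; apply: frac_sub => //; apply: subring_int.
  have [c /andP[c0 c1]] := ints_floor Fy.
  have : (0 <= c) && (c < k.+1%:Z).
    rewrite -(ltr_int algC) -[0 <= c]/(0 <= c) andbC; apply/andP; split.
      apply: le_lt_trans (_ : K * (t%:R * x i - w%:~R) < _); first by rewrite -subr_ge0.
      by rewrite -[ltRHS]mulr1 ltr_pM2l.
    rewrite -ltzD1 -(ltr_int algC) rmorphD /= mulr0z mulr1z.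
    have: K * (t%:R * x i - w%:~R) < 1 + c%:~R by rewrite -ltrBlDr.
    by move=> h; rewrite addrC; apply: le_lt_trans h; rewrite mulr_ge0 // ltW.
  case: c c0 c1 => // c c0 c1 /andP[_ lt]; exists (Ordinal (lt : (c < k.+1)%N)), w.
  by apply/andP; split.
have /fin_all_exists[c cP] (t : 'I_(k.+1 ^ #|I|).+1) : exists c : {ffun I -> 'I_k.+1},
    forall i, exists w : int, 0 <= K * (t%:R * x i - w%:~R) - (c i)%:R < 1.
  have [c cP] := fin_all_exists (digits t).
  by exists [ffun i => c i] => i; rewrite ffunE.
have /injectivePn[t1 [t2 ne E]] : ~~ injectiveb c.
  apply/negP=> /injectiveP/leq_card; rewrite card_ord card_ffun card_ord.
  by rewrite ltnn.
wlog lt : t1 t2 ne E / (t1 < t2)%N.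
  move=> H; case: (ltngtP t1 t2) => h; [exact: (H t1 t2)| |by case/eqP: ne; apply: val_inj].
  by apply: (H t2 t1) => //; rewrite eq_sym.
have /fin_all_exists[w wP] i : exists w : int, `|(t2 - t1)%:R * x i - w%:~R| < K^-1.
  have [[w1 /andP[a1 b1]] [w2 /andP[a2 b2]]] := (cP t1 i, cP t2 i); exists (w2 - w1).
  rewrite -E in a2 b2.
  have -> : (t2 - t1)%:R * x i - (w2 - w1)%:~R =
    K^-1 * ((K * (t2%:R * x i - w2%:~R) - (c t1 i)%:R) - (K * (t1%:R * x i - w1%:~R) - (c t1 i)%:R)).
    have Kn : K != 0 by rewrite gt_eqF.
    apply: (mulfI Kn); rewrite mulVKf // natrB ?(ltnW lt) // rmorphB /=.
    by move: (K) => K1; ring.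
  rewrite normrM gtr0_norm ?invr_gt0 // -[ltRHS]mulr1 ltr_pM2l ?invr_gt0 //.
  rewrite real_ltr_norml; last by rewrite rpredB ?ger0_real.
  apply/andP; split; last by rewrite ltrBlDr (lt_le_trans b2) // lerDl.
  by rewrite ltrBrDr (lt_le_trans _ a2) // addrC subr_lt0.
exists (t2 - t1)%N, (fun i => (w i)%:~R); split.
  by rewrite subn_gt0 lt /= (leq_trans (leq_subr _ _)) // -ltnS.
move=> i; split; first by apply/SZ; apply: intr_int.
move=> nu; rewrite ints_frac_fix // natrB ?(ltnW lt) //.
by apply: fracB => //; [rewrite -natrB ?(ltnW lt)|apply: frac_sub => //; apply: subring_int].
Qed.
End Integers.

Lemma Zadj_int (c : int) : is_ints (Zadj c%:~R).
Proof.
move=> x; split.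
  apply: (@Zadj_min (fun x => x \is a Num.int)); last exact: intr_int.
  by split; [apply: rpred1|move=> *; apply: rpredB|move=> *; apply: rpredM].
by move=> /intrP[m ->]; apply: (subring_int (Zadj_subring _) m).
Qed.

(** * Primitive roots of unity *)

Definition rsum (z : algC) : algC := z + z^-1.

Lemma prim_neq0 n (z : algC) : n.-primitive_root z -> z != 0.
Proof. by move=> pz; rewrite (prim_root_eq0 pz) -lt0n (prim_order_gt0 pz). Qed.

Lemma rsum_sqr z : z != 0 -> rsum z ^+ 2 = 2 + rsum (z ^+ 2).
Proof. by move=> z0; rewrite /rsum; field. Qed.

Lemma prim_sqr m (z : algC) : (m.*2).-primitive_root z -> m.-primitive_root (z ^+ 2).
Proof.
move=> pz; have := exp_prim_root pz 2; rewrite -muln2 (gcdn_idPl _) ?dvdn_mull //.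
by rewrite mulnK.
Qed.

(** If [y] had odd order, [y^2] would have that same order, against [m] being even. *)
Lemma prim_sqrt m (y : algC) : ~~ odd m -> m.-primitive_root (y ^+ 2) -> (m.*2).-primitive_root y.
Proof.
move=> em pz; have m0 := prim_order_gt0 pz.
have [||d pd _] := @prim_order_exists _ m.*2 y; first by rewrite double_gt0.
  by rewrite -mul2n exprM (prim_expr_order pz).
have pd2 := exp_prim_root pd 2.
have E : m = (d %/ gcdn 2 d)%N.
  apply/eqP; rewrite eqn_dvd (prim_order_dvd pz) (prim_expr_order pd2) eqxx.
  by rewrite (prim_order_dvd pd2) (prim_expr_order pz) eqxx.
have [od|ed] := boolP (odd d).
  by move: em; rewrite E (eqP (_ : coprime 2 d)) ?coprime2n // divn1 od.
have d2 : (2 %| d)%N by rewrite dvdn2.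
by rewrite E (gcdn_idPl d2) -muln2 divnK.
Qed.

Lemma prim_double_expr m (y : algC) : (m.*2).-primitive_root y -> y ^+ m = -1.
Proof.
move=> py; have m0 : (0 < m)%N by rewrite -double_gt0 (prim_order_gt0 py).
have /eqP : (y ^+ m) ^+ 2 = 1 ^+ 2 by rewrite -exprM muln2 (prim_expr_order py) expr1n.
rewrite eqf_sqr => /orP[|/eqP //]; rewrite -(prim_order_dvd py) => /dvdn_leq.
by move=> /(_ m0); rewrite -addnn -{3}[m]addn0 leq_add2l leqNgt m0.
Qed.

(** The exponent [m + 1] is prime to [2m] because [m] is even, and [y^(m+1) = -y] since
    [y^m = -1]. *)
Lemma conj_exists m : ~~ odd m -> (0 < m)%N ->
  exists s : {rmorphism algC -> algC}, forall y, (m.*2).-primitive_root y -> s y = - y.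
Proof.
move=> em m0; have co : coprime m.+1 m.*2.
  by rewrite -muln2 coprimeMr coprimeSn coprimen2 /= em.
have [s sP] := Qn_aut_exists co; exists s => y py.
by rewrite sP ?(prim_expr_order py) // exprS (prim_double_expr py) mulrN1.
Qed.

Lemma rsum_neq0 m (y : algC) : (2 < m)%N -> (m.*2).-primitive_root y -> rsum y != 0.
Proof.
move=> m2 py; have y0 := prim_neq0 py; apply/eqP=> E.
have y2 : y ^+ 2 = -1.
  have -> : y ^+ 2 = y * rsum y - 1 by rewrite /rsum; field.
  by rewrite E mulr0 sub0r.
have : (m.*2 %| 4)%N by rewrite (prim_order_dvd py) (exprM y 2 2) y2 sqrrN expr1n.
by move/dvdn_leq => /(_ isT); rewrite leqNgt -[4%N]/(2.*2)%N ltn_double m2.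
Qed.

Lemma tower_rsum m y : ~~ odd m -> (2 < m)%N -> (m.*2).-primitive_root y ->
  exists s : {rmorphism algC -> algC}, (forall x, (m.*2).-primitive_root x -> s x = - x) /\
    tower (Zadj (rsum (y ^+ 2))) (Zadj (rsum y)) s (rsum y).
Proof.
move=> em m2 py; have y0 := prim_neq0 py.
have [|s sP] := conj_exists em; first by rewrite (ltn_trans _ m2).
exists s; split=> //; apply: tower_Zadj.
- exact: rsum_sqr.
- exact: rsum_neq0 m2 py.
- by rewrite rmorphD fmorphV /= sP // /rsum invrN opprD.
Qed.

Lemma rsum_conj n z (nu : {rmorphism algC -> algC}) : n.-primitive_root z ->
  nu (rsum z) \is Num.real /\ `|nu (rsum z)| <= 2.
Proof.
move=> pz; have n0 := prim_order_gt0 pz.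
have N1 : `|nu z| = 1.
  apply/eqP; rewrite -(@pexpr_eq1 _ _ n) // -normrX -rmorphXn (prim_expr_order pz).
  by rewrite rmorph1 normr1.
rewrite rmorphD fmorphV /=; split.
  have -> : (nu z)^-1 = (nu z)^* by rewrite invC_norm N1 expr1n invr1 mul1r.
  by rewrite CrealE rmorphD /= conjCK addrC.
by rewrite (le_trans (ler_normD _ _)) // normfV N1 invr1.
Qed.

Lemma Zadj_rsum_real n z x : n.-primitive_root z -> fracset (Zadj (rsum z)) x -> totreal x.
Proof.
move=> pz; have H x' : Zadj (rsum z) x' -> totreal x'.
  apply: Zadj_min; last by move=> nu; case: (rsum_conj nu pz).
  split.
  - by move=> nu; rewrite rmorph1 real1.
  - by move=> a b ha hb nu; rewrite rmorphB rpredB ?ha ?hb.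
  - by move=> a b ha hb nu; rewrite rmorphM rpredM ?ha ?hb.
by move=> [a [b [/H ha /H hb _ ->]]] nu; rewrite fmorph_div rpred_div ?ha ?hb.
Qed.

Lemma Zadj_rsumX z k : z != 0 -> Zadj (rsum z) (rsum (z ^+ k)).
Proof.
move=> z0; have Sr := Zadj_subring (rsum z).
suff [] : Zadj (rsum z) (rsum (z ^+ k)) /\ Zadj (rsum z) (rsum (z ^+ k.+1)) by [].
elim: k => [|k [IH1 IH2]].
  rewrite expr0 expr1 {2}/rsum invr1; split; last exact: Zadj_gen.
  exact: subring_nat Sr 2.
split=> //.
have -> : rsum (z ^+ k.+2) = rsum z * rsum (z ^+ k.+1) - rsum (z ^+ k).
  have zk0 : z ^+ k != 0 by rewrite expf_neq0.
  by rewrite /rsum !exprS; move: (z ^+ k) zk0 => w w0; field; rewrite z0 w0.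
by apply: subringB => //; apply: subringM => //; apply: Zadj_gen.
Qed.

Lemma Zadj_rsum_prim n z y : n.-primitive_root z -> n.-primitive_root y ->
  Zadj (rsum z) (rsum y).
Proof.
move=> pz py; have [k ->] := prim_rootP pz (prim_expr_order py).
exact/Zadj_rsumX/(prim_neq0 pz).
Qed.

(** * Units realising all signatures, and the data independent of class groups *)

Inductive sign_units (n : nat) : pset :=
| sign_units_gen y : n.-primitive_root y -> sign_units n (- (1 + rsum y))
| sign_unitsM x y : sign_units n x -> sign_units n y -> sign_units n (x * y).

(** What can be carried up from the integers in both families, from orders 4 and 6; the class data
    of the second family start only at order 12. *)
Record arith_data (n : nat) (z : algC) : Prop := ArithData {
  arith_norm : exists N, int_norm (Zadj (rsum z)) N;
  arith_approx : approximable (Zadj (rsum z));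
  arith_residues : finite_residues (Zadj (rsum z));
  arith_gen_units : forall y, n.-primitive_root y ->
    is_unit_in (Zhalf (Zadj (rsum z))) (1 + rsum y);
  arith_signs : signs_in (Zhalf (Zadj (rsum z))) (sign_units n) }.

Lemma sign_units_unit S n x : is_subring S ->
    (forall y, n.-primitive_root y -> is_unit_in S (1 + rsum y)) ->
  sign_units n x -> is_unit_in S x.
Proof.
move=> Sr H; elim=> [y /H|{}x y _ Ux _ Uy]; [exact: unit_inN|exact: unit_inM].
Qed.

Lemma rsum_norm1 y : y != 0 -> (1 + rsum y) * (1 - rsum y) = - (1 + rsum (y ^+ 2)).
Proof. by move=> y0; rewrite /rsum; field. Qed.

Lemma gen_unit_step m z y (S T : pset) : is_subring T ->
    (forall x, S x -> T x) -> Zadj (rsum z) (rsum y) -> y != 0 ->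
    (forall x, Zadj (rsum z) x -> T x) ->
    is_unit_in S (1 + rsum (y ^+ 2)) -> (m.*2).-primitive_root y ->
  is_unit_in T (1 + rsum y).
Proof.
move=> Tr ST Zy y0 ZT US py; have Ty := ZT _ Zy.
have T1 := subring1 Tr.
apply: (unit_in_div Tr _ _ (rsum_norm1 y0)); [exact: subringD|exact: subringB|].
apply: unit_inN => //; case: US => Sx [x' [Sx' E]].
by split; [apply: ST | exists x'; split=> //; apply: ST].
Qed.

Lemma arith_data_step m z : ~~ odd m -> (2 < m)%N -> (m.*2).-primitive_root z ->
  arith_data m (z ^+ 2) -> arith_data m.*2 z.
Proof.
move=> em m2 pz [[N nN] app res gu sg]; have [s [sP tw]] := tower_rsum em m2 pz.
have Or := tower_base tw; have OTr := tower_top tw.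
have twh := tower_Zhalf tw; have Rr := tower_base twh; have Tr := tower_top twh.
have gu' y : (m.*2).-primitive_root y -> is_unit_in (Zhalf (Zadj (rsum z))) (1 + rsum y).
  move=> py; apply: (@gen_unit_step m z y (Zhalf (Zadj (rsum (z ^+ 2))))) => //.
  - exact: tower_sub twh.
  - exact: Zadj_rsum_prim py.
  - exact: prim_neq0 py.
  - by move=> x; apply: Zhalf_sub.
  - exact/gu/prim_sqr.
split=> //.
- by exists (fun x => N (x * s x)); apply: int_norm_tower tw nN.
- by apply: (approximable_tower tw) => // nu; case: (rsum_conj nu pz).
- exact: finite_residues_tower tw res.
apply: (signs_step twh) sg.
- by move=> x /Zhalf_frac-/(_ OTr); apply: Zadj_rsum_real pz.
- by move=> x /(sign_units_unit Tr gu')[].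
- exact: sign_unitsM.
- move=> x; elim=> [y py|{}x y _ Ux _ Uy]; last by rewrite rmorphM; apply: sign_unitsM.
  have -> : s (- (1 + rsum y)) = - (1 + rsum (- y)).
    by rewrite rmorphN /rsum !rmorphD fmorphV rmorph1 /= sP.
  apply: sign_units_gen; rewrite -(sP y py).
  by rewrite fmorph_primitive_root.
- move=> x; elim=> [y py|{}x y _ [x' Ux ->] _ [y' Uy ->]]; last first.
    by exists (x' * y'); [apply: sign_unitsM | rewrite rmorphM mulrACA].
  have py' : (m.*2).-primitive_root (sqrtC y) by apply: prim_sqrt => //; rewrite sqrtCK.
  exists (- (1 + rsum (sqrtC y))); first exact: sign_units_gen.
  rewrite rmorphN rmorphD [in RHS]/rsum rmorphD fmorphV rmorph1 /= sP // mulrNN.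
  rewrite -{1}(sqrtCK y) -rsum_norm1 ?(prim_neq0 py') //.
  by rewrite /rsum invrN opprD.
Qed.

(** Over the rationals one negative element and its square give both signs. It is -1 for [c = 0],
    and -2 for [c = 1], which requires 2 to be inverted. *)
Lemma arith_data_base n z (c : int) : rsum z = c%:~R -> n.-primitive_root z ->
    (forall y, n.-primitive_root y -> rsum y = c%:~R) -> (0 <= c)%R ->
    is_unit_in (Zhalf (Zadj c%:~R)) (1 + c%:~R) ->
  arith_data n z.
Proof.
move=> zE pz yE c0 U; have SZ := Zadj_int c; have Sr := Zadj_subring c%:~R.
split; rewrite zE.
- by exists id; apply: ints_norm SZ.
- exact: ints_approximable.
- exact: ints_finite_residues.
- by move=> y /yE->.
move=> x /(Zhalf_frac Sr) Fx x0.
have c1 : (0 : algC) < 1 + c%:~R by rewrite ltr_pwDl // ler0z.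
have W : sign_units n (- (1 + c%:~R)) by rewrite -zE; apply: sign_units_gen.
have [xp|xn|x00] := real_ltgt0P (ints_frac_real SZ Fx); last by rewrite x00 eqxx in x0.
  exists ((- (1 + c%:~R)) * (- (1 + c%:~R))); split; first exact: sign_unitsM.
  by move=> nu; rewrite mulrNN !rmorphM (ints_frac_fix SZ) // rmorphD rmorph1 rmorph_int !mulr_gt0.
exists (- (1 + c%:~R)); split=> // nu.
by rewrite rmorphM (ints_frac_fix SZ) // rmorphN rmorphD rmorph1 rmorph_int nmulr_rgt0 // oppr_lt0.
Qed.

Lemma prim4_rsum y : 4.-primitive_root y -> rsum y = 0.
Proof.
move=> py; have y0 := prim_neq0 py; have y2 := @prim_double_expr 2 y py.
apply: (mulfI y0); rewrite /rsum mulrDr mulfV // mulr0 -expr2 y2.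
by rewrite addNr.
Qed.

Lemma prim6_rsum y : 6.-primitive_root y -> rsum y = 1.
Proof.
move=> py; have y0 := prim_neq0 py; have y3 := @prim_double_expr 3 y py.
have y1 : y + 1 != 0.
  apply/eqP=> /eqP; rewrite addr_eq0 => /eqP E.
  by have : (6 %| 2)%N by rewrite (prim_order_dvd py) E sqrrN expr1n.
apply: (mulfI y0); apply: (mulfI y1); rewrite /rsum mulr1.
have -> : (y + 1) * (y * (y + y^-1)) = y ^+ 3 + y ^+ 2 + y + 1 by field.
by rewrite y3; ring.
Qed.

Lemma arith_data_pow2 k z : (4 * 2 ^ k).-primitive_root z -> arith_data (4 * 2 ^ k) z.
Proof.
elim: k z => [|k IH] z.
  rewrite expn0 => pz; apply: (@arith_data_base _ _ 0) => //; first exact: prim4_rsum.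
    exact: prim4_rsum.
  by rewrite addr0; apply/unit_in1/Zhalf_subring/Zadj_subring.
rewrite expnSr mulnA muln2 => pz; apply: arith_data_step => //.
- by rewrite oddM.
- by rewrite (leq_trans (_ : _ < 4)%N) // leq_pmulr // expn_gt0.
- exact/IH/prim_sqr.
Qed.

Lemma arith_data_three_pow2 k z : (6 * 2 ^ k).-primitive_root z -> arith_data (6 * 2 ^ k) z.
Proof.
elim: k z => [|k IH] z.
  rewrite expn0 => pz; apply: (@arith_data_base _ _ 1) => //; first exact: prim6_rsum.
    exact: prim6_rsum.
  have Sr := Zadj_subring 1%:~R.
  have -> : 1 + 1%:~R = 2 :> algC by [].
  apply: unit_inP; [| exact: Zhalf_half | by rewrite pnatr_eq0].
  exact/Zhalf_sub/(subring_nat Sr 2).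
rewrite expnSr mulnA muln2 => pz; apply: arith_data_step => //.
- by rewrite oddM.
- by rewrite (leq_trans (_ : _ < 6)%N) // leq_pmulr // expn_gt0.
- exact/IH/prim_sqr.
Qed.

(** * Units and two-torsion along the tower *)

Local Notation Rz z := (Zhalf (Zadj (rsum z))).

(** One level up the norm of [2 + e] is [2 - rsum z], with [e^2 = 2 + rsum z]. So [class_neg] is
    exactly the hypothesis on the norm of [dT] in the descent. *)
Record class_data (z : algC) : Prop := ClassData {
  class_inv : invertible_ideals (Rz z);
  class_torsion : no_two_torsion (Rz z);
  class_tp : tp_units_gen (Rz z) (2 + rsum z);
  class_unit : is_unit_in (Rz z) (2 + rsum z);
  class_neg : exists eps, is_unit_in (Rz z) eps /\ 2 - rsum z = (2 + rsum z) * eps ^+ 2 }.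

Lemma unit_signs_of_arith n z : arith_data n z -> unit_signs (Rz z).
Proof.
move=> [_ _ _ gu sg] x Fx x0; have [eps [W p]] := sg x Fx x0; exists eps; split=> //.
by apply: sign_units_unit gu W; apply/Zhalf_subring/Zadj_subring.
Qed.

(** It is the square of the totally real [rsum (sqrtC z)], one level up. *)
Lemma totpos_two_rsum n z : ~~ odd n -> n.-primitive_root z -> 2 + rsum z != 0 ->
  totpos (2 + rsum z).
Proof.
move=> en pz nz; have py : (n.*2).-primitive_root (sqrtC z) by apply: prim_sqrt => //; rewrite sqrtCK.
have E : 2 + rsum z = rsum (sqrtC z) ^+ 2 by rewrite rsum_sqr ?(prim_neq0 py) // sqrtCK.
rewrite E; apply: totpos_sqr; last by apply: contraNneq nz => h; rewrite E h expr0n.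
apply: (Zadj_rsum_real py); apply: frac_sub; [exact: Zadj_subring|exact: Zadj_gen].
Qed.

Lemma class_data_step m z : ~~ odd m -> (2 < m)%N -> (m.*2).-primitive_root z ->
  arith_data m.*2 z -> class_data (z ^+ 2) -> class_data z.
Proof.
move=> em m2 pz /unit_signs_of_arith sg [inv N2 H2 U [eps [Ueps epsE]]].
have [s [sP tw']] := tower_rsum em m2 pz; have OTr := tower_top tw'.
have tw := tower_Zhalf tw'; have Rr := tower_base tw; have Tr := tower_top tw.
set e := rsum z in tw *; set f := rsum (z ^+ 2) in tw H2 U epsE *.
have e2 : e ^+ 2 = 2 + f by apply: rsum_sqr; apply: prim_neq0 pz.
have half : Zhalf (Zadj f) 2^-1 by apply: Zhalf_half; apply: Zadj_subring.
have e0 : e != 0 := tower_gen0 tw; have eps0 := unit_in_neq0 Ueps.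
have inv_sqr : Zhalf (Zadj f) (e ^+ 2)^-1 by rewrite e2; apply: unit_in_invr.
have Te : Zhalf (Zadj e) e := tower_mem_gen tw.
have T2 : Zhalf (Zadj e) 2 by apply: (subring_nat Tr).
have Ud : is_unit_in (Zhalf (Zadj e)) (2 + e).
  apply: (@unit_in_div _ Tr _ (2 - e) (e ^+ 2 * eps ^+ 2)).
  - exact: subringD.
  - exact: subringB.
  - rewrite e2 -epsE; have -> : (2 + e) * (2 - e) = 4 - e ^+ 2 by ring.
    by rewrite e2; ring.
  - by apply: (tower_unit tw); apply: unit_inM => //; rewrite ?e2 //; apply: unit_inX.
have d0 := unit_in_neq0 Ud.
have pd : totpos (2 + e) by apply: totpos_two_rsum pz d0; rewrite odd_double.
have Nd : (2 + e) * s (2 + e) = e ^+ 2 * eps ^+ 2.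
  rewrite e2 -epsE rmorphD rmorph_nat (tower_gen tw).
  have -> : (2 + e) * (2 - e) = 4 - e ^+ 2 by ring.
  by rewrite e2; ring.
have real x : fracset (Zhalf (Zadj e)) x -> totreal x.
  by move=> /Zhalf_frac-/(_ OTr); apply: Zadj_rsum_real pz.
have invT : invertible_ideals (Zhalf (Zadj e)) := invertible_ideals_step tw half inv_sqr inv.
have H2' : tp_units_gen (Zhalf (Zadj f)) (e ^+ 2) by rewrite e2.
have tpd : tp_unit (Zhalf (Zadj e)) (2 + e) by [].
split=> //.
- exact: (no_two_torsion_step tw real half inv_sqr N2 H2' tpd Ueps Nd sg).
- exact: (tp_units_gen_step tw real half inv_sqr N2 H2' invT tpd Ueps Nd).
(* From [(2 + e) (2 - e) = e^2 eps^2] it follows that [2 - e = (2 + e) (2 - e)^2 / (e eps)^2]. *)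
exists ((2 - e) / (e * eps)); split.
  have U2 : is_unit_in (Zhalf (Zadj e)) (2 - e).
    apply: (@unit_in_div _ Tr _ (2 + e) (e ^+ 2 * eps ^+ 2)).
    - exact: subringB.
    - exact: subringD.
    - by rewrite -Nd rmorphD rmorph_nat (tower_gen tw) mulrC.
    - by apply: (tower_unit tw); apply: unit_inM => //; rewrite ?e2 //; apply: unit_inX.
  apply: unit_inM => //; apply: unit_inV => //; apply: unit_inM => //; last exact: tower_unit tw _ Ueps.
  apply: (@unit_in_div _ Tr _ e (e ^+ 2)) => //.
  by apply: (tower_unit tw); rewrite e2.
rewrite expr_div_n exprMn -Nd rmorphD rmorph_nat (tower_gen tw).
have m0 : 2 - e != 0.
  have : (2 + e) * s (2 + e) != 0 by rewrite mulf_neq0 // fmorph_eq0.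
  by rewrite rmorphD rmorph_nat (tower_gen tw) mulf_eq0 negb_or => /andP[].
by move: (2 - e) (2 + e) m0 d0 => x y x0 y0; field; rewrite x0 y0.
Qed.

Lemma ints_half_unit S u : is_ints S -> is_unit_in (Zhalf S) u -> 0 < u ->
  exists j k : nat, u * 2 ^+ k = 2 ^+ j.
Proof.
move=> SZ [[k Sa] [u' [[l Sb] uu]]] u0.
have u'0 : 0 < u' by rewrite -(pmulr_rgt0 _ u0) uu ltr01.
have p0 i : (0 : algC) < 2 ^+ i by rewrite exprn_gt0 // ltr0n.
have /natrP[a aE] : 2 ^+ k * u \is a Num.nat by rewrite natrEint (SZ _).1 //= mulr_ge0 // ltW.
have /natrP[b bE] : 2 ^+ l * u' \is a Num.nat by rewrite natrEint (SZ _).1 //= mulr_ge0 // ltW.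
have : (a %| 2 ^ (k + l))%N.
  apply/dvdnP; exists b; apply/eqP; rewrite -(eqr_nat algC) natrM -aE -bE natrX exprD.
  by rewrite mulrACA [u' * u]mulrC uu mulr1 mulrC.
by case/(dvdn_pfactor _ _ (isT : prime 2)) => j _ ja; exists j, k; rewrite mulrC aE ja natrX.
Qed.

Lemma class_data_base4 z : 4.-primitive_root z -> class_data z.
Proof.
move=> pz; have e0 := prim4_rsum pz.
have SZ : is_ints (Zadj (rsum z)) by rewrite e0; apply: (Zadj_int 0).
have Sr := ints_subring SZ; have Rr := Zhalf_subring Sr.
have PR := principal_Zhalf Sr (ints_principal SZ).
have U2 : is_unit_in (Rz z) 2.
  apply: unit_inP; [|exact: Zhalf_half|by rewrite pnatr_eq0].
  exact/Zhalf_sub/(subring_nat Sr 2).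
split; rewrite ?[X in 2 + X]e0 ?[X in 2 - X]e0 ?addr0 ?subr0 //.
- exact: principal_invertible.
- exact: principal_no_two_torsion.
- move=> u [Uu /(_ idfun) /= pu]; have [j [k E]] := ints_half_unit SZ Uu pu.
  have k0 : (2 ^+ k : algC) != 0 by rewrite expf_neq0 // pnatr_eq0.
  (* [u] is [2^(j+k)] over a square, so the parity of [j + k] selects the class. *)
  exists (2 ^+ (j + k)./2 / 2 ^+ k); split.
    by apply: unit_inM => //; [|apply: unit_inV => //]; apply: unit_inX.
  have uE : u = 2 ^+ (j + k) / (2 ^+ k) ^+ 2 by rewrite exprD -E; field.
  move: (odd_double_half (j + k)); case: (odd (j + k)) => D; [right|left];
    by rewrite uE expr_div_n -!exprM !muln2 -[in LHS]D exprD ?expr0 ?expr1 ?mul1r -?mulrA.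
- by exists 1; split; [exact: (unit_in1 Rr) | rewrite ?e0 ?addr0 ?subr0 expr1n mulr1].
Qed.

(** * The bottom ring of the second family, generated by a square root of 3 *)

Section Order12.
Variable z : algC.
Hypothesis pz : 12.-primitive_root z.
Let e := rsum z.
Let T := Rz z.

Lemma prim12_sqr : e ^+ 2 = 3.
Proof.
rewrite rsum_sqr ?(prim_neq0 pz) // (@prim6_rsum (z ^+ 2)); last exact: (@prim_sqr 6).
by ring.
Qed.

Lemma tower12 : exists s : {rmorphism algC -> algC}, tower (Zadj 1%:~R) (Zadj e) s e.
Proof.
have [|||s [_ tw]] := @tower_rsum 6 z => //; exists s.
by rewrite (@prim6_rsum (z ^+ 2)) in tw; last exact: (@prim_sqr 6).
Qed.

Let Or : is_subring (Zadj e) := Zadj_subring e.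
Let Tr : is_subring T := Zhalf_subring Or.

Lemma round_half S x : is_ints S -> fracset S x -> exists w : int, `|x - w%:~R| <= 2^-1.
Proof.
move=> SZ Fx; have [w /andP[h0 h1]] := ints_floor SZ Fx.
have half : 2^-1 \is @Num.real algC by rewrite rpredV realn.
have xr : x - w%:~R \is Num.real by rewrite ger0_real.
have [le|lt] := real_leP xr half; first by exists w; rewrite ger0_norm.
exists (w + 1); rewrite intrD opprD addrA ler0_norm; last by rewrite subr_le0 ltW.
rewrite opprB lerBlDr -lerBlDl; apply: le_trans (ltW lt).
by rewrite lerBlDr; have -> : 2^-1 + 2^-1 = 1 :> algC by field.
Qed.

(** Rounding leaves coordinates of modulus at most [1/2], so the norm [a^2 - 3 b^2] of the remainder
    lies between [-3/4] and [1/4]. *)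
Lemma principal12 : principal_ideals (Zadj e).
Proof.
have [s tw] := tower12; have SZ := Zadj_int 1.
have nN := int_norm_tower tw (ints_norm SZ).
apply: (euclidean_principal Or nN) => x /(tower_split_frac tw)[a [b [Fa Fb ->]]].
have [[m hm] [n hn]] := (round_half SZ Fa, round_half SZ Fb).
exists (m%:~R + n%:~R * e); split.
  by apply/(tower_topE tw); exists m%:~R, n%:~R; split=> //; apply/SZ; apply: intr_int.
have Fa' : fracset (Zadj 1%:~R) (a - m%:~R).
  by apply: fracB => //; [apply: ints_subring|apply: frac_sub => //; [apply: ints_subring|apply/SZ/intr_int]].
have Fb' : fracset (Zadj 1%:~R) (b - n%:~R).
  by apply: fracB => //; [apply: ints_subring|apply: frac_sub => //; [apply: ints_subring|apply/SZ/intr_int]].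
have -> : a + b * e - (m%:~R + n%:~R * e) = (a - m%:~R) + (b - n%:~R) * e by ring.
have ra := ints_frac_real SZ Fa'; have rb := ints_frac_real SZ Fb'.
move: (a - _) (b - _) hm hn Fa' Fb' ra rb => a' b' ha hb Fa' Fb' ra rb.
rewrite /= rmorphD rmorphM (tower_gen tw) !(tower_fix_frac tw) //.
have -> : (a' + b' * e) * (a' + b' * - e) = a' ^+ 2 - 3 * b' ^+ 2 by rewrite -prim12_sqr; ring.
have sq (t : algC) : t \is Num.real -> `|t| <= 2^-1 -> 0 <= t ^+ 2 <= 4^-1.
  move=> rx hx; rewrite real_exprn_even_ge0 //= -(real_normK rx).
  have -> : 4^-1 = 2^-1 ^+ 2 :> algC by rewrite exprVn -natrX.
  by rewrite ler_pXn2r // nnegrE ?invr_ge0 ?ler0n.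
have /andP[a0 a1] := sq a' ra ha; have /andP[b0 b1] := sq b' rb hb.
rewrite real_ltr_norml; last by apply: realB; apply: ger0_real => //; rewrite mulr_ge0 ?ler0n.
have q : (4^-1 : algC) < 1 by rewrite invf_lt1 ?ltr1n ?ltr0n.
apply/andP; split.
  rewrite ltrBrDl -ltrBrDr opprK; apply: lt_le_trans (_ : 1 <= _); last by rewrite lerDr.
  apply: le_lt_trans (_ : 3 * 4^-1 < _); first by rewrite ler_pM2l ?ltr0n.
  by rewrite ltr_pdivrMr ?ltr0n // mul1r ltr_nat.
rewrite ltrBlDr; apply: le_lt_trans a1 _; apply: lt_le_trans q _.
by rewrite lerDl mulr_ge0 // ler0n.
Qed.

Let e2 : e ^+ 2 = 3 := prim12_sqr.
Let Oe : Zadj e e := Zadj_gen e.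
Let On k : Zadj e k%:R := subring_nat Or k.

Lemma unit12_tp : is_unit_in (Zadj e) (2 + e).
Proof.
split; first exact: subringD (On 2) Oe.
exists (2 - e); split; first exact: subringB (On 2) Oe.
have -> : (2 + e) * (2 - e) = 4 - e ^+ 2 by ring.
by rewrite e2; ring.
Qed.

Let cls x := exists v, is_unit_in T v /\ (x = v ^+ 2 \/ x = (2 + e) * v ^+ 2).

Let Ud : is_unit_in T (2 + e) := Zhalf_unit unit12_tp.
Let d0 : 2 + e != 0 := unit_in_neq0 Ud.

Lemma unit12_unif : is_unit_in T (1 + e).
Proof.
apply: (@unit_in_div _ Tr _ (1 - e) (- 2)).
- exact/Zhalf_sub/(subringD Or (On 1) Oe).
- exact/Zhalf_sub/(subringB Or (On 1) Oe).
- have -> : (1 + e) * (1 - e) = 1 - e ^+ 2 by ring.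
  by rewrite e2; ring.
apply: unit_inN => //; apply: unit_inP; [|exact: Zhalf_half|by rewrite pnatr_eq0].
exact/Zhalf_sub/On.
Qed.

Lemma cls_tp x : cls x -> cls ((2 + e) * x).
Proof.
case=> v [Uv [->|->]]; first by exists v; split=> //; right.
by exists ((2 + e) * v); split; [apply: unit_inM | left; ring].
Qed.

Lemma cls_sqr u x : is_unit_in T u -> cls x -> cls (u ^+ 2 * x).
Proof.
move=> Uu [v [Uv [->|->]]]; exists (u * v); (split; first exact: unit_inM); [left|right]; ring.
Qed.

(** Since [e^2 = 3], one has [(1 + e)^2 = 2 (2 + e)]: up to squares of units, 2 and [2 + e]
    agree. *)
Lemma cls_double x : cls x -> cls (2 * x).
Proof.
move=> cx; have -> : 2 * x = ((1 + e) / (2 + e)) ^+ 2 * ((2 + e) * x).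
  have -> : ((1 + e) / (2 + e)) ^+ 2 = 2 / (2 + e); last by field.
  have E : (1 + e) ^+ 2 = 2 * (2 + e).
    have -> : (1 + e) ^+ 2 = 1 + 2 * e + e ^+ 2 by ring.
    by rewrite e2; ring.
  by rewrite expr_div_n E; field.
apply: cls_sqr; last exact: cls_tp.
by apply: unit_inM => //; [apply: unit12_unif | apply: unit_inV].
Qed.

Let elt (A B : int) : algC := A%:~R + B%:~R * e.

Let elt_T A B : T (elt A B).
Proof. exact/Zhalf_sub/(subringD Or (subring_int Or A))/(subringM Or (subring_int Or B) Oe). Qed.

Let elt_norm A B : elt A B * elt A (- B) = (A ^+ 2 - 3 * B ^+ 2)%:~R.
Proof.
rewrite /elt rmorphN mulNr rmorphB rmorphXn rmorphM rmorphXn /=.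
have -> : (A%:~R + B%:~R * e) * (A%:~R - B%:~R * e) = A%:~R ^+ 2 - e ^+ 2 * B%:~R ^+ 2 by ring.
by rewrite e2.
Qed.

(* Descent by the fundamental unit [2 + e]. *)
Lemma pell_unit n (A B : int) : (`|B| <= n)%N -> 0 < A -> A ^+ 2 - 3 * B ^+ 2 = 1 -> cls (elt A B).
Proof.
elim: n A B => [|n IH].
  move=> A B; rewrite leqn0 absz_eq0 => /eqP-> A0 E.
  have -> : A = 1 by nia.
  by exists 1; split; [exact: unit_in1 | left; rewrite /elt mul0r addr0 expr1n].
have pos A B : 0 < B -> (`|B| <= n.+1)%N -> 0 < A -> A ^+ 2 - 3 * B ^+ 2 = 1 -> cls (elt A B).
  move=> B0 Bn A0 E.
  (* The second factor is [elt A B] times [2 - e], the inverse of [2 + e]. From [B < A <= 2 B] its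
     second coordinate satisfies [0 <= 2 B - A < B]. *)
  have -> : elt A B = (2 + e) * elt (2 * A - 3 * B) (2 * B - A).
    rewrite /elt !(rmorphB, rmorphM) /=.
    have -> : (2 + e) * (2%:~R * A%:~R - 3%:~R * B%:~R + (2%:~R * B%:~R - A%:~R) * e) =
      4 * A%:~R - 6 * B%:~R + B%:~R * e + (2 * B%:~R - A%:~R) * e ^+ 2 by ring.
    by rewrite e2; ring.
  apply/cls_tp/IH.
  - have h1 : B < A by nia.
    have h2 : A <= 2 * B by nia.
    lia.
  - nia.
  - by rewrite -[RHS]E; ring.
move=> A B Bn A0 E; case: (ltrgtP B 0) => B0; last 1 first.
- by apply: IH => //; rewrite B0.
- have Uc : elt A B * elt A (- B) = 1 by rewrite elt_norm E.
  (* Up to a square, the element is its own conjugate-inverse, which has positive second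
     coordinate. *)
  have -> : elt A B = elt A B ^+ 2 * elt A (- B) by rewrite expr2 -mulrA Uc mulr1.
  apply: cls_sqr; first by split; [apply: elt_T | exists (elt A (- B)); split; [apply: elt_T|]].
  by apply: pos; rewrite ?sqrrN ?abszN // oppr_gt0.
- exact: pos.
Qed.

(** For [j = 1] there is no solution, 2 not being a square modulo 3. For [j >= 2], reduction modulo
    4 makes [A] and [B] even, and halving both lowers [j] by two. *)
Lemma pell_pow2 j (A B : int) : 0 < A -> A ^+ 2 - 3 * B ^+ 2 = 2 ^+ j -> cls (elt A B).
Proof.
have [j2] := ubnP j; elim: j2 j A B => // j2 IH [|[|j]] A B lt A0 E.
- exact: (@pell_unit `|B|).
- have D := divz_eq A 3; have M0 := modz_ge0 A (isT : 3 != 0 :> int).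
  have M1 := ltz_pmod A (isT : 0 < 3 :> int); rewrite expr1 in E.
  move: (A %/ 3)%Z (A %% 3)%Z D M0 M1 => q r D M0 M1.
  have : r = 0 \/ r = 1 \/ r = 2 by lia.
  by move: E; rewrite D => E [|[]] rE; move: E; rewrite rE; lia.
have DA := divz_eq A 2; have MA0 := modz_ge0 A (isT : 2 != 0 :> int).
have MA1 := ltz_pmod A (isT : 0 < 2 :> int).
have DB := divz_eq B 2; have MB0 := modz_ge0 B (isT : 2 != 0 :> int).
have MB1 := ltz_pmod B (isT : 0 < 2 :> int).
rewrite !exprS mulrA in E.
have [a0 b0] : (A %% 2)%Z = 0 /\ (B %% 2)%Z = 0.
  move: (A %/ 2)%Z (A %% 2)%Z (B %/ 2)%Z (B %% 2)%Z DA DB MA0 MA1 MB0 MB1 => a r b q DA DB *.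
  have : r = 0 \/ r = 1 by lia.
  have : q = 0 \/ q = 1 by lia.
  by move: E; rewrite DA DB => E [] qE [] rE; move: E; rewrite rE qE; lia.
rewrite a0 addr0 in DA; rewrite b0 addr0 in DB.
have -> : elt A B = 2 * elt (A %/ 2)%Z (B %/ 2)%Z.
  by rewrite /elt {1}DA {1}DB !rmorphM /=; ring.
by apply/cls_double/(IH j); [lia | nia | nia].
Qed.

(** For the units: a square power of 2 clears denominators, the trace gives [A > 0], and the norm is
    a positive unit of [Z[1/2]] that is an integer, hence a power of 2. This is the situation of
    [pell_pow2]. *)
Lemma class_data_base12 : class_data z.
Proof.
have [s tw] := tower12; have SZ := Zadj_int 1.
have PR := principal_Zhalf Or principal12; have twh := tower_Zhalf tw.
split.
- exact: principal_invertible.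
- exact: principal_no_two_torsion.
- move=> u [Uu pu]; have [[k Ou] _] := Uu.
  have k0 : (2 ^+ k : algC) != 0 by rewrite expf_neq0 // pnatr_eq0.
  have U2 : is_unit_in T (2 ^+ k).
    apply: unit_inX => //; apply: unit_inP; [|exact: Zhalf_half|by rewrite pnatr_eq0].
    exact/Zhalf_sub/On.
  have p2 : totpos ((2 ^+ k) ^+ 2).
    by move=> nu; rewrite !rmorphXn rmorph_nat !exprn_gt0 // ltr0n.
  pose u' := (2 ^+ k) ^+ 2 * u.
  have Uu' : is_unit_in T u' by apply: unit_inM => //; apply: unit_inX.
  have pu' : totpos u' by apply: totposM.
  have : Zadj e u'.
    rewrite /u' expr2 -mulrA; apply: subringM => //; apply: subringX => //; exact: On.
  move=> /(tower_topE tw)[_ [_ [/SZ/intrP[A ->] /SZ/intrP[B ->] uE]]].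
  have sE : s u' = elt A (- B).
    by rewrite uE rmorphD rmorphM /= !rmorph_int (tower_gen tw) /elt mulrN rmorphN mulNr.
  have A0 : 0 < A.
    have : totpos (u' + s u') by apply: totposD => //; apply: totpos_morph.
    move=> /(_ idfun) /=; rewrite sE uE /elt rmorphN mulNr addrACA subrr addr0 -intrD.
    by rewrite ltr0z => h; lia.
  have [j [l E]] : exists j l : nat, (u' * s u') * 2 ^+ l = 2 ^+ j.
    apply: (ints_half_unit SZ); first exact: tower_norm_unit twh _ Uu'.
    by apply: (totposM pu' (totpos_morph s pu') idfun).
  have [v [Uv vE]] : cls u'.
    have NE : u' * s u' = (A ^+ 2 - 3 * B ^+ 2)%:~R by rewrite sE -elt_norm {1}uE.
    have N0 : 0 < A ^+ 2 - 3 * B ^+ 2.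
      by rewrite -(ltr0z algC) -NE; apply: (totposM pu' (totpos_morph s pu') idfun).
    case ME : (A ^+ 2 - 3 * B ^+ 2) N0 NE => [M|//] _ NE.
    have : (M %| 2 ^ j)%N.
      apply/dvdnP; exists (2 ^ l)%N; apply/eqP.
      by rewrite -(eqr_nat algC) natrM !natrX -E NE mulrC.
    case/(dvdn_pfactor _ _ (isT : prime 2)) => i _ Mi.
    by rewrite uE; apply: (@pell_pow2 i) => //; rewrite ME Mi -natrX natz.
  have uE' : u = (2 ^+ k)^-1 ^+ 2 * u' by rewrite /u' exprVn mulKf // expf_neq0.
  by rewrite uE'; apply: cls_sqr; [apply: unit_inV | exists v].
- exact: Ud.
exists (2 - e); split.
  apply: (@unit_in_div _ Tr _ (2 + e) 1); last exact: unit_in1.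
  - exact/Zhalf_sub/(subringB Or (On 2) Oe).
  - exact/Zhalf_sub/(subringD Or (On 2) Oe).
  - have -> : (2 - e) * (2 + e) = 4 - e ^+ 2 by ring.
    by rewrite e2; ring.
rewrite -/e; have -> : (2 + e) * (2 - e) ^+ 2 = (4 - e ^+ 2) * (2 - e) by ring.
by rewrite e2; ring.
Qed.
End Order12.

(** * Roots of -1, and the prime above two along the tower *)

Lemma prim_of_expr_N1 s (w : algC) : w ^+ (2 ^ s) = -1 -> (2 ^ s.+1).-primitive_root w.
Proof.
move=> wE; have w1 : w ^+ (2 ^ s.+1) = 1 by rewrite expnSr exprM wE sqrrN expr1n.
have [|d pd dvd] := prim_order_exists _ w1; first by rewrite expn_gt0.
have [j le_j dE] := dvdn_pfactor _ _ (isT : prime 2) dvd.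
move: le_j; rewrite leq_eqVlt => /orP[/eqP jE|]; first by rewrite -jE -dE.
rewrite ltnS => le_j; have : (d %| 2 ^ s)%N by rewrite dE dvdn_exp2l.
rewrite (prim_order_dvd pd) wE eq_sym -subr_eq0 opprK.
by rewrite -[1 + 1]/(2%:R) pnatr_eq0.
Qed.

(* The root has minimal argument, whereas a cube root of an [m]-th root of -1 is
   a [3 * m]-th root of -1, and can be chosen with a smaller argument. *)
Lemma nthroot_not_short m : ~~ odd m -> (0 < m)%N -> ((3 * m).-root (-1) : algC) ^+ m <> -1.
Proof.
move=> em m0; have n1 : (1 < 3 * m)%N by rewrite (leq_trans (_ : _ < 3)%N) // leq_pmulr.
have n0 := ltnW n1; set w := _.-root _ => wm.
have wn : w ^+ (3 * m) = -1 by rewrite rootCK.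
have N1 : -1 != 1 :> algC.
  by rewrite eq_sym -subr_eq0 opprK -[1 + 1]/(2%:R) pnatr_eq0.
set v := 3.-root w; have v3 : v ^+ 3 = w by rewrite rootCK.
have vn : v ^+ (3 * m) = -1 by rewrite exprM v3.
have vm : `|v| = 1.
  by apply/eqP; rewrite -(@pexpr_eq1 _ _ (3 * m)) // -normrX vn normrN normr1.
set c := 'Re v; set t := 'Im v.
have [rc rt] : c \is Num.real /\ t \is Num.real by rewrite Creal_Re Creal_Im.
have vE : v = c + 'i * t by rewrite -Crect.
have ct : c ^+ 2 + t ^+ 2 = 1 by rewrite -normC2_Re_Im vm expr1n.
have i2 : 'i ^+ 2 = -1 :> algC by rewrite sqrCi.
have t0 : 0 <= t by apply: Im_rootC_ge0.
have wE : w = (c ^+ 3 - 3 * c * t ^+ 2) + 'i * (3 * c ^+ 2 * t - t ^+ 3).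
  rewrite -v3 vE.
  have -> : (c + 'i * t) ^+ 3 = c ^+ 3 + 3 * c * t ^+ 2 * 'i ^+ 2 + 'i * (3 * c ^+ 2 * t + t ^+ 3 * 'i ^+ 2).
    by ring.
  by rewrite i2; ring.
have r1 : c ^+ 3 - 3 * c * t ^+ 2 \is Num.real by rewrite !(realB, realM, rpredX, realn).
have r2 : 3 * c ^+ 2 * t - t ^+ 3 \is Num.real by rewrite !(realB, realM, rpredX, realn).
have Rew : 'Re w = c ^+ 3 - 3 * c * t ^+ 2 by rewrite wE Re_rect.
have Imw : 'Im w = 3 * c ^+ 2 * t - t ^+ 3 by rewrite wE Im_rect.
have h1 : c <= 'Re w by apply: rootC_Re_max.
have h2 : 0 <= 'Im w by apply: Im_rootC_ge0.
have t_gt0 : 0 < t.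
  rewrite lt0r t0 andbT; apply/eqP=> tE.
  have c2 : c ^+ 2 = 1 by rewrite -ct tE expr0n addr0.
  have vc : v = c by rewrite vE tE mulr0 addr0.
  have : c ^+ (3 * m) = 1.
    by rewrite -(odd_double_half m) (negPf em) add0n -mul2n mulnCA exprM c2 expr1n.
  by rewrite -vc vn => /eqP; apply/negP.
(* On the unit circle [Re(v^3) - Re v = -4 c t^2], and this is nonnegative because [w] has the
   greatest real part among the roots of -1 in the upper half plane. *)
have c0 : c <= 0.
  have : 0 <= - (c * (4 * t ^+ 2)).
    have -> : - (c * (4 * t ^+ 2)) = 'Re w - c; last by rewrite subr_ge0.
    rewrite Rew.
    have -> : c ^+ 3 - 3 * c * t ^+ 2 - c = c * (c ^+ 2 + t ^+ 2 - 1) - c * (4 * t ^+ 2) by ring.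
    by rewrite ct subrr mulr0 sub0r.
  by rewrite oppr_ge0 pmulr_lle0 // mulr_gt0 ?ltr0n // exprn_gt0.
have c4 : t ^+ 2 <= 3 * c ^+ 2.
  move: h2; rewrite Imw; have -> : 3 * c ^+ 2 * t - t ^+ 3 = (3 * c ^+ 2 - t ^+ 2) * t by ring.
  by rewrite pmulr_lge0 // subr_ge0.
set r := sqrtC (3 : algC); have r0 : 0 < r by rewrite sqrtC_gt0 ltr0n.
have r2' : r ^+ 2 = 3 by rewrite sqrtCK.
have rr : r \is Num.real by rewrite gtr0_real.
(* The rotation of [v] by a third of a turn clockwise: again a cube root of [w] in the upper half
   plane, but with positive real part, against the choice of [v]. *)
pose u := v * ((- 1 - 'i * r) / 2).
have u3 : u ^+ 3 = w.
  rewrite exprMn v3 -[RHS]mulr1; congr (_ * _).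
  have -> : ((-1 - 'i * r) / 2) ^+ 3 =
    (- 1 - 3 * 'i * r - 3 * ('i ^+ 2 * r ^+ 2) - 'i * r * ('i ^+ 2 * r ^+ 2)) / 8 by field.
  by rewrite i2 r2'; field.
have uE : u = (- c + r * t) / 2 + 'i * ((- t - r * c) / 2).
  rewrite /u vE.
  have -> : (c + 'i * t) * ((-1 - 'i * r) / 2) =
    (- c - 'i ^+ 2 * r * t) / 2 + 'i * ((- t - r * c) / 2) by field.
  by rewrite i2; field.
have half : 2^-1 \is @Num.real algC by rewrite rpredV realn.
have q1 : (- c + r * t) / 2 \is Num.real by rewrite !(realD, realM, realN).
have q2 : (- t - r * c) / 2 \is Num.real by rewrite !(realD, realM, realN).
have : 'Re u <= c.
  apply: rootC_Re_max => //; rewrite uE Im_rect // mulr_ge0 ?invr_ge0 ?ler0n //.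
  rewrite addrC subr_ge0 -mulrN.
  rewrite -(@ler_pXn2r _ 2) ?nnegrE ?mulr_ge0 ?oppr_ge0 ?(ltW r0) //.
  by rewrite exprMn r2' sqrrN.
rewrite uE Re_rect // => /le_trans/(_ c0).
rewrite pmulr_lle0 ?invr_gt0 ?ltr0n // lt_geF //.
by rewrite ltr_wpDl ?oppr_ge0 // mulr_gt0.
Qed.

Lemma zeta_prim_pow2 s : (2 ^ s).-primitive_root (zeta (2 ^ s)).
Proof.
have p0 : (0 < 2 ^ s)%N by rewrite expn_gt0.
by apply: prim_sqr; rewrite -muln2 -expnSr; apply: prim_of_expr_N1; rewrite rootCK.
Qed.

(** The cube of the chosen root of -1 has order [2^(s+1)], so the root itself has that order or
    three times it. The smaller one is excluded by minimality of the argument, through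
    [nthroot_not_short]. *)
Lemma zeta_prim_three_pow2 s : (0 < s)%N -> (3 * 2 ^ s).-primitive_root (zeta (3 * 2 ^ s)).
Proof.
move=> s0; have p0 : (0 < 2 ^ s)%N by rewrite expn_gt0.
have n0 : (0 < 3 * 2 ^ s)%N by rewrite muln_gt0.
rewrite /zeta; set w := _.-root _; have wn : w ^+ (3 * 2 ^ s) = -1 by rewrite rootCK.
apply: prim_sqr.
have p3 : (2 ^ s.+1).-primitive_root (w ^+ 3) by apply: prim_of_expr_N1; rewrite -exprM.
have w1 : w ^+ (3 * 2 ^ s).*2 = 1 by rewrite -muln2 exprM wn sqrrN expr1n.
have [|d pd _] := prim_order_exists _ w1; first by rewrite double_gt0.
have pd3 := exp_prim_root pd 3.
have E : (2 ^ s.+1)%N = (d %/ gcdn 3 d)%N.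
  apply/eqP; rewrite eqn_dvd (prim_order_dvd p3) (prim_expr_order pd3) eqxx.
  by rewrite (prim_order_dvd pd3) (prim_expr_order p3) eqxx.
have [d3|nd3] := boolP (3 %| d)%N.
  by rewrite -muln2 -mulnA -expnSr E (gcdn_idPl d3) mulnC divnK.
have co : coprime 3 d by rewrite prime_coprime.
move: E; rewrite (eqP co) divn1 => E.
have pw : ((2 ^ s).*2).-primitive_root w by rewrite -muln2 -expnSr E.
case: (@nthroot_not_short (2 ^ s)) => //; last exact: prim_double_expr pw.
by rewrite oddX orbF -lt0n s0.
Qed.

Lemma class_data_pow2 k z : (4 * 2 ^ k).-primitive_root z -> class_data z.
Proof.
elim: k z => [|k IH] z; first exact: class_data_base4.
move=> pz; have ar := arith_data_pow2 pz.
move: pz ar; rewrite expnSr mulnA muln2 => pz ar.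
apply: (class_data_step _ _ pz) => //.
- by rewrite oddM.
- by rewrite (leq_trans (_ : _ < 4)%N) // leq_pmulr // expn_gt0.
- exact/IH/prim_sqr.
Qed.

Lemma class_data_three_pow2 k z : (12 * 2 ^ k).-primitive_root z -> class_data z.
Proof.
elim: k z => [|k IH] z; first exact: class_data_base12.
move=> pz; have ar : arith_data (12 * 2 ^ k.+1) z.
  by move: pz; rewrite -[12%N]/(6 * 2)%N -mulnA -expnS; apply: arith_data_three_pow2.
move: pz ar; rewrite expnSr mulnA muln2 => pz ar.
apply: (class_data_step _ _ pz) => //.
- by rewrite oddM.
- by rewrite (leq_trans (_ : _ < 12)%N) // leq_pmulr // expn_gt0.
- exact/IH/prim_sqr.
Qed.

(** With [p = t + e] one has [p (t - e) = t^2 - 2 - f], an associate of [t + f]. As [p] divides 2,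
    it divides [2 t - p = t - e], and conjugation shows the quotient to be a unit. So [t + f] is
    [p^2] up to a unit, and the exponent of 2 doubles. *)
Lemma unif_step m z (t k : nat) kap eps : ~~ odd m -> (2 < m)%N -> (m.*2).-primitive_root z ->
    is_unit_in (Zadj (rsum (z ^+ 2))) kap ->
    t%:R ^+ 2 - 2 - rsum (z ^+ 2) = (t%:R + rsum (z ^+ 2)) * kap ->
    is_unit_in (Zadj (rsum (z ^+ 2))) eps ->
    2 = (t%:R + rsum (z ^+ 2)) ^+ k.+1 * eps ->
  exists u eps', [/\ is_unit_in (Zadj (rsum z)) u, t%:R - rsum z = (t%:R + rsum z) * u,
    is_unit_in (Zadj (rsum z)) eps' & 2 = (t%:R + rsum z) ^+ (k.*2.+1).+1 * eps'].
Proof.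
move=> em m2 pz; have [s [_ tw]] := tower_rsum em m2 pz.
have Or := tower_base tw; have Tr := tower_top tw.
set e := rsum z in tw *; set f := rsum (z ^+ 2) in tw *.
have e2 : e ^+ 2 = 2 + f by apply: rsum_sqr; apply: prim_neq0 pz.
move=> Uk kE Ueps twoE; have two0 : (2 : algC) != 0 by rewrite pnatr_eq0.
have k0 := unit_in_neq0 Uk.
have Tt : Zadj e t%:R by apply: (subring_nat Tr).
have Te : Zadj e e := tower_mem_gen tw.
have NE : (t%:R + e) * (t%:R - e) = (t%:R + f) * kap.
  rewrite -kE; have -> : (t%:R + e) * (t%:R - e) = t%:R ^+ 2 - e ^+ 2 by ring.
  by rewrite e2; ring.
have fE : t%:R + f = (t%:R + e) * ((t%:R - e) * kap^-1) by rewrite mulrA NE mulfK.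
have p0 : t%:R + e != 0.
  by apply: contraNneq two0 => h; rewrite twoE fE h mul0r exprS mul0r mul0r.
have Tf : Zadj e (t%:R + f) by apply: (tower_sub tw); apply: subringD => //; [apply: (subring_nat Or)|apply: Zadj_gen].
have TV : is_unit_in (Zadj e) kap^-1 by apply: (tower_unit tw); apply: unit_inV.
have Ueps' := tower_unit tw Ueps.
have Tm : Zadj e (t%:R - e) by apply: subringB.
have [q Tq qE] : exists2 q, Zadj e q & 2 * t%:R = (t%:R + e) * q.
  exists ((t%:R - e) * kap^-1 * ((t%:R + f) ^+ k * eps) * t%:R).
    by do ![apply: subringM => //]; [case: TV|apply: subringX|case: Ueps'].
  by rewrite {1}twoE exprS {1}fE !mulrA.
pose u := q - 1.
have Tu : Zadj e u by apply: subringB => //; apply: subring1.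
have uE : t%:R - e = (t%:R + e) * u by rewrite mulrBr -qE; ring.
have Uu : is_unit_in (Zadj e) u.
  split=> //; exists (s u); split; first exact: tower_morph tw _ Tu.
  apply: (mulfI p0); rewrite mulr1 mulrA -uE.
  have := congr1 s uE; rewrite rmorphM (rmorphB s _ e) (rmorphD s _ e) rmorph_nat (tower_gen tw) opprK.
  by move=> <-.
exists u, ((u * kap^-1) ^+ k.+1 * eps); split=> //.
  by apply: unit_inM => //; apply: unit_inX => //; apply: unit_inM.
rewrite {1}twoE fE uE -doubleS -muln2 mulnC exprM mulrA -exprMn; congr (_ ^+ _ * _).
by rewrite expr2 !mulrA.
Qed.

Lemma unif_pow2 n z : (4 * 2 ^ n).-primitive_root z -> exists k u eps,
  [/\ is_unit_in (Zadj (rsum z)) u, 2 - rsum z = (2 + rsum z) * u,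
    is_unit_in (Zadj (rsum z)) eps & 2 = (2 + rsum z) ^+ k.+1 * eps].
Proof.
elim: n z => [|n IH] z.
  move=> pz; have U1 := unit_in1 (Zadj_subring (rsum z)).
  by exists 0%N, 1, 1; rewrite {2 3 5}(prim4_rsum pz) subr0 addr0 !mulr1.
rewrite expnSr mulnA muln2 => pz; have [k [kap [eps [Uk kE Ue eE]]]] := IH _ (prim_sqr pz).
have [|||u [eps' [Uu uE Ue' eE']]] := unif_step (t := 2) _ _ pz Uk _ Ue eE.
- by rewrite oddM.
- by rewrite (leq_trans (_ : _ < 4)%N) // leq_pmulr // expn_gt0.
- by rewrite -kE; ring.
by exists (k.*2.+1), u, eps'.
Qed.

Lemma unif_three_pow2 n z : (12 * 2 ^ n).-primitive_root z -> exists k eps,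
  is_unit_in (Zadj (rsum z)) eps /\ 2 = (1 + rsum z) ^+ k.+1 * eps.
Proof.
elim: n z => [|n IH] z.
  move=> pz; have U := unit12_tp pz; have Or := Zadj_subring (rsum z).
  have e2 := prim12_sqr pz; set e := rsum z in U e2 Or *.
  exists 1%N, (2 + e)^-1; split; first exact: unit_inV.
  have -> : (1 + e) ^+ 2 = 2 * (2 + e).
    have -> : (1 + e) ^+ 2 = 1 + 2 * e + e ^+ 2 by ring.
    by rewrite e2; ring.
  by rewrite mulfK // (unit_in_neq0 U).
rewrite expnSr mulnA muln2 => pz; have [k [eps [Ue eE]]] := IH _ (prim_sqr pz).
have Or := Zadj_subring (rsum (z ^+ 2)).
have [|||u [eps' [_ _ Ue' eE']]] := unif_step (t := 1) _ _ pz (unit_inN Or (unit_in1 Or)) _ Ue eE.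
- by rewrite oddM.
- by rewrite (leq_trans (_ : _ < 12)%N) // leq_pmulr // expn_gt0.
- by ring.
by exists (k.*2.+1), eps'.
Qed.

(** [(2 + e) (2 - e)] is [2 - f], a unit by induction, and equals 1 at order 12. So here the
    exceptional class is represented by a unit of the ring of integers, not by the prime above 2. *)
Lemma tp_unit_three_pow2 n z : (12 * 2 ^ n).-primitive_root z ->
  is_unit_in (Zadj (rsum z)) (2 + rsum z) /\ is_unit_in (Zadj (rsum z)) (2 - rsum z).
Proof.
have H S (a b c : algC) : is_subring S -> S a -> S b -> a * b = c -> is_unit_in S c ->
    is_unit_in S a /\ is_unit_in S b.
  move=> Sr Sa Sb E Uc; split; first exact: unit_in_div E Uc.
  by apply: unit_in_div Uc => //; [exact: Sa|rewrite mulrC].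
elim: n z => [|n IH] z pz; have Or := Zadj_subring (rsum z); have Oe := Zadj_gen (rsum z);
  have O2 : Zadj (rsum z) 2 by [apply: (subring_nat Or)].
  apply: (H _ _ _ 1) => //; [exact: subringD|exact: subringB| |exact: unit_in1].
  have -> : (2 + rsum z) * (2 - rsum z) = 4 - rsum z ^+ 2 by ring.
  by rewrite (prim12_sqr pz); ring.
move: pz; rewrite expnSr mulnA muln2 => pz; have [_ U] := IH _ (prim_sqr pz).
apply: (H _ _ _ (2 - rsum (z ^+ 2))) => //; [exact: subringD|exact: subringB| |].
  have -> : (2 + rsum z) * (2 - rsum z) = 4 - rsum z ^+ 2 by ring.
  by rewrite rsum_sqr ?(prim_neq0 pz) //; ring.
have [||s [_ tw]] := tower_rsum _ _ pz; last exact: tower_unit tw _ U.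
- by rewrite oddM.
- by rewrite (leq_trans (_ : _ < 12)%N) // leq_pmulr // expn_gt0.
Qed.

(** At order 4 the element is 1, so for powers of two all signatures already come from units of the
    ring of integers. *)
Lemma gen_units_pow2 n z y : (4 * 2 ^ n).-primitive_root z -> (4 * 2 ^ n).-primitive_root y ->
  is_unit_in (Zadj (rsum z)) (1 + rsum y).
Proof.
elim: n z y => [|n IH] z y pz py.
  by rewrite (prim4_rsum py) addr0; apply/unit_in1/Zadj_subring.
have Zy := Zadj_rsum_prim pz py.
move: pz py; rewrite expnSr mulnA muln2 => pz py.
have [||s [_ tw]] := tower_rsum _ _ pz.
- by rewrite oddM.
- by rewrite (leq_trans (_ : _ < 4)%N) // leq_pmulr // expn_gt0.
apply: (@gen_unit_step _ z y (Zadj (rsum (z ^+ 2))) _ _ _ _ _ _ _ py) => //.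
- exact: tower_top tw.
- exact: tower_sub tw.
- exact: prim_neq0 py.
- by apply: IH; apply: prim_sqr.
Qed.

(** The elements congruent to 0 or 1 modulo [p] form a subring because [p] divides 2, and it
    contains [e = p - t]. *)
Lemma unif_residue e (t k : nat) eps : is_unit_in (Zadj e) eps ->
    2 = (t%:R + e) ^+ k.+1 * eps ->
  forall x, Zadj e x ->
    exists y, Zadj e y /\ (x = (t%:R + e) * y \/ x = 1 + (t%:R + e) * y).
Proof.
move=> Ue twoE x Ox; have Or := Zadj_subring e; have Oe := Zadj_gen e.
have Ot := subring_nat Or t; set p := t%:R + e in twoE *.
have Op : Zadj e p by apply: subringD.
have Oeps : Zadj e eps by case: Ue.
pose q := p ^+ k * eps; have Oq : Zadj e q by apply: subringM => //; apply: subringX.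
have qE : 2 = p * q by rewrite twoE exprS mulrA.
pose P x := Zadj e x /\ exists y, Zadj e y /\ (x = p * y \/ x = 1 + p * y).
have O1 := subring1 Or.
have Pr : is_subring P.
  split.
  - split=> //; exists 0; split; first exact: subring0.
    by right; rewrite mulr0 addr0.
  - move=> a b [Oa [a' [Oa' aE]]] [Ob [b' [Ob' bE]]]; split; first exact: subringB.
    case: aE bE => -> [] ->.
    + by exists (a' - b'); split; [apply: subringB | left; ring].
    + exists (a' - b' - q); split; first by do 2!apply: subringB => //.
      by right; rewrite !mulrBr -qE; ring.
    + by exists (a' - b'); split; [apply: subringB | right; ring].
    + by exists (a' - b'); split; [apply: subringB | left; ring].
  - move=> a b [Oa [a' [Oa' aE]]] [Ob [b' [Ob' bE]]]; split; first exact: subringM.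
    case: aE => aE; first by exists (a' * b); split; [apply: subringM | left; rewrite aE mulrA].
    case: bE => bE; first by exists (a * b'); split; [apply: subringM | left; rewrite bE mulrCA].
    exists (a' + b' + p * (a' * b')); split.
      by do ![apply: subringD => //|apply: subringM => //].
    by right; rewrite aE bE; ring.
have [] // : P x; apply: Zadj_min Ox => //.
have -> : e = p - t%:R by rewrite /p addrC addKr.
apply: (subringB Pr); last exact: subring_nat.
by split=> //; exists 1; split=> //; left; rewrite mulr1.
Qed.

(** * Narrow classes *)

Lemma narrow_equiv_wide S I J : narrow_equiv S I J -> ideal_equiv S I J.
Proof. by move=> [a [b [Sa [Sb [a0 [b0 [_ E]]]]]]]; exists a, b. Qed.

Lemma narrow_equiv_sym S I J : narrow_equiv S I J -> narrow_equiv S J I.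
Proof.
move=> [a [b [Sa [Sb [a0 [b0 [p E]]]]]]]; exists b, a; do 4!split=> //.
by split; [rewrite mulrC | apply: same_set_sym].
Qed.

(** A relation [a I = b J] persists when [a] is multiplied by a unit, and some unit makes [a b]
    totally positive. *)
Lemma narrow_class_number_wide S h : is_subring S -> unit_signs S ->
  class_number S h -> narrow_class_number S h.
Proof.
move=> Sr sg [reps [nr [inj cov]]]; exists reps; split=> //; split.
  by move=> i j /narrow_equiv_wide; apply: inj.
move=> I nI; have [i [a [b [Sa [Sb [a0 [b0 E]]]]]]] := cov I nI; exists i.
have [|eps [Ue p]] := sg (a * b) _ (mulf_neq0 a0 b0); first exact/frac_sub/(subringM Sr Sa Sb).
have Se : S eps by case: Ue.
exists (a * eps), b; split; first exact: subringM.
do 2![split=> //]; first by rewrite mulf_neq0 // (unit_in_neq0 Ue).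
do 2![split=> //]; first by rewrite mulrAC.
apply: same_set_trans E; apply: same_set_trans (same_set_sym (scale_setA _ _ _)) _.
exact/scale_set_same/(scale_set_unit (nz_ideal_submodule nI)).
Qed.

(** Its square roots are, up to sign, [rsum (sqrtC z)], which the conjugation one level up negates
    while fixing the present ring. *)
Lemma two_rsum_not_square n z v : ~~ odd n -> (2 < n)%N -> n.-primitive_root z ->
  Zhalf (Zadj (rsum z)) v -> 2 + rsum z <> v ^+ 2.
Proof.
move=> en n2 pz Rv E.
have py : (n.*2).-primitive_root (sqrtC z) by apply: prim_sqrt => //; rewrite sqrtCK.
have [s [_ tw]] := tower_rsum en n2 py; have twh := tower_Zhalf tw; rewrite sqrtCK in twh.
have y0 := tower_gen0 tw; set y := rsum (sqrtC z) in twh y0 *.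
have /eqP : y ^+ 2 = v ^+ 2 by rewrite -E rsum_sqr ?(prim_neq0 py) // sqrtCK.
have sv := tower_fix twh Rv; have sy := tower_gen twh.
have two0 : (2 : algC) != 0 by rewrite pnatr_eq0.
have H : y = - y -> False.
  move/eqP; rewrite -subr_eq0 opprK -mulr2n -mulr_natl mulf_eq0 (negPf two0) /=.
  exact/negP.
rewrite eqf_sqr => /orP[]/eqP yv; apply: H; rewrite -sy yv ?rmorphN /= sv //.
Qed.

Lemma tp_units_card n z : ~~ odd n -> (2 < n)%N -> n.-primitive_root z -> class_data z ->
  tp_units_mod_squares_card (Zhalf (Zadj (rsum z))) 2.
Proof.
move=> en n2 pz cd; have Or := Zadj_subring (rsum z); have Rr := Zhalf_subring Or.
have Ud := class_unit cd; have d0 := unit_in_neq0 Ud.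
have pd : totpos (2 + rsum z) by apply: totpos_two_rsum en pz d0.
have sq v : is_unit_in (Zhalf (Zadj (rsum z))) v -> 2 + rsum z <> v ^+ 2.
  by move=> [Rv _]; apply: two_rsum_not_square en n2 pz Rv.
exists (fun i : 'I_2 => if i == ord0 then 1 else 2 + rsum z); split; last split.
- move=> i; case: eqP => _; last by [].
  by split; [apply: unit_in1 | move=> nu; rewrite rmorph1 ltr01].
- move=> i j v Uv; have v0 := unit_in_neq0 Uv.
  have [->|ni] := eqVneq i ord0; have [->|nj] := eqVneq j ord0 => //.
  + move=> E; case: (sq v^-1); first exact: unit_inV.
    have v20 : v ^+ 2 != 0 by rewrite expf_neq0.
    by apply: (mulIf v20); rewrite -E -exprMn mulVf // expr1n.
  + by rewrite mul1r => /sq; case.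
  + have E k : k != ord0 -> k = ord_max :> 'I_2.
      by case: k => [[|[|k]] //= lt] nk; apply: val_inj.
    by rewrite (E i ni) (E j nj).
- move=> u tpu; have [v [Uv [->|->]]] := class_tp cd tpu.
    by exists ord0, v; rewrite eqxx mul1r.
  by exists ord_max, v.
Qed.

Lemma unit_signs_Zadj n z : arith_data n z ->
    (forall y, n.-primitive_root y -> is_unit_in (Zadj (rsum z)) (1 + rsum y)) ->
  unit_signs (Zadj (rsum z)).
Proof.
move=> [_ _ _ _ sg] gu x Fx x0; have Or := Zadj_subring (rsum z).
have [|eps [W p]] := sg x _ x0; first exact/(Zhalf_frac Or).
by exists eps; split=> //; apply: sign_units_unit gu W.
Qed.

(** * Class numbers and units of a single ring of the tower *)

Section Assembly.
Variables (n : nat) (z : algC) (t k : nat) (eps : algC).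
Hypothesis pz : n.-primitive_root z.
Let S := Zadj (rsum z).
Let R := Zhalf S.
Let p := t%:R + rsum z.
Hypothesis ar : arith_data n z.
Hypothesis cd : class_data z.
Hypothesis Ueps : is_unit_in S eps.
Hypothesis two_p : 2 = p ^+ k.+1 * eps.

Let Sr : is_subring S := Zadj_subring _.
Let Rr : is_subring R := Zhalf_subring Sr.
Let Sp : S p := subringD Sr (subring_nat Sr t) (Zadj_gen _).
Let res_p := unif_residue Ueps two_p.

Lemma class_numbers_odd : exists h, [/\ class_number S h, class_number R h & odd h].
Proof.
have [[N nN] app fin _ _] := ar.
have [h hS] := class_number_exists Sr nN app fin.
have hR := class_number_half Sr nN Sp Ueps two_p res_p hS.
by exists h; split=> //; exact: (odd_class_number Rr (class_inv cd) (class_torsion cd) hR).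
Qed.

Lemma narrow_class_number_half h : class_number R h -> narrow_class_number R h.
Proof. exact: narrow_class_number_wide Rr (unit_signs_of_arith ar). Qed.

Lemma tp_unit_half u : tp_unit S u -> tp_unit R u.
Proof. by move=> [Uu pu]; split=> //; apply: Zhalf_unit. Qed.

Lemma unif_unit_pow_inj a b x y : is_unit_in S x -> is_unit_in S y ->
  p ^+ a * x = p ^+ b * y -> a = b /\ x = y.
Proof.
have [[N nN] _ _ _ _] := ar.
move=> Ux Uy; apply: (unif_pow_inj Sr Sp two_p); try by [case: Ux | case: Uy].
  exact: (not_dvd_unif_unit Sr nN Sp Ueps two_p Ux).
exact: (not_dvd_unif_unit Sr nN Sp Ueps two_p Uy).
Qed.

Lemma unif_neq0 : p != 0.
Proof.
have two0 : (2 : algC) != 0 by rewrite pnatr_eq0.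
by apply: contraNneq two0 => p0; rewrite two_p p0 exprS !mul0r.
Qed.
Let p0 := unif_neq0.

(** With [t = 2] the exceptional class is that of [p] itself, and [u = p v^2] is impossible by
    parity of the order at [p]. If [u = v^2], comparing orders replaces [v] by a unit of [S]. *)
Lemma tp_unit_square u : t = 2 -> tp_unit S u -> exists v, is_unit_in S v /\ u = v ^+ 2.
Proof.
move=> t2 tpu; have [Uu _] := tpu; have u0 := unit_in_neq0 Uu.
have [[N nN] _ _ _ _] := ar.
have [v [Uv [uE|uE]]] := class_tp cd (tp_unit_half tpu).
  have [a [b [w [Uw vE]]]] := unit_half_split Sr nN Sp Ueps two_p res_p Uv.
  have [||_ uw] := @unif_unit_pow_inj (b * 2) (a * 2) u (w ^+ 2) Uu; first exact: unit_inX.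
    by rewrite !exprM -exprMn -vE uE exprMn mulrC.
  by exists w.
have v0 := unit_in_neq0 Uv.
have [] := @odd_unif_not_square S N p eps k Sr nN Sp Ueps two_p res_p u^-1 v^-1.
- exact: unit_inV.
- exact: unit_inV.
- have pE : p = 2 + rsum z by rewrite /p t2.
  rewrite uE -pE; move: (p) p0 => q q0; field; by rewrite q0 v0.
Qed.

Hypothesis Ud : is_unit_in S (2 + rsum z).

(** Otherwise [p w] would be a square up to [2 + rsum z], a unit of [S], and a square would have odd
    order at [p]. *)
Lemma tp_unit_odd_unif w : is_unit_in S w -> ~ totpos (p * w).
Proof.
move=> Uw pw; have [[N nN] _ _ _ _] := ar.
have d0 := unit_in_neq0 Ud.
have tpw : tp_unit R (p * w).
  split=> //; apply: unit_inM => //; last exact: Zhalf_unit.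
  exact: unif_unit_half Sr Sp Ueps two_p.
have nsq := @odd_unif_not_square S N p eps k Sr nN Sp Ueps two_p res_p.
have [v [Uv [E|E]]] := class_tp cd tpw; first exact: (nsq w v).
apply: (nsq (w * (2 + rsum z)^-1) v) => //; first by apply: unit_inM => //; apply: unit_inV.
by rewrite mulrA E mulrAC mulfV // mul1r.
Qed.

(** If [j > 0], a nonzero element of [I] would be divisible by every power of [p]. *)
Lemma unif_scale_stable I j : nz_ideal S I -> same_set I (scale_set (p ^+ j) I) -> j = 0%N.
Proof.
move=> nI E; have [IS [_ [_ [_ [x [Ix x0]]]]]] := nI.
have [[N nN] _ _ _ _] := ar.
case: j E => // j E; exfalso.
have H m y : I y -> exists z', S z' /\ y = p ^+ (j.+1 * m) * z'.
  elim: m y => [|m IH] y Iy; first by exists y; rewrite muln0 mul1r; split=> //; apply: IS.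
  have [y' [Iy' yE]] := (E y).1 Iy; have [z' [Sz' E']] := IH _ Iy'.
  by exists z'; split=> //; rewrite yE E' mulnS exprD mulrA.
have [o [y [Sy ny xE]]] := unif_order nN Sp Ueps two_p (IS _ Ix) x0.
have [z' [Sz' E']] := H o.+1 x Ix.
have z'0 : z' != 0 by apply: contraNneq x0 => z'0; rewrite E' z'0 mulr0.
have [c [y' [Sy' ny' zE]]] := unif_order nN Sp Ueps two_p Sz' z'0.
have [] := @unif_pow_inj _ _ _ _ Sr Sp two_p o (j.+1 * o.+1 + c) y y' Sy Sy' ny ny'.
  by rewrite -xE E' zE exprD mulrA.
by move=> h _; move: (leqnn o); rewrite {1}h mulSn -addnA leqNgt (leq_trans (ltnSn o)) // leq_addr.
Qed.

(** The quotient [x = a / (b p)] satisfies [x I = I]. Over [R], where ideals are known to be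
    invertible, this makes [x] a unit, so a power of [p] times a unit [w] of [S]; the power is
    trivial by [unif_scale_stable]. Then [a b = p w b^2] would make [p w] totally positive. *)
Lemma narrow_twist_distinct I a b : nz_ideal S I -> S a -> S b -> a != 0 -> b != 0 ->
  same_set (scale_set a I) (scale_set b (scale_set p I)) -> ~ totpos (a * b).
Proof.
move=> nI Sa Sb a0 b0 E pab; have [[N nN] _ _ _ _] := ar.
have nH := Zhalf_ideal Sr nI; have Im := nz_ideal_submodule nI.
pose x := a / (b * p); have bp0 : b * p != 0 by rewrite mulf_neq0.
have x0 : x != 0 by rewrite mulf_neq0 // invr_eq0.
have Ex : same_set (scale_set x I) I.
  apply: (scale_set_inj bp0); apply: same_set_trans (scale_setA _ _ _) _.
  rewrite /x mulrC divfK //; apply: same_set_trans E _; exact: scale_setA.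
have EH : same_set (scale_set x (Zhalf I)) (Zhalf I).
  by apply: same_set_trans (same_set_sym (Zhalf_scale _ _)) _; apply: Zhalf_same.
have Rx : R x.
  by apply: (mul_stable_ideal Rr (class_inv cd) nH) => y Iy; apply/EH; exists y.
have Rx' : R x^-1.
  apply: (mul_stable_ideal Rr (class_inv cd) nH) => y /EH[y' [Iy' ->]].
  by rewrite mulKf.
have [k' [l [w [Uw wE]]]] := unit_half_split Sr nN Sp Ueps two_p res_p (unit_inP Rx Rx' x0).
have Ew := scale_set_unit Im Uw.
have El : same_set (scale_set (p ^+ l) I) (scale_set (p ^+ k') I).
  apply: same_set_trans (scale_set_same (p ^+ l) (same_set_sym Ex)) _.
  apply: same_set_trans (scale_setA _ _ _) _; rewrite mulrC wE.
  apply: same_set_trans (same_set_sym (scale_setA _ _ _)) _.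
  exact: scale_set_same.
have pk0 m : p ^+ m != 0 by rewrite expf_neq0.
have H m m' : (m <= m')%N -> same_set (scale_set (p ^+ m) I) (scale_set (p ^+ m') I) -> m = m'.
  move=> le Em; apply/eqP; rewrite eqn_leq le -subn_eq0; apply/eqP.
  apply: (unif_scale_stable nI); apply: (scale_set_inj (pk0 m)).
  apply: same_set_trans Em _; apply: same_set_sym.
  by apply: same_set_trans (scale_setA _ _ _) _; rewrite -exprD subnKC.
have kl : k' = l.
  case: (leqP k' l) => [le|/ltnW le]; first exact: H le (same_set_sym El).
  exact/esym/(H _ _ le El).
have xw : x = w by apply: (mulIf (pk0 l)); rewrite wE kl mulrC.
apply: (tp_unit_odd_unif Uw); apply: (@totposMr _ (b ^+ 2)).
  by apply: totpos_sqr => //; apply: (Zadj_rsum_real pz); apply: frac_sub.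
have -> : p * w * b ^+ 2 = a * b by rewrite -xw /x; move: (p) p0 => q q0; field; rewrite b0 q0.
by [].
Qed.

(** Signs can be corrected by units of [R], and such a unit is a power of [p] times a unit of [S].
    The parity of the power tells whether an ideal belongs to a representative or to its twist by
    [p]. *)
Lemma narrow_class_number_double h : class_number S h -> narrow_class_number S (2 * h).
Proof.
move=> [reps [nr [inj cov]]]; rewrite mul2n -addnn; have [[N nN] _ _ _ _] := ar.
pose X (i : 'I_h + 'I_h) := match i with inl i => reps i | inr i => scale_set p (reps i) end.
have tr := fun A B C => @ideal_equiv_trans S A B C Sr.
have pI i : ideal_equiv S (scale_set p (reps i)) (reps i).
  exists 1, p; split; first exact: subring1.
  do 3![split; first by rewrite ?oner_neq0].
  apply: scale_set_unit (unit_in1 Sr); apply: submodule_scale; exact: nz_ideal_submodule.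
have mixed i j : ~ narrow_equiv S (reps i) (scale_set p (reps j)).
  move=> ne; have ij : i = j by apply: inj; apply: tr (narrow_equiv_wide ne) (pI j).
  move: ne; rewrite -ij => -[a [b [Sa [Sb [a0 [b0 [pab E]]]]]]].
  exact: (narrow_twist_distinct (nr i) Sa Sb a0 b0 E pab).
exists (fun i => X (split i)); split; last split.
- move=> i; rewrite /X; case: (split i) => j //; exact: nz_ideal_scale.
- move=> i j; rewrite /X => H; rewrite -(splitK i) -(splitK j); congr unsplit.
  case: (split i) (split j) H => i' [] j' H.
  + by congr inl; apply/inj/narrow_equiv_wide.
  + by case: (mixed _ _ H).
  + by case: (mixed _ _ (narrow_equiv_sym H)).
  + congr inr; apply: inj; apply: (tr _ (scale_set p (reps i'))); first exact/ideal_equiv_sym/pI.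
    exact: tr (narrow_equiv_wide H) (pI j').
move=> I nI; have [i [a [b [Sa [Sb [a0 [b0 E]]]]]]] := cov I nI.
suff [x Hx] : exists x, narrow_equiv S I (X x) by exists (unsplit x); rewrite unsplitK.
have Im := nz_ideal_submodule nI.
have [|e [Ue pe]] := unit_signs_of_arith ar (x := a * b) _ (mulf_neq0 a0 b0).
  exact/(Zhalf_frac Sr)/(frac_sub Sr)/(subringM Sr Sa Sb).
have [k' [l [w [Uw wE]]]] := unit_half_split Sr nN Sp Ueps two_p res_p Ue.
have Sw : S w by case: Uw.
have w0 := unit_in_neq0 Uw.
have real x : S x -> totreal x by move=> Sx; apply: (Zadj_rsum_real pz); apply: frac_sub.
have pk0 m : p ^+ m != 0 by rewrite expf_neq0.
have psq m : totpos ((p ^+ m) ^+ 2).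
  by apply: totpos_sqr => //; apply/real/(subringX Sr _ Sp).
have p1 : totpos (a * b * w * p ^+ (k' + l)).
  have -> : a * b * w * p ^+ (k' + l) = a * b * e * (p ^+ l) ^+ 2.
    have -> : a * b * e * (p ^+ l) ^+ 2 = a * b * (e * p ^+ l) * p ^+ l by ring.
    by rewrite wE exprD; ring.
  exact: totposM.
have Ew : same_set (scale_set (a * w) I) (scale_set b (reps i)).
  apply: same_set_trans E; apply: same_set_trans (same_set_sym (scale_setA _ _ _)) _.
  exact/scale_set_same/(scale_set_unit Im Uw).
have sp m : totpos (p ^+ m.*2) by rewrite -muln2 exprM.
(* Even powers of [p] are totally positive and are dropped; only the parity of the exponent
   remains. *)
rewrite -(odd_double_half (k' + l)) exprD mulrA in p1.
have {}p1 := totposMr (sp _) p1.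
case: (odd _) p1 => p1.
  exists (inr i), (a * w * p), b; split; first by do 2!apply: subringM => //.
  split=> //; split; first by rewrite !mulf_neq0.
  split=> //; split; first by move: p1; rewrite expr1; congr totpos; ring.
  have E1 : same_set (scale_set (a * w * p) I) (scale_set p (scale_set (a * w) I)).
    by rewrite mulrC; apply/same_set_sym/scale_setA.
  apply: same_set_trans E1 _; apply: same_set_trans (scale_set_same p Ew) _.
  exact: scale_setC.
exists (inl i), (a * w), b; split; first exact: subringM.
split=> //; split; first by rewrite mulf_neq0.
split=> //; split=> //; move: p1; rewrite mulr1; congr totpos; ring.
Qed.
End Assembly.

Lemma even_four_pow2 k : ~~ odd (4 * 2 ^ k) /\ (2 < 4 * 2 ^ k)%N.
Proof. by rewrite oddM (leq_trans (_ : _ < 4)%N) // leq_pmulr // expn_gt0. Qed.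

Theorem theorem3p14 (n : nat) (hn : (8 <= n)%N) :
  (forall s : nat, n = (2 ^ s)%N ->
     (forall u, tp_unit (Oring n) u ->
        exists v, is_unit_in (Oring n) v /\ u = v ^+ 2) /\
     (exists ht h, narrow_class_number (Oring n) ht /\ odd ht /\
                   class_number (Oring n) h /\ odd h) /\
     tp_units_mod_squares_card (Rring n) 2) /\
  (forall s : nat, n = (3 * 2 ^ s)%N ->
     (exists h, class_number (Oring n) h /\ narrow_class_number (Rring n) h /\
                odd h /\ narrow_class_number (Oring n) (2 * h)) /\
     tp_units_mod_squares_card (Rring n) 2).
Proof.
split=> s nE.
  have pz : n.-primitive_root (zeta n) by rewrite nE; apply: zeta_prim_pow2.
  have [k nk] : exists k, n = (4 * 2 ^ k)%N.
    by case: s nE hn => [|[|s]] -> // _; exists s; rewrite !expnS mulnA.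
  have [en n2] := even_four_pow2 k; rewrite -nk in en n2.
  have ar : arith_data n (zeta n) by move: pz; rewrite nk; apply: arith_data_pow2.
  have cd : class_data (zeta n) by apply: (@class_data_pow2 k); rewrite -nk.
  have [|j [_ [eps [_ _ Ueps eE]]]] := @unif_pow2 k (zeta n); first by rewrite -nk.
  have [h [hO hR oh]] := class_numbers_odd (t := 2) ar cd Ueps eE.
  split; first by move=> u; apply: (tp_unit_square (t := 2) ar cd Ueps eE erefl).
  split; last exact: tp_units_card en n2 pz cd.
  (* Units of the ring of integers realise all signatures, so narrow and ordinary classes
     coincide. *)
  exists h, h; split=> //.
  apply: (narrow_class_number_wide (Zadj_subring _)) hO.
  apply: (unit_signs_Zadj ar) => y py; apply: (@gen_units_pow2 k); by rewrite -nk.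
(* The bound on [n] excludes 3 and 6, so the tower reaches down to order 12. *)
have [k [nk s0]] : exists k, n = (12 * 2 ^ k)%N /\ (0 < s)%N.
  by case: s nE hn => [|[|s]] -> // _; exists s; rewrite !expnS !mulnA.
have pz : n.-primitive_root (zeta n) by rewrite nE; apply: zeta_prim_three_pow2.
have en : ~~ odd n by rewrite nk oddM.
have n2 : (2 < n)%N by rewrite (leq_trans _ hn).
have ar : arith_data n (zeta n).
  by move: pz; rewrite nk -[12%N]/(6 * 2)%N -mulnA -expnS; apply: arith_data_three_pow2.
have pz' : (12 * 2 ^ k).-primitive_root (zeta n) by rewrite -nk.
have cd := class_data_three_pow2 pz'.
have [j [eps [Ueps eE]]] := unif_three_pow2 pz'.
have [Ud _] := tp_unit_three_pow2 pz'.
have [h [hO hR oh]] := class_numbers_odd (t := 1) ar cd Ueps eE.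
split; last exact: tp_units_card en n2 pz cd.
exists h; split=> //; split; first exact: (narrow_class_number_half ar hR).
split=> //; exact: (narrow_class_number_double (t := 1) pz ar cd Ueps eE Ud hO).
Qed.
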